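(* Let $n\ge 1$, $n<p<\infty$, and let $H:\mathbb{R}^n\to[0,\infty)$ be a strictly convex $C^1$-function with $H(0)=0$, $DH(0)=0$ which is superlinear, i.e. $H(x)/|x|\to\infty$ as $|x|\to\infty$. Suppose that there exist constants $C>1$ and $C'>1$ such that $$\frac{H(2x)}{H(x)}>2C\quad\text{for every }x\in\mathbb{R}^n\setminus\{0\},\qquad\text{and}\qquad \sup_{\partial B(0,r)}H< C'\inf_{\partial B(0,r)}H\quad\text{for every }r>0 .$$ For a bounded function $u\in W^{1,p}(\mathbb{R}^n)$ (continuous representative) let $w$ be the Hopf--Lax (viscosity) solution of $w_t+H(D_xw)=0$ in $\mathbb{R}^n\times(0,\infty)$ with $w(x,0)=u(x)$, that is, $$w(x,t)=\inf_{y\in\mathbb{R}^n}\Big(u(y)+tL\Big(\frac{x-y}{t}\Big)\Big),\qquad L(q)=\sup_{z\in\mathbb{R}^n}\big(z\cdot q-H(z)\big).$$ Then $D_xw(\cdot,t)\to Du$ in $L^p(\mathbb{R}^n)$ as $t\to 0^+$. Moreover, there is a constant $C(p,n,H)$, depending only on $p$, $n$ and $H$, such that $\|D_xw(\cdot,t)\|_{L^p(\mathbb{R}^n)}\le C(p,n,H)\,\|Du\|_{L^p(\mathbb{R}^n)}$ for every $t>0$ and every bounded $u\in W^{1,p}(\mathbb{R}^n)$.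
   Context: Since $p>n$, every $u\in W^{1,p}(\mathbb{R}^n)$ is identified with its continuous representative. $L$ is the Legendre--Fenchel transform of $H$. For each $t>0$ the function $w(\cdot,t)$ is Lipschitz on $\mathbb{R}^n$, hence differentiable almost everywhere, and $D_xw(\cdot,t)$ denotes its almost everywhere defined spatial gradient. $Du$ denotes the weak gradient of $u$. $B(0,r)$ is the open ball of radius $r$ centred at $0$. *)

(* Defs.v *)
From HB Require Import structures.
From mathcomp Require Import all_boot all_order all_algebra.
From mathcomp Require Import all_classical all_reals all_analysis.

Set Implicit Arguments.
Unset Strict Implicit.
Unset Printing Implicit Defensive.

Import Order.TTheory GRing.Theory Num.Theory.
Import numFieldNormedType.Exports.

Local Open Scope classical_set_scope.
Local Open Scope ring_scope.

(* The library has no Lebesgue measure on R^n; it is built here on 'rV[R]_n by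
   iterating the product with the one-dimensional Lebesgue measure.  The
   sigma-algebra is the one generated by the coordinates, as the library does
   for n.-tuple; for R^n it is the Borel sigma-algebra. *)
Section measurable_rV.
Context {R : realType} (n : nat).

Definition rV_coord (i : 'I_n) (x : 'rV[R]_n) : measurableTypeR R := x ord0 i.

Let rV_set0 : g_sigma_preimage rV_coord set0.
Proof. exact: sigma_algebra0. Qed.

Let rV_setC A : g_sigma_preimage rV_coord A -> g_sigma_preimage rV_coord (~` A).
Proof. exact: sigma_algebraC. Qed.

Let rV_bigcup (F : (set 'rV[R]_n)^nat) :
  (forall i, g_sigma_preimage rV_coord (F i)) ->
  g_sigma_preimage rV_coord (\bigcup_i (F i)).
Proof. exact: sigma_algebra_bigcup. Qed.

HB.instance Definition _ := @isMeasurable.Build default_measure_display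
  'rV[R]_n (g_sigma_preimage rV_coord) rV_set0 rV_setC rV_bigcup.

End measurable_rV.

Lemma measurable_rV_coord (R : realType) n (i : 'I_n) :
  measurable_fun [set: 'rV[R]_n] (rV_coord i).
Proof.
move=> _ Y mY; rewrite setTI; apply: sub_sigma_algebra => /=.
rewrite -bigcup_seq/=; exists i => /=; first by rewrite mem_index_enum.
by exists Y => //; rewrite setTI.
Qed.

Lemma measurable_fun_rVP (R : realType) d (T : measurableType d) n
    (f : T -> 'rV[R]_n) :
  (forall i, measurable_fun [set: T] (rV_coord i \o f)) ->
  measurable_fun [set: T] f.
Proof.
move=> mf; apply: measurability => //.
move=> _ [A + <-]; rewrite -bigcup_seq => -[i _ [B mB <-]].
by rewrite !setTI -comp_preimage -[X in measurable X]setTI; exact: mf.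
Qed.

Section lebesgue_rV.
Context {R : realType}.

Definition rV_cons n (xv : measurableTypeR R * 'rV[R]_n) : 'rV[R]_n.+1 :=
  \row_i oapp (xv.2 ord0) xv.1 (unlift ord0 i).

Definition rV_uncons n (v : 'rV[R]_n.+1) : measurableTypeR R * 'rV[R]_n :=
  (v ord0 ord0, \row_i v ord0 (lift ord0 i)).

Lemma rV_consK n : cancel (@rV_cons n) (@rV_uncons n).
Proof.
move=> [x v]; rewrite /rV_uncons /rV_cons mxE unlift_none/=; congr pair.
by apply/rowP => i; rewrite !mxE liftK.
Qed.

Lemma measurable_rV_cons n : measurable_fun setT (@rV_cons n).
Proof.
apply: measurable_fun_rVP => i; case: (unliftP ord0 i) => [j ->|->].
- rewrite (_ : _ \o _ = rV_coord j \o snd); last first.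
    by apply/funext => xv; rewrite /rV_coord /= mxE liftK.
  exact: measurableT_comp (measurable_rV_coord j) measurable_snd.
- rewrite (_ : _ \o _ = fst); first exact: measurable_fst.
  by apply/funext => xv; rewrite /rV_coord /= mxE unlift_none.
Qed.

Lemma measurable_rV_uncons n : measurable_fun setT (@rV_uncons n).
Proof.
apply: measurable_fun_pair; first exact: (measurable_rV_coord ord0).
apply: measurable_fun_rVP => i.
rewrite (_ : _ \o _ = rV_coord (lift ord0 i)).
  exact: measurable_rV_coord.
by apply/funext => v; rewrite /rV_coord /= mxE.
Qed.

Section step.
Local Open Scope ereal_scope.
Variables (n : nat) (mu : {sigma_finite_measure set 'rV[R]_n -> \bar R}).

Definition lebesgue_step : set 'rV[R]_n.+1 -> \bar R :=
  pushforward (lebesgue_measure \x mu) (@rV_cons n).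

Let mcons (A : set 'rV[R]_n.+1) :
  measurable A -> measurable (@rV_cons n @^-1` A).
Proof. by move=> mA; rewrite -[X in measurable X]setTI; exact: measurable_rV_cons. Qed.

Let step0 : lebesgue_step set0 = 0.
Proof. by rewrite /lebesgue_step /pushforward preimage_set0 measure0. Qed.

Let step_ge0 A : 0 <= lebesgue_step A.
Proof. by apply: integral_ge0 => x _; exact: measure_ge0. Qed.

Let step_sigma_additive : semi_sigma_additive lebesgue_step.
Proof.
move=> F mF tF mUF; rewrite /lebesgue_step /pushforward preimage_bigcup.
apply: measure_semi_sigma_additive.
- by move=> k; exact: mcons.
- apply/trivIsetP => /= i j _ _ ij; rewrite -preimage_setI.
  by move/trivIsetP : tF => /(_ _ _ _ _ ij) ->//; rewrite preimage_set0.
- by rewrite -preimage_bigcup; exact: mcons.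
Qed.

HB.instance Definition _ := isMeasure.Build _ _ _ lebesgue_step
  step0 step_ge0 step_sigma_additive.

(* Proved by hand: the SigmaFiniteMeasure instance that the library finds on
   _ \x _ is the one for subprobabilities. *)
Let prod_sigma_finite : sigma_finite setT (lebesgue_measure \x mu).
Proof.
have /sigma_finiteP[F [TF ndF Foo]] := sigma_finiteT (@lebesgue_measure R).
have /sigma_finiteP[G [TG ndG Goo]] := sigma_finiteT mu.
exists (fun k => F k `*` G k).
  rewrite -setXTT TF TG predeqE => -[x y]; split.
    move=> [/= [k _ Fkx] [l _ Gly]]; exists (maxn k l) => //; split.
    - by move: x Fkx; exact/subsetPset/ndF/leq_maxl.
    - by move: y Gly; exact/subsetPset/ndG/leq_maxr.
  by move=> [k _ []/= ? ?]; split; exists k.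
move=> k; have [? ?] := Foo k; have [? ?] := Goo k.
split; first exact: measurableX.
by rewrite product_measure1E// lte_mul_pinfty// ge0_fin_numE.
Qed.

Let step_sigma_finite : sigma_finite setT lebesgue_step.
Proof.
have [F TF Foo] := prod_sigma_finite.
exists (fun k => @rV_uncons n @^-1` F k).
  by rewrite -preimage_bigcup -TF preimage_setT.
move=> k; have [mF Fk] := Foo k; split.
  by rewrite -[X in measurable X]setTI; exact: measurable_rV_uncons.
rewrite /lebesgue_step /pushforward -comp_preimage.
rewrite (_ : _ \o _ = idfun) ?preimage_id//.
by apply/funext => xv; exact: rV_consK.
Qed.

HB.instance Definition _ := Measure_isSigmaFinite.Build _ _ _ lebesgue_step
  step_sigma_finite.

End step.

Fixpoint lebesgue_rV n : {sigma_finite_measure set 'rV[R]_n -> \bar R} :=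
  if n is m.+1 then lebesgue_step (lebesgue_rV m) else \d_(0 : 'rV[R]_0).

Lemma lebesgue_rV_box n (A : 'I_n -> set (measurableTypeR R)) :
  (forall i, measurable (A i)) ->
  lebesgue_rV n [set x | forall i, A i (x ord0 i)] =
  (\prod_(i < n) lebesgue_measure (A i))%E.
Proof.
elim: n A => [|n IH] A mA.
  rewrite big_ord0 /= diracE mem_set//.
  by move=> [].
pose B := [set x : 'rV[R]_n | forall i, A (lift ord0 i) (x ord0 i)].
rewrite big_ord_recl /= -(IH (fun i => A (lift ord0 i)))// -/B.
rewrite /lebesgue_step /pushforward.
have mB : measurable B.
  rewrite (_ : B = \bigcap_(i in [set: 'I_n]) (rV_coord i @^-1` A (lift ord0 i))).
    apply: fin_bigcap_measurable => // i _.
    by rewrite -[X in measurable X]setTI; exact: measurable_rV_coord.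
  by apply/seteqP; split=> x /= h i; [move=> _|]; exact: h.
rewrite -product_measure1E//; congr (product_measure1 _ _ _).
apply/seteqP; split => -[x v] /=.
  move=> h; split => [|i].
    by have := h ord0; rewrite mxE unlift_none.
  by have := h (lift ord0 i); rewrite mxE liftK.
move=> [Ax Bv] i; rewrite mxE.
by case: (unliftP ord0 i) => [j ->|->] //=; exact: Bv.
Qed.

End lebesgue_rV.

Section euclidean.
Context {R : realType} {n : nat}.
Implicit Types x y : 'rV[R]_n.

Definition dot x y : R := \sum_(i < n) x ord0 i * y ord0 i.

(* The library norm `|x| on 'rV[R]_n is the maximum norm; the Euclidean norm
   induces the same topology. *)
Definition enorm x : R := Num.sqrt (dot x x).

Definition eball (r : R) : set 'rV[R]_n := [set x | enorm x < r].

Definition boundary (A : set 'rV[R]_n) : set 'rV[R]_n := closure A `\` A°.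

Definition strictly_convex (f : 'rV[R]_n -> R) : Prop :=
  forall x y (s : R), x != y -> 0 < s < 1 ->
    f (s *: x + (1 - s) *: y) < s * f x + (1 - s) * f y.

Definition superlinear (f : 'rV[R]_n -> R) : Prop :=
  forall M : R, exists r : R, forall x, r < enorm x -> M < f x / enorm x.

Definition partial (f : 'rV[R]_n -> R) (i : 'I_n) : 'rV[R]_n -> R :=
  fun x => 'D_(delta_mx ord0 i) f x.

(* Total: a coordinate is an unspecified real where that partial derivative
   does not exist, so gradient f is meaningful only up to a null set when f is
   differentiable almost everywhere. *)
Definition gradient (f : 'rV[R]_n -> R) (x : 'rV[R]_n) : 'rV[R]_n :=
  \row_i partial f i x.

Fixpoint class_C (k : nat) (f : 'rV[R]_n -> R) : Prop :=
  if k is k'.+1 then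
    (forall x, differentiable f x) /\ (forall i, class_C k' (partial f i))
  else continuous f.

Definition test_function (phi : 'rV[R]_n -> R) : Prop :=
  (forall k, class_C k phi) /\ compact (closure [set x | phi x != 0]).

Definition Lp (p : R) (f : 'rV[R]_n -> R) : Prop :=
  f \in Lfun (lebesgue_rV n) p%:E.

Definition Lp_vec (p : R) (g : 'rV[R]_n -> 'rV[R]_n) : Prop :=
  forall i : 'I_n, Lp p (fun x => g x ord0 i).

Definition Lp_vec_norm (p : R) (g : 'rV[R]_n -> 'rV[R]_n) : \bar R :=
  ('N[lebesgue_rV n]_p%:E [(fun x => (enorm (g x))%:E)])%E.

Definition weak_gradient (u : 'rV[R]_n -> R) (Du : 'rV[R]_n -> 'rV[R]_n) : Prop :=
  forall (i : 'I_n) (phi : 'rV[R]_n -> R), test_function phi ->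
    \int[lebesgue_rV n]_x (u x * partial phi i x) =
    - \int[lebesgue_rV n]_x (Du x ord0 i * phi x).

(* u belongs to W^{1,p}(R^n) and Du is its weak gradient. *)
Definition sobolev_W1 (p : R) (u : 'rV[R]_n -> R) (Du : 'rV[R]_n -> 'rV[R]_n) : Prop :=
  [/\ Lp p u, Lp_vec p Du & weak_gradient u Du].

Definition legendre (H : 'rV[R]_n -> R) (q : 'rV[R]_n) : R :=
  sup [set dot z q - H z | z in [set: 'rV[R]_n]].

(* Used for t > 0 only. *)
Definition hopf_lax (H u : 'rV[R]_n -> R) (t : R) (x : 'rV[R]_n) : R :=
  inf [set u y + t * legendre H (t^-1 *: (x - y)) | y in [set: 'rV[R]_n]].

End euclidean.

(* Main.v *)
Require Import Defs.
From HB Require Import structures.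
From mathcomp Require Import all_boot all_order all_algebra.
From mathcomp Require Import all_classical all_reals all_analysis.
From mathcomp Require Import measurable_realfun ring lra.

Import Order.TTheory GRing.Theory Num.Theory.
Import numFieldNormedType.Exports.

Set Implicit Arguments.
Unset Strict Implicit.
Unset Printing Implicit Defensive.

Local Open Scope classical_set_scope.
Local Open Scope ring_scope.

(* With y = x - t v, w(x) = min_v u(x - t v) + t L(v).  If all minimizers v at x give
   the same coordinate (DL(v))_i, then the partial derivative of w exists and equals
   it; otherwise w has a concave kink at x in the direction e_i, and each line
   carries only countably many kinks.  So D w(x) = DL(v) a.e.  Minimality gives
   t L(v) <= u(x) - u(x - t v), Morrey's inequality bounds the right-hand side by
   C t |v| M(x)^(1/s), where M is the maximal function of |Du|^s and n < s < p, and
   the two conditions on H give |DL(v)| |v| <= K L(v).  So |D w| <= K' M^(1/s),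
   uniformly in t, with M^(1/s) in L^p by the maximal inequality; convergence holds
   a.e. by differentiability of u, and in L^p by domination. *)

(** * Lebesgue measure on row vectors *)

(** The exponent s is squeezed from both sides: Morrey's inequality needs s > n, and the maximal
    inequality for |Du|^s in L^(p/s) needs p/s > 1. Neither smoothing of u nor a differentiability
    theorem for Lipschitz functions is invoked. Averages of u are taken against smooth product
    weights on boxes, so that the difference of two averages is u integrated against a derivative of
    a product test function and the weak gradient enters at once. The regularity of w comes from L
    alone: moving x and v together leaves the foot point x - t v in place, so u drops out of the
    comparison. The inequality |DL(v)| |v| <= K L(v) is where both conditions on H act: a doubling
    factor above 2 makes H(2^-k q) small against 2^-k, and comparability on spheres transfers this
    from q to the multiple of v of the same length. Since t cancels in the bound on L(v), dividing
    by |v| leaves a majorant free of t, which serves both the L^p bound and the dominated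
    convergence. *)

Section cubes.
Context {R : realType} {n : nat}.
Local Notation vec := 'rV[R]_n.
Implicit Types (x y : vec) (r : R).

(** [ball] is taken in the maximum norm, so every ball below is an open cube of side [2 * r], a
    product of intervals. *)
Lemma ball_rVP x r y :
  ball x r y <-> 0 < r /\ forall j, `|x ord0 j - y ord0 j| < r.
Proof.
split=> -[r0 h]; split=> //; first by move=> j; exact: (h ord0 j).
by move=> i j; rewrite (ord1 i); exact: h.
Qed.

Lemma norm_coord_le x (j : 'I_n) : `|x ord0 j| <= `|x|.
Proof.
rewrite [leRHS]/Num.Def.normr /= mx_normrE; apply/bigmax_geP; right => /=.
by exists (ord0, j).
Qed.

Lemma norm_rV_le x r : 0 <= r -> (forall j, `|x ord0 j| <= r) -> `|x| <= r.
Proof.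
move=> r0 h; rewrite [leLHS]/Num.Def.normr /= mx_normrE; apply/bigmax_leP.
by split=> // -[i j] _ /=; rewrite (ord1 i).
Qed.

Lemma measurable_ball_rV x r : measurable (ball x r).
Proof.
have [r0|r0] := ltP 0 r; last first.
  rewrite (_ : ball x r = set0)//; apply/seteqP; split=> // y /ball_rVP[].
  by rewrite ltNge r0.
rewrite (_ : ball x r = \bigcap_(j in [set: 'I_n])
    (rV_coord j @^-1` ball (x ord0 j) r)).
  apply: fin_bigcap_measurable => // j _.
  rewrite -[X in measurable X]setTI; apply: measurable_rV_coord => //.
  exact: measurable_ball.
apply/seteqP; split=> y /=; first by move=> /ball_rVP[_ h] j _; exact: h.
by move=> h; apply/ball_rVP; split=> // j; exact: (h j I).
Qed.

Lemma lebesgue_rV_ball x r : 0 < r ->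
  lebesgue_rV n (ball x r) = ((2 * r) ^+ n)%:E.
Proof.
move=> r0.
rewrite (_ : ball x r = [set y | forall i, ball (x ord0 i) r (y ord0 i)]).
  rewrite (lebesgue_rV_box (A := fun i => ball (x ord0 i) r)); last first.
    by move=> i; exact: measurable_ball.
  under eq_bigr do rewrite lebesgue_measure_ball ?ltW//.
  by rewrite prodEFin prodr_const card_ord mulr_natl.
by apply/seteqP; split=> y /=; [move/ball_rVP => []|move=> h; apply/ball_rVP].
Qed.

Lemma rat_rV_approx x r : 0 < r ->
  exists q : 'rV[rat]_n, ball x r (map_mx ratr q).
Proof.
move=> r0.
have h j : exists q : rat, `|x ord0 j - ratr q| < r.
  have [|q] := @rat_in_itvoo R (x ord0 j - r) (x ord0 j + r).
    by rewrite ltrD2l; rewrite gtrN.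
  rewrite in_itv/= => /andP[h1 h2]; exists q.
  by rewrite ltr_norml; apply/andP; split; lra.
exists (\row_j projT1 (cid (h j))); apply/ball_rVP; split=> // j.
by rewrite !mxE; case: cid.
Qed.

(** The sigma-algebra is generated by the coordinates, so an open set has to be exhibited as a
    countable union: the cubes with rational centre and radius 1/(k+1) that it contains. *)
Lemma open_measurable_rV (U : set vec) : open U -> measurable U.
Proof.
move=> oU.
pose F (qk : 'rV[rat]_n * nat) : set vec :=
  if `[< ball (map_mx ratr qk.1 : vec) (qk.2.+1%:R^-1) `<=` U >]
  then ball (map_mx ratr qk.1 : vec) (qk.2.+1%:R^-1) else set0.
rewrite (_ : U = \bigcup_qk F qk).
  apply: countable_bigcupT_measurable; first exact: countableP.
  by move=> qk; rewrite /F; case: ifP => // _; exact: measurable_ball_rV.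
apply/seteqP; split=> [x Ux|x [qk _]]; last first.
  by rewrite /F; case: asboolP => // h /h.
have /nbhs_ballP[/= e e0 eU] : nbhs x U by exact: open_nbhs_nbhs.
have [k ke] : exists k : nat, k.+1%:R^-1 < e / 2.
  have [k _ hk] := near_infty_natSinv_lt (PosNum (divr_gt0 e0 (ltr0n R 2))).
  by exists k; exact: hk (leqnn _).
have k0 : (0 : R) < k.+1%:R^-1 by rewrite invr_gt0 ltr0n.
have [q qx] := rat_rV_approx x k0.
exists (q, k) => //; rewrite /F /=; case: asboolP.
  by move=> _; exact: ball_sym.
case=> y yq; apply: eU; rewrite [e](splitr e).
apply: ball_triangle; [exact: le_ball (ltW ke) _ qx|exact: le_ball (ltW ke) _ yq].
Qed.

Lemma closed_measurable_rV (F : set vec) : closed F -> measurable F.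
Proof.
move=> cF; rewrite -[F]setCK; apply: measurableC; apply: open_measurable_rV.
exact: closed_openC.
Qed.

Lemma continuous_measurable_rV (f : vec -> R) :
  continuous f -> measurable_fun setT f.
Proof.
move=> /continuousP cf; apply: (measurability _ (RGenOpens.measurableE R)).
move=> _ [_ [a [b ->]] <-]; rewrite setTI; apply: open_measurable_rV.
by apply: cf; exact: interval_open.
Qed.

End cubes.

(** * Null sets by Fubini on parallel lines *)

Section lines.
Context {R : realType}.

(** Induction on the dimension. If [i] is a later coordinate, the slices with fixed first coordinate
    satisfy the same hypothesis one dimension lower; if [i] is the first one, the sections in that
    coordinate are countable sets of reals. *)
Lemma lebesgue_rV_null_lines n (i : 'I_n) (A : set 'rV[R]_n) :
  measurable A ->
  (forall x, countable [set s : R | A (x + s *: delta_mx ord0 i)]) ->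
  lebesgue_rV n A = 0%E.
Proof.
elim: n i A => [[]//|n IH] i A mA cA.
have mB : measurable (@rV_cons R n @^-1` A).
  by rewrite -[X in measurable X]setTI; exact: measurable_rV_cons.
rewrite /= /lebesgue_step /pushforward.
have [j ij|i0] := unliftP ord0 i.
- rewrite /product_measure1 /=; apply: integral0_eq => s _ /=.
  apply: (IH j); first exact: measurable_xsection.
  move=> x; apply: sub_countable (cA (rV_cons (s, x))).
  apply: subset_card_le => t /=; rewrite /xsection/= inE/= ij.
  congr A; apply/rowP => k; rewrite !mxE /=.
  case: (unliftP ord0 k) => [l ->|->] /=; rewrite ?mxE ?eqxx/=.
    by rewrite (inj_eq lift_inj).
  by rewrite mulr0 addr0.
(* [lebesgue_rV] integrates the first coordinate last. Here it has to be integrated first, and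
   uniqueness of the product measure allows the exchange. *)
- transitivity ((lebesgue_measure \x^ lebesgue_rV n)%E (@rV_cons R n @^-1` A)).
    apply: product_measure_unique => // B C mB' mC'.
    exact: product_measure2E.
  rewrite /product_measure2 /=; apply: integral0_eq => v _ /=.
  apply: countable_lebesgue_measure0.
  apply: sub_countable (cA (rV_cons (0, v))).
  apply: subset_card_le => t /=; rewrite /ysection/= inE/= i0.
  congr A; apply/rowP => k; rewrite !mxE /=.
  case: (unliftP ord0 k) => [l ->|->] /=; rewrite ?eqxx/= ?mxE.
    by rewrite mulr0 addr0.
  by rewrite mulr1 add0r.
Qed.

End lines.

Section tensor.
Context {R : realType}.

(** Products of one-variable functions: integrals factor and a partial derivative touches a single
    factor, so the calculus of test functions reduces to dimension one. *)
Definition tensor n (g : 'I_n -> R -> R) (x : 'rV[R]_n) : R :=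
  \prod_i g i (x ord0 i).

Lemma tensor_rV_cons n (g : 'I_n.+1 -> R -> R) z :
  tensor g (rV_cons z) = g ord0 z.1 * tensor (fun i => g (lift ord0 i)) z.2.
Proof.
rewrite /tensor big_ord_recl /rV_cons mxE unlift_none /=; congr (_ * _).
by apply: eq_bigr => i _; rewrite mxE liftK.
Qed.

Lemma integrable_rV_cons n (f : 'rV[R]_n.+1 -> \bar R) :
  measurable_fun setT f ->
  (lebesgue_measure \x lebesgue_rV n)%E.-integrable setT (f \o @rV_cons R n) ->
  (lebesgue_rV n.+1).-integrable setT f.
Proof.
move=> mf if_.
have := integrable_pushforward (@measurable_rV_cons R n) mf if_ measurableT.
by case/integrableP => _ foo; apply/integrableP; split.
Qed.

Lemma integral_rV_cons n (f : 'rV[R]_n.+1 -> \bar R) :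
  measurable_fun setT f ->
  (lebesgue_measure \x lebesgue_rV n)%E.-integrable setT (f \o @rV_cons R n) ->
  (\int[lebesgue_rV n.+1]_x f x =
   \int[lebesgue_measure]_s \int[lebesgue_rV n]_v f (rV_cons (s, v)))%E.
Proof.
move=> mf if_.
transitivity (\int[lebesgue_measure \x lebesgue_rV n]_z f (rV_cons z))%E.
  have := integral_pushforward (@measurable_rV_cons R n) mf if_ measurableT.
  rewrite preimage_setT; apply: etrans.
  by apply: eq_measure_integral => //; exact: measurable_rV_cons.
by rewrite -integral12_prod_meas1.
Qed.

Lemma measurable_tensor n (g : 'I_n -> R -> R) :
  (forall i, measurable_fun setT (g i)) -> measurable_fun setT (tensor g).
Proof.
move=> mg; apply: measurable_prod => i _.
exact: measurableT_comp (mg i) (measurable_rV_coord i).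
Qed.

Lemma tensor_integrable_integral n (g : 'I_n -> R -> R) :
  (forall i, (@lebesgue_measure R).-integrable setT (EFin \o g i)) ->
  (lebesgue_rV n).-integrable setT (EFin \o tensor g) /\
  (\int[lebesgue_rV n]_x tensor g x =
   \prod_i \int[lebesgue_measure]_s g i s)%R.
Proof.
elim: n g => [|n IH] g ig.
  have m0 : lebesgue_rV 0 [set: 'rV[R]_0] = 1%E.
    by rewrite (_ : lebesgue_rV 0 = \d_(0 : 'rV[R]_0) :> (set _ -> _))// diracT.
  have E : EFin \o tensor g = cst 1%E.
    by apply/funext => x; rewrite /tensor /= big_ord0.
  split; last first.
    rewrite big_ord0 /Rintegral.
    rewrite [X in integral _ _ X](_ : _ = cst 1%E) ?integral_cst//.
    by rewrite mul1e -[RHS]/(fine 1%E); congr fine; exact: m0.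
  rewrite E; apply/integrableP; split; first exact: measurable_cst.
  under eq_integral do rewrite /= normr1.
  rewrite integral_cst// mul1e; exact: (eq_ind_r (fun z => z < +oo)%E (ltry 1) m0).
have mg i : measurable_fun setT (g i).
  by apply/measurable_EFinP; exact: (measurable_int _ (ig i)).
have [iI eI] := IH (fun i => g (lift ord0 i)) (fun i => ig _).
set h := tensor (fun i => g (lift ord0 i)) in iI eI.
have mh : measurable_fun setT h.
  by apply/measurable_EFinP; exact: (measurable_int _ iI).
have mt : measurable_fun setT (tensor g) by exact: measurable_tensor.
have hE s v : (EFin \o tensor g) (rV_cons (s, v)) = ((g ord0 s)%:E * (h v)%:E)%E.
  by rewrite /= tensor_rV_cons EFinM.
have i2 : (lebesgue_measure \x lebesgue_rV n)%E.-integrable setT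
    ((EFin \o tensor g) \o @rV_cons R n).
  apply/integrable12ltyP.
    apply: measurableT_comp; last exact: measurable_rV_cons.
    exact/measurable_EFinP.
  under eq_integral => s _.
    under eq_integral => v _ do rewrite -[X in abse X]/((EFin \o tensor g) (rV_cons (s, v))) hE abseM.
    rewrite ge0_integralZl//; last exact/measurableT_comp/measurable_EFinP.
  over.
  have /integrableP[_ h1] := iI; have /integrableP[m2 h2] := ig ord0.
  rewrite ge0_integralZr//; last 2 first.
  - exact: measurableT_comp.
  - exact: integral_ge0.
  by apply: lte_mul_pinfty; rewrite ?integral_ge0 ?ge0_fin_numE ?integral_ge0.
split; first by apply: integrable_rV_cons => //; exact/measurable_EFinP.
have hfin : (\int[lebesgue_rV n]_x (h x)%:E)%E \is a fin_num.
  exact: integrable_fin_num.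
have gfin : (\int[lebesgue_measure]_s (g ord0 s)%:E)%E \is a fin_num.
  exact: integrable_fin_num (ig ord0).
rewrite big_ord_recl -eI /Rintegral -fineM//.
congr fine; rewrite integral_rV_cons//; last exact/measurable_EFinP.
transitivity (\int[lebesgue_measure]_s
    ((g ord0 s)%:E * \int[lebesgue_rV n]_x (h x)%:E))%E.
  apply: eq_integral => s _; rewrite -integralZl//.
  by apply: eq_integral => v _; rewrite -hE.
by rewrite -(fineK hfin); apply: integralZr => //; exact: ig.
Qed.

End tensor.

(** * Smooth cutoffs and product test functions *)

Section smooth1.
Context {R : realType}.
Implicit Types (f g : R -> R) (k : nat).

(** The derivative is carried as a witness instead of being computed by the derivation operator, so
    that stability under sums, products, inverses and affine changes is a plain induction on [k]. *)
Fixpoint smooth1 k f : Prop :=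
  if k is k'.+1 then
    exists f', (forall x : R, is_derive x 1 f (f' x)) /\ smooth1 k' f'
  else continuous f.

Lemma is_derive_continuous f f' :
  (forall x : R, is_derive x 1 f (f' x)) -> continuous f.
Proof.
move=> h x; apply: differentiable_continuous; apply/derivable1_diffP.
by have [] := h x.
Qed.

Lemma smooth1_continuous k f : smooth1 k f -> continuous f.
Proof. by case: k => // k [f' [/is_derive_continuous]]. Qed.

Lemma smooth1W k f : smooth1 k.+1 f -> smooth1 k f.
Proof.
elim: k f => [|k IH] f; first exact: smooth1_continuous.
by move=> [f' [df' /IH h]]; exists f'.
Qed.

Lemma smooth1D k f g : smooth1 k f -> smooth1 k g ->
  smooth1 k (fun x => f x + g x).
Proof.
elim: k f g => [|k IH] f g.
  by move=> cf cg x; apply: cvgD; [exact: cf|exact: cg].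
move=> [f' [df sf]] [g' [dg sg]]; exists (fun x => f' x + g' x).
by split; [move=> x; apply: is_deriveD|exact: IH].
Qed.

Lemma smooth1_cst k (c : R) : smooth1 k (fun=> c).
Proof.
elim: k c => [|k IH] c; first by move=> x; exact: cvg_cst.
exists (fun=> 0); split; last exact: IH.
by move=> x; exact: is_derive_cst.
Qed.

Lemma smooth1M k f g : smooth1 k f -> smooth1 k g ->
  smooth1 k (fun x => f x * g x).
Proof.
elim: k f g => [|k IH] f g.
  by move=> cf cg x; apply: cvgM; [exact: cf|exact: cg].
move=> sf sg; have [f' [df sf']] := sf; have [g' [dg sg']] := sg.
exists (fun x => f' x * g x + f x * g' x); split; last first.
  by apply: smooth1D; apply: IH => //; exact: smooth1W.
move=> x; apply: (is_derive_eq (is_deriveM (df x) (dg x))).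
by rewrite /GRing.scale /=; ring.
Qed.

Lemma is_derive_affine (a b x : R) : is_derive x 1 (fun y => a * y + b) a.
Proof.
by apply: is_derive_eq; last by rewrite -[RHS]addr0; congr (_ + _); rewrite -[RHS]mulr1.
Qed.

Lemma smooth1_affine k (a b : R) f : smooth1 k f ->
  smooth1 k (fun x => f (a * x + b)).
Proof.
have da := is_derive_affine a b.
elim: k f => [|k IH] f.
  by move=> cf x; apply: continuous_comp; [exact: is_derive_continuous da x|exact: cf].
move=> [f' [df sf]]; exists (fun x => a * f' (a * x + b)); split.
  move=> x; apply: (is_derive_eq (is_derive1_comp (df _) (da x))).
  by rewrite mulrC.
by apply: smooth1M; [exact: smooth1_cst|exact: IH].
Qed.

Lemma smooth1V k f : (forall x, f x != 0) -> smooth1 k f ->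
  smooth1 k (fun x => (f x)^-1).
Proof.
move=> f0; elim: k => [|k IH].
  by move=> cf x; apply: cvgV; [exact: f0|exact: cf].
move=> sf; have [f' [df sf']] := sf.
exists (fun x => -1 * ((f x)^-1 * (f x)^-1 * f' x)); split; last first.
  apply: smooth1M; first exact: smooth1_cst.
  by apply: smooth1M => //; apply: smooth1M; apply: IH; exact: smooth1W.
move=> x; apply: (is_derive_eq (is_deriveV (f0 x) (df x))).
by rewrite /GRing.scale /= mulN1r -exprVn expr2 mulNr.
Qed.

Lemma smooth1_derive f f' : (forall x : R, is_derive x 1 f (f' x)) ->
  (forall k, smooth1 k f) -> forall k, smooth1 k f'.
Proof.
move=> df sf k; have [g [dg sg]] := sf k.+1.
rewrite (_ : f' = g)//; apply/funext => x.
by rewrite -[LHS](@derive_val _ _ _ _ _ _ _ (df x)) (@derive_val _ _ _ _ _ _ _ (dg x)).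
Qed.

(* All the powers are needed: the family is stable under differentiation. *)
Definition flat m (x : R) : R := if 0 < x then x^-1 ^+ m * expR (- x^-1) else 0.

Lemma flat_ge0 m x : 0 <= flat m x.
Proof.
rewrite /flat; case: ifPn => // x0.
by rewrite mulr_ge0 ?expR_ge0 ?exprn_ge0// invr_ge0 ltW.
Qed.

(** With y = 1/x, the bound exp y >= y^(m+1)/(m+1)! leaves one factor x to spare, which gives
    continuity at 0. *)
Lemma flat_le m x : flat m x <= m.+1`!%:R * `|x|.
Proof.
rewrite /flat; case: ifPn => x0; last by rewrite mulr_ge0.
have y0 : 0 < x^-1 by rewrite invr_gt0.
have h := @expR_ge1Dxn _ x^-1 m (ltW y0).
have {}h : x^-1 ^+ m.+1 / m.+1`!%:R <= expR x^-1 by lra.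
rewrite ler_pdivrMr ?ltr0n ?fact_gt0// in h.
rewrite gtr0_norm// expRN ler_pdivrMr ?expR_gt0//.
have -> : x^-1 ^+ m = x * x^-1 ^+ m.+1 by rewrite exprS mulrA divff ?mul1r// gt_eqF.
by rewrite mulrAC (mulrC _ x) ler_pM2l// mulrC.
Qed.

Lemma flat_mul m x : flat m x = x * flat m.+1 x.
Proof.
rewrite /flat; case: ifPn => x0; last by rewrite mulr0.
by rewrite exprS !mulrA divff ?mul1r// gt_eqF.
Qed.

Lemma flat_continuous0 m : {for 0, continuous (flat m)}.
Proof.
rewrite /continuous_at /prop_for {2}/flat ltxx.
have h0 : (fun x : R => m.+1`!%:R * `|x|) @ nbhs (0 : R) --> (0 : R).
  rewrite -[X in _ --> X](mulr0 m.+1`!%:R); apply: cvgMr.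
  by rewrite -[X in _ --> X](@normr0 _ R); apply: cvg_norm; exact: cvg_id.
apply: (@squeeze_cvgr _ _ _ _ (cst 0) _ _ _ _ _ h0); last exact: cvg_cst.
by near=> x; rewrite flat_ge0 flat_le.
Unshelve. all: by end_near. Qed.

Lemma is_derive_flat m (x : R) :
  is_derive x 1 (flat m) (- m%:R * flat m.+1 x + flat m.+2 x).
Proof.
have [x0|x0|->] := ltgtP x 0.
- rewrite /flat ltNge (ltW x0) /= mulr0 addr0.
  apply: (near_eq_is_derive _ (is_derive_cst (0 : R) x 1)).
  near=> y; rewrite /flat ltNge ltW//=.
  by near: y; exact: lt_nbhsl.
- have xn0 : x != 0 by rewrite gt_eqF.
  have dV : is_derive x 1 (fun y : R => y^-1) (- x ^- 2).
    apply: (is_derive_eq (@is_deriveV _ id _ _ _ xn0 (is_derive_id _ _))).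
    by rewrite /GRing.scale /= mulr1.
  have dE : is_derive x 1 (fun y : R => expR (- y^-1)) (expR (- x^-1) * x ^- 2).
    apply: (is_derive_eq (is_derive1_comp (is_derive_expR _) (is_deriveN dV))).
    by rewrite opprK.
  have H := is_deriveM (is_deriveX m dV) dE.
  apply: (is_derive_eq (near_eq_is_derive _ H)).
    near=> y; rewrite /flat ifT ?mulrfctE ?exprfctE//.
    by near: y; exact: lt_nbhsr.
  rewrite ?exprfctE /flat x0 /GRing.scale /=.
  case: m {H} => [|m] /=; first by rewrite -!exprVn; ring.
  by rewrite -!exprVn !exprS; ring.
- rewrite /flat ltxx mulr0 addr0.
  (* By [flat_mul], the slope of [flat m] between 0 and z is [flat m.+1 z], which is continuous at 0
     with value 0. *)
  apply/is_derive1_caratheodory; exists (flat m.+1); split.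
  + by move=> z; rewrite subr0 /flat ltxx subr0 -/(flat m z) -/(flat m.+1 z) flat_mul mulrC.
  + exact: flat_continuous0.
  + by rewrite /flat ltxx.
Unshelve. all: by end_near. Qed.

Lemma smooth1_flat m k : smooth1 k (flat m).
Proof.
elim: k m => [|k IH] m; first exact: is_derive_continuous (is_derive_flat m).
exists (fun x => - m%:R * flat m.+1 x + flat m.+2 x); split.
  exact: is_derive_flat.
by apply: smooth1D; [apply: smooth1M; [exact: smooth1_cst|]|]; exact: IH.
Qed.

(** The classical quotient f(x) / (f(x) + f(1 - x)) with f = [flat 0]; the denominator is positive
    because x or 1 - x is. *)
Lemma exists_smooth_step_closed : exists B b : R -> R, exists beta : R,
  [/\ (forall k, smooth1 k B) /\ (forall x : R, is_derive x 1 B (b x)),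
      (forall x, x <= 0 -> B x = 0) /\ (forall x, 1 <= x -> B x = 1),
      forall x, 0 <= B x <= 1,
      forall x, `|b x| <= beta &
      forall x, ~~ (0 <= x <= 1) -> b x = 0].
Proof.
pose D x := flat 0 x + flat 0 (-1 * x + 1).
have D0 x : 0 < D x.
  rewrite /D; have [x0|x0] := ltP 0 x.
    by rewrite ltr_wpDr ?flat_ge0// /flat x0 mulr_gt0 ?expR_gt0.
  rewrite ltr_wpDl ?flat_ge0// /flat ifT ?mulr_gt0 ?expR_gt0//.
  by lra.
pose B x := flat 0 x * (D x)^-1.
have sB k : smooth1 k B.
  apply: smooth1M; first exact: smooth1_flat.
  apply: smooth1V; first by move=> x; rewrite gt_eqF.
  by apply: smooth1D; [|apply: smooth1_affine]; exact: smooth1_flat.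
have [b [db sb]] := sB 1%N.
have B0 x : x <= 0 -> B x = 0 by move=> x0; rewrite /B /flat ltNge x0 mul0r.
have B1 x : 1 <= x -> B x = 1.
  move=> x1; have -> : B x = flat 0 x / (flat 0 x + 0).
    by rewrite /B /D [flat 0 (_ + _)]/flat ifF//; apply/negbTE; rewrite -leNgt; lra.
  by rewrite addr0 divff// /flat ifT ?mulf_neq0 ?expr0 ?oner_neq0 ?gt_eqF ?expR_gt0//; lra.
have bout x : ~~ (0 <= x <= 1) -> b x = 0.
  rewrite negb_and -!ltNge => /orP[x0|x1].
    rewrite -[LHS](@derive_val _ _ _ _ _ _ _ (db x)).
    rewrite (@near_eq_derive _ _ _ _ (cst (0 : R))) ?derive_cst//.
    near=> y; apply: B0; apply: ltW; near: y; exact: lt_nbhsl.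
  rewrite -[LHS](@derive_val _ _ _ _ _ _ _ (db x)).
  rewrite (@near_eq_derive _ _ _ _ (cst (1 : R))) ?derive_cst//.
  near=> y; apply: B1; apply: ltW; near: y; exact: lt_nbhsr.
have [c _ cmax] : exists2 c, c \in `[0, 1]%R & forall t, t \in `[0, 1]%R -> `|b t| <= `|b c|.
  apply: (@EVT_max _ (fun t => `|b t|)) => //; apply: continuous_subspaceT => t.
  by apply: cvg_norm; exact: sb.
exists B, b, `|b c|; split => //.
- move=> x; rewrite /B; apply/andP; split.
    by rewrite divr_ge0 ?flat_ge0// ltW.
  by rewrite ler_pdivrMr// mul1r lerDl flat_ge0.
- move=> x; have [x01|x01] := boolP (0 <= x <= 1).
    by apply: cmax; rewrite in_itv.
  by rewrite bout// normr0.
Unshelve. all: by end_near. Qed.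

(** The change of variable 2x - 1/2 confines the transition to [1/4, 3/4], so that the derivative
    vanishes at 0 and 1 as well. The bumps built from it are then 0 off an open interval, which
    matches the open cubes [ball]. *)
Lemma exists_smooth_step : exists B b : R -> R, exists beta : R,
  [/\ (forall k, smooth1 k B) /\ (forall x : R, is_derive x 1 B (b x)),
      (forall x, x <= 0 -> B x = 0) /\ (forall x, 1 <= x -> B x = 1),
      forall x, 0 <= B x <= 1,
      forall x, `|b x| <= beta &
      forall x, ~~ (0 < x < 1) -> b x = 0].
Proof.
have [B [b [beta [[sB dB] [B0 B1] B01 bb bout]]]] := exists_smooth_step_closed.
have da := is_derive_affine 2 (- 2^-1).
exists (fun x => B (2 * x + (- 2^-1))), (fun x => b (2 * x + (- 2^-1)) * 2), (beta * 2).
split; [split| split | | | ].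
- by move=> k; exact: smooth1_affine.
- move=> x; exact: (is_derive1_comp (dB _) (da x)).
- by move=> x x0; apply: B0; lra.
- by move=> x x1; apply: B1; lra.
- by move=> x; exact: B01.
- by move=> x; rewrite normrM (@ger0_norm _ 2)// ler_pM2r.
- move=> x; rewrite negb_and -!leNgt => h; rewrite bout ?mul0r//.
  by rewrite negb_and -!ltNge; case/orP: h => h; apply/orP; [left|right]; lra.
Qed.

End smooth1.

Section compact_support1.
Context {R : realType}.
Local Notation leb := (@lebesgue_measure R).

Definition supp1 (g : R -> R) : Prop :=
  exists M : R, forall s, M < `|s| -> g s = 0.

Lemma continuous_supp1_bounded (g : R -> R) : continuous g -> supp1 g ->
  exists K : R, forall s, `|g s| <= K.
Proof.
move=> cg [M gM].
have M0 : - `|M| <= `|M| by rewrite lerNl; apply: (@le_trans _ _ 0); rewrite ?oppr_le0.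
have [c _ cmax] : exists2 c, c \in `[- `|M|, `|M|]%R &
    forall t, t \in `[- `|M|, `|M|]%R -> `|g t| <= `|g c|.
  apply: (@EVT_max _ (fun t => `|g t|)) => //; apply: continuous_subspaceT => t.
  by apply: cvg_norm; exact: cg.
exists `|g c| => s; have [sM|sM] := leP `|s| `|M|.
  by apply: cmax; rewrite in_itv/= -ler_norml.
by rewrite gM ?normr0// (le_lt_trans (ler_norm _) sM).
Qed.

Lemma continuous_supp1_integrable (g : R -> R) : continuous g -> supp1 g ->
  leb.-integrable setT (EFin \o g).
Proof.
move=> cg sg; have [M gM] := sg; have [K gK] := continuous_supp1_bounded cg sg.
have E : EFin \o g = ((EFin \o g) \_ `[- `|M|, `|M|]).
  apply/funext => s; rewrite patchE; case: ifPn => // /negP sM /=.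
  rewrite gM//; apply: le_lt_trans (ler_norm _) _; rewrite ltNge; apply/negP => h.
  by apply: sM; rewrite inE /= in_itv /= -ler_norml.
rewrite E; apply: (integrable_mkcond _ _).1 => //.
apply: continuous_compact_integrable; first exact: segment_compact.
exact: continuous_subspaceT.
Qed.

Lemma integral_derive1 (g g' : R -> R) (a b : R) : a < b ->
  (forall x : R, is_derive x 1 g (g' x)) -> continuous g' ->
  (forall s, ~~ (a <= s <= b) -> g' s = 0) ->
  (\int[leb]_s g' s = g b - g a)%R.
Proof.
move=> ab dg cg' out.
have cg := is_derive_continuous dg.
have -> : \int[leb]_s g' s = \int[leb]_(s in `[a, b]) g' s.
  rewrite [RHS]Rintegral_mkcond; apply: eq_Rintegral => s _.
  rewrite patchE; case: ifPn => // /negP h; apply: out; apply/negP => h'; apply: h.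
  by rewrite inE /= in_itv.
rewrite /Rintegral (@continuous_FTC2 _ g' g)//.
- exact: continuous_subspaceT.
- split.
  + by move=> x _; have [] := dg x.
  + exact: cvg_at_right_filter (cg a).
  + exact: cvg_at_left_filter (cg b).
- by move=> x _; rewrite derive1E (@derive_val _ _ _ _ _ _ _ (dg x)).
Qed.

End compact_support1.

Section tensor_test.
Context {R : realType} {n : nat}.
Local Notation vec := 'rV[R]_n.
Implicit Types (g : 'I_n -> R -> R) (x : vec).

(** Differentiating a product in direction [i] replaces its factor [i]; this operation expresses the
    partial derivative of a [tensor] as another [tensor]. *)
Definition upd g i (h : R -> R) : 'I_n -> R -> R :=
  fun j => if j == i then h else g j.

Lemma continuous_rV_coord (i : 'I_n) : continuous (fun x : vec => x ord0 i).
Proof.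
by move=> x; apply: differentiable_continuous; exact: differentiable_coord.
Qed.

Lemma tensor_continuous g : (forall i, continuous (g i)) -> continuous (tensor g).
Proof.
move=> cg x; rewrite /tensor; elim: (index_enum _) => [|i s IH].
  rewrite (_ : (fun _ => _) = cst 1); first exact: cst_continuous.
  by apply/funext => y; rewrite big_nil.
rewrite (_ : (fun _ => _) =
    (fun y : vec => g i (y ord0 i) * \prod_(j <- s) g j (y ord0 j))).
  apply: (@continuousM _ _ (fun y : vec => g i (y ord0 i))) IH.
  by apply: continuous_comp; [exact: continuous_rV_coord|exact: cg].
by apply/funext => y; rewrite big_cons.
Qed.

Lemma tensor_differentiable g x : (forall i (s : R), derivable (g i) s 1) ->
  differentiable (tensor g) x.
Proof.
move=> dg; rewrite /tensor; elim: (index_enum _) => [|i s IH].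
  rewrite (_ : (fun _ => _) = cst 1); first exact: differentiable_cst.
  by apply/funext => y; rewrite big_nil.
rewrite (_ : (fun _ => _) = (g i \o (fun y : vec => y ord0 i)) *
    (fun y : vec => \prod_(j <- s) g j (y ord0 j))).
  apply: differentiableM => //; apply: differentiable_comp.
    exact: differentiable_coord.
  by apply/derivable1_diffP; exact: dg.
by apply/funext => y; rewrite big_cons.
Qed.

Lemma tensor_partial g i (h : R -> R) x :
  (forall s : R, is_derive s 1 (g i) (h s)) ->
  partial (tensor g) i x = tensor (upd g i h) x.
Proof.
move=> dg.
pose c := \prod_(j | j != i) g j (x ord0 j).
have H : (fun k : R => k^-1 *: (g i (k *: 1 + x ord0 i) - g i (x ord0 i)))
    @ 0^' --> h (x ord0 i).
  by have [d <-] := dg (x ord0 i); exact: d.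
have -> : tensor (upd g i h) x = h (x ord0 i) * c.
  rewrite /tensor (bigD1 i)//= /upd eqxx; congr (_ * _).
  by apply: eq_bigr => j /negbTE ->.
apply: cvg_lim => //.
rewrite [X in X @ _](_ : _ = fun k : R =>
    (k^-1 *: (g i (k *: 1 + x ord0 i) - g i (x ord0 i))) * c).
  by apply: cvgM => //; exact: cvg_cst.
apply/funext => k; rewrite /= /tensor (bigD1 i)//= [in X in _ - X](bigD1 i)//=.
rewrite !mxE !eqxx (_ : \prod_(_ | _) _ = c).
  by rewrite -mulrBl /GRing.scale /= mulrA.
apply: eq_bigr => j ji; rewrite !mxE !eqxx (negbTE ji).
by rewrite /GRing.scale /= mulr0 add0r.
Qed.

Lemma tensor_class_C k g : (forall i, smooth1 k (g i)) -> class_C k (tensor g).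
Proof.
elim: k g => [|k IH] g sg; first by apply: tensor_continuous => i; exact: sg.
split.
  move=> x; apply: tensor_differentiable => i s.
  by have [g' [dg _]] := sg i; have [] := dg s.
move=> i; have [g' [dg sg']] := sg i.
rewrite (_ : partial _ i = tensor (upd g i g')).
  by apply: IH => j; rewrite /upd; case: ifP => // _; exact: smooth1W.
by apply/funext => x; exact: tensor_partial.
Qed.

Lemma tensor_supp g : (forall i, supp1 (g i)) ->
  exists M : R, forall x, M < `|x| -> tensor g x = 0.
Proof.
move=> sg; pose M := \sum_i `|projT1 (cid (sg i))|.
exists M => x Mx.
have [i Mi] : exists i, `|projT1 (cid (sg i))| < `|x ord0 i|.
  apply/not_existsP => h; move: Mx; rewrite ltNge => /negP; apply.
  have M0 : 0 <= M by apply: sumr_ge0.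
  apply: norm_rV_le => // i.
  apply: (@le_trans _ _ `|projT1 (cid (sg i))|).
    by rewrite leNgt; apply/negP; exact: h.
  by rewrite /M (bigD1 i)//= lerDl sumr_ge0.
rewrite /tensor (bigD1 i)//=; move: Mi; case: cid => m /= hm mi.
by rewrite hm ?mul0r// (le_lt_trans (ler_norm _) mi).
Qed.

Lemma tensor_test_function g :
  (forall i k, smooth1 k (g i)) -> (forall i, supp1 (g i)) ->
  test_function (tensor g).
Proof.
move=> sg cg; split; first by move=> k; apply: tensor_class_C => i; exact: sg.
have [M hM] := tensor_supp cg.
have clM : closed [set x : vec | `|x| <= M].
  apply: (@closed_comp _ _ (fun x : vec => `|x|) [set y | y <= M]).
    by move=> x _; exact: norm_continuous.
  exact: closed_le.
have sub : closure [set x | tensor g x != 0] `<=` [set x : vec | `|x| <= M].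
  rewrite [X in _ `<=` X](closure_id _).1//; apply: closure_subset => x /=.
  by apply: contraNT; rewrite -ltNge => /hM ->.
apply: bounded_closed_compact; last exact: closed_closure.
exists M; split; first exact: num_real.
by move=> y My x /sub /= h; apply: le_trans h _; exact: ltW.
Qed.

End tensor_test.

(** * Morrey's inequality on cubes *)

Section cube_averages.
Context {R : realType} {n : nat} (B b : R -> R) (beta : R).
Local Notation vec := 'rV[R]_n.
Context (sB : forall k, smooth1 k B) (dB : forall x : R, is_derive x 1 B (b x)).
Context (B0 : forall x, x <= 0 -> B x = 0) (B1 : forall x, 1 <= x -> B x = 1).
Context (B01 : forall x, 0 <= B x <= 1) (bb : forall x, `|b x| <= beta).
Context (bout : forall x, ~~ (0 < x < 1) -> b x = 0).
Implicit Types (c : R * R).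
Local Notation mu := (lebesgue_rV n).

(** The pair [c] stands for the interval from [c.1] of length [c.2]. [stepf c] goes from 0 to 1
    across it, and its derivative [bumpf c] is a smooth weight of integral 1 on it, of which no sign
    is assumed. *)
Definition stepf c (z : R) : R := B (c.2^-1 * z + (- (c.2^-1 * c.1))).
Definition bumpf c (z : R) : R := b (c.2^-1 * z + (- (c.2^-1 * c.1))) * c.2^-1.

Let argE c z : c.2^-1 * z + (- (c.2^-1 * c.1)) = (z - c.1) / c.2.
Proof. by rewrite -mulrBr mulrC. Qed.

Lemma smooth1_stepf c k : smooth1 k (stepf c).
Proof. exact: smooth1_affine. Qed.

Lemma is_derive_stepf c (z : R) : is_derive z 1 (stepf c) (bumpf c z).
Proof.
have da := is_derive_affine c.2^-1 (- (c.2^-1 * c.1)).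
exact: (is_derive1_comp (dB _) (da z)).
Qed.

Lemma smooth1_bumpf c k : smooth1 k (bumpf c).
Proof. by apply: (smooth1_derive (is_derive_stepf c)) => j; exact: smooth1_stepf. Qed.

Lemma stepf_le c z : 0 < c.2 -> z <= c.1 -> stepf c z = 0.
Proof.
by move=> c0 h; rewrite /stepf argE B0// pmulr_lle0 ?invr_gt0// subr_le0.
Qed.

Lemma stepf_ge c z : 0 < c.2 -> c.1 + c.2 <= z -> stepf c z = 1.
Proof.
by move=> c0 h; rewrite /stepf argE B1// ler_pdivlMr// mul1r lerBrDl.
Qed.

Lemma bumpf_out c z : 0 < c.2 -> ~~ (c.1 < z < c.1 + c.2) -> bumpf c z = 0.
Proof.
move=> c0 h; rewrite /bumpf argE bout ?mul0r//; apply: contra h.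
by rewrite ltr_pdivrMr// mul1r pmulr_lgt0 ?invr_gt0// subr_gt0 ltrBlDl.
Qed.

Lemma bumpf_le c z : 0 < c.2 -> `|bumpf c z| <= beta / c.2.
Proof.
move=> c0; rewrite /bumpf normrM (@gtr0_norm _ c.2^-1) ?invr_gt0//.
by rewrite ler_pM2r ?invr_gt0.
Qed.

Lemma bumpf_supp c : 0 < c.2 -> supp1 (bumpf c).
Proof.
move=> c0; exists (`|c.1| + c.2) => z hz; apply: bumpf_out => //.
apply: contraTN hz => /andP[h1 h2]; rewrite -leNgt ler_norml.
by have := ler_norm c.1; have := ler_norm (- c.1); rewrite normrN => *; apply/andP; split; lra.
Qed.

(** Neither step has compact support, but both are 0 far to the left and 1 far to the right. Their
    difference is thus a legitimate factor of a test function, and its derivative is a difference of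
    two bumps. *)
Lemma stepf_diff_supp c c' : 0 < c.2 -> 0 < c'.2 ->
  supp1 (fun z => stepf c z - stepf c' z).
Proof.
move=> c0 c0'; exists (`|c.1| + c.2 + `|c'.1| + c'.2) => z hz.
have [h1 h2] := (ler_norm c.1, ler_norm (- c.1)).
have [h3 h4] := (ler_norm c'.1, ler_norm (- c'.1)); rewrite !normrN in h2 h4.
have [z0|z0] := leP 0 z.
  rewrite (ger0_norm z0) in hz;
  have [-> ->] : stepf c z = 1 /\ stepf c' z = 1 by split; apply: stepf_ge => //; lra.
  by rewrite subrr.
rewrite (ltr0_norm z0) in hz;
have [-> ->] : stepf c z = 0 /\ stepf c' z = 0 by split; apply: stepf_le => //; lra.
by rewrite subrr.
Qed.

Lemma integral_bumpf c : 0 < c.2 ->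
  (\int[@lebesgue_measure R]_z bumpf c z = 1)%R.
Proof.
move=> c0; have ab : c.1 < c.1 + c.2 by rewrite ltrDl.
rewrite (integral_derive1 ab (is_derive_stepf c)).
- by rewrite stepf_ge// stepf_le// subr0.
- exact: (@smooth1_bumpf c 0).
- move=> s h; apply: bumpf_out => //; apply: contra h => /andP[h1 h2].
  by rewrite !ltW.
Qed.

(** The average is weighted by a smooth product rather than by an indicator, so that averages over
    two boxes can be compared through the weak gradient. *)
Definition cube_avg (u : vec -> R) (c : 'I_n -> R * R) : R :=
  (\int[lebesgue_rV n]_x (u x * tensor (fun j => bumpf (c j)) x))%R.

(* Product test functions suffice for Morrey's inequality.  Unlike sobolev_W1, this
   notion is stable under subtraction of a linear function. *)
Definition tensor_weak_gradient (u : vec -> R) (G : vec -> vec) :=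
  forall i (g : 'I_n -> R -> R) (h : R -> R),
  (forall i k, smooth1 k (g i)) -> (forall i, supp1 (g i)) ->
  (forall s : R, is_derive s 1 (g i) (h s)) ->
  (\int[lebesgue_rV n]_x (u x * tensor (upd g i h) x) =
   - \int[lebesgue_rV n]_x (G x ord0 i * tensor g x))%R.

Lemma continuous_tensor_integrable (u : vec -> R) (g : 'I_n -> R -> R) :
  continuous u -> (forall i, continuous (g i)) -> (forall i, supp1 (g i)) ->
  (lebesgue_rV n).-integrable setT (EFin \o (fun x => u x * tensor g x)).
Proof.
move=> cu cg sg.
have [M hM] := tensor_supp sg.
pose K := [set x : vec | `|x| <= `|M|].
have clK : closed K.
  apply: (@closed_comp _ _ (fun x : vec => `|x|) [set y | y <= `|M|]).
    by move=> x _; exact: norm_continuous.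
  exact: closed_le.
have cK : compact K.
  apply: bounded_closed_compact => //; exists `|M|; split; first exact: num_real.
  by move=> y My x /= h; apply: le_trans h _; exact: ltW.
have cut : continuous (fun x => u x * tensor g x).
  by move=> x; apply: (@continuousM _ _ u (tensor g)); [exact: cu|exact: tensor_continuous].
have cf : continuous (fun x => `|u x * tensor g x|).
  move=> x; apply: (@continuous_comp _ _ _ (fun x => u x * tensor g x) (@Num.norm R R)).
    exact: cut.
  exact: norm_continuous.
have [c _ hc] : exists2 c, c \in K & forall t, t \in K ->
    `|u t * tensor g t| <= `|u c * tensor g c|.
  apply: (@EVT_max_rV _ _ (fun x => `|u x * tensor g x|)) => //.
    by exists 0; rewrite /K/= normr0.
  exact: continuous_subspaceT.
apply/integrableP; split.
  by apply/measurable_EFinP; exact: continuous_measurable_rV.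
pose r : R := `|M| + 1; pose m : R := `|u c * tensor g c|.
have r0 : 0 < r by rewrite /r; apply: ltr_wpDl.
have le1 : (\int[lebesgue_rV n]_x `|(u x * tensor g x)%:E| <=
    \int[lebesgue_rV n]_(x in ball (0%R : vec) r) m%:E)%E.
  rewrite [leRHS]integral_mkcond; apply: ge0_le_integral => //.
  - apply/measurableT_comp => //; by apply/measurable_EFinP; exact: continuous_measurable_rV.
  - by apply: (measurable_restrictT _ _).1 => //; exact: measurable_ball_rV.
  - move=> x _; rewrite patchE; case: ifPn => [xB|/negP xB] /=.
      rewrite lee_fin; have [xM|xM] := leP `|x| `|M|; first by apply: hc; rewrite inE.
      rewrite hM ?mulr0 ?normr0 ?normr_ge0//; exact: le_lt_trans (ler_norm _) xM.
    rewrite hM ?mulr0 ?normr0//; apply: le_lt_trans (ler_norm _) _.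
    rewrite ltNge; apply/negP => h; apply: xB; rewrite inE.
    rewrite mx_norm_ball /ball_ /= sub0r normrN /r; lra.
apply: le_lt_trans le1 _; rewrite integral_cst; last exact: measurable_ball_rV.
by rewrite [X in (_ * X)%E](lebesgue_rV_ball _ r0) ltry.
Qed.

Lemma tensor_upd_sub (g : 'I_n -> R -> R) k (h1 h2 : R -> R) (x : vec) :
  tensor (upd g k (fun z => h1 z - h2 z)) x =
  tensor (upd g k h1) x - tensor (upd g k h2) x.
Proof.
rewrite /tensor (bigD1 k)//= [in X in _ = X - _](bigD1 k)//=.
rewrite [in X in _ = _ - X](bigD1 k)//= /upd eqxx.
have E h : \prod_(i < n | i != k) (if i == k then h else g i) (x ord0 i) =
    \prod_(i < n | i != k) g i (x ord0 i).
  by apply: eq_bigr => j /negbTE ->.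
by rewrite !E mulrBl.
Qed.

(** The weights of the two boxes differ in factor [k] only, so their difference is the [k]-th
    partial derivative of a product whose factor [k] is [stepf (c k) - stepf (c' k)]. Integration by
    parts trades [u] for [G]; that factor is bounded by 1 and the other [n.-1] factors by [K]. *)
Lemma cube_avg_step (u : vec -> R) (G : vec -> vec)
    (N : vec -> R) (c c' : 'I_n -> R * R) (k : 'I_n) (K r I : R)
    (a : vec) :
  continuous u -> (forall i, measurable_fun setT (fun x => G x ord0 i)) ->
  measurable_fun setT N -> (forall x i, `|G x ord0 i| <= N x) ->
  tensor_weak_gradient u G ->
  0 < r -> (forall j, j != k -> c j = c' j) ->
  (forall j, 0 < (c j).2) -> (forall j, 0 < (c' j).2) ->
  (forall j, beta / (c j).2 <= K) ->
  (forall j, a ord0 j - r <= (c j).1 /\ (c j).1 + (c j).2 <= a ord0 j + r) ->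
  (forall j, a ord0 j - r <= (c' j).1 /\ (c' j).1 + (c' j).2 <= a ord0 j + r) ->
  (\int[mu]_(x in ball a r) (N x)%:E <= I%:E)%E ->
  `|cube_avg u c - cube_avg u c'| <= K ^+ n.-1 * I.
Proof.
move=> cu mG mN GN ibp r0 cc' c0 c'0 cK ca ca' NI.
have K0 : 0 <= K.
  have beta0 : 0 <= beta := le_trans (normr_ge0 _) (bb 0).
  by apply: le_trans (cK k); apply: divr_ge0 => //; exact: ltW.
pose s z := stepf (c k) z - stepf (c' k) z.
pose h z := bumpf (c k) z - bumpf (c' k) z.
pose g := upd (fun j => bumpf (c j)) k s.
have sg i j : smooth1 j (g i).
  rewrite /g /upd; case: ifP => _; last exact: smooth1_bumpf.
  rewrite (_ : s = fun z => stepf (c k) z + (-1) * stepf (c' k) z).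
    apply: smooth1D; first exact: smooth1_stepf.
    by apply: smooth1M; [exact: smooth1_cst|exact: smooth1_stepf].
  by apply/funext => z; rewrite mulN1r.
have suppg i : supp1 (g i).
  rewrite /g /upd; case: ifP => _; first exact: stepf_diff_supp.
  exact: bumpf_supp.
have dh (z : R) : is_derive z 1 (g k) (h z).
  rewrite /g /upd eqxx; apply: is_deriveB; exact: is_derive_stepf.
have gupd : upd g k h = upd (fun j => bumpf (c j)) k h.
  by apply/funext => j; rewrite /g /upd; case: (j == k).
have cub (e : 'I_n -> R * R) : (forall j, 0 < (e j).2) ->
    mu.-integrable setT (EFin \o (fun x => u x * tensor (fun j => bumpf (e j)) x)).
  move=> e0; apply: continuous_tensor_integrable => // i.
    exact: (smooth1_bumpf _ 0).
  exact: bumpf_supp.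
have -> : cube_avg u c - cube_avg u c' = - \int[mu]_x (G x ord0 k * tensor g x).
  rewrite -(ibp k g h sg suppg dh) gupd /cube_avg -RintegralB//; [|exact: cub..].
  apply: eq_Rintegral => x _; rewrite /h tensor_upd_sub -mulrBr; congr (_ * (_ - _)).
    by congr tensor; apply/funext => j; rewrite /upd; case: eqP => // ->.
  congr tensor; apply/funext => j; rewrite /upd; case: eqP => [->//|/eqP jk].
  by rewrite cc'.
rewrite normrN.
(* Outside the cube some coordinate lies beyond the intervals of both boxes: in direction [k] the
   two steps agree there, in any other direction the bump is 0. *)
have gout x : ~ ball a r x -> tensor g x = 0.
  move=> /ball_rVP xa; have [j hj] : exists j, r <= `|a ord0 j - x ord0 j|.
    apply/not_existsP => hn; apply: xa; split => // j.
    by rewrite ltNge; apply/negP; exact: hn.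
  rewrite /tensor (bigD1 j)//= (_ : g j (x ord0 j) = 0) ?mul0r//.
  have [ca1 ca2] := ca j; have [ca3 ca4] := ca' j.
  have := c0 j; have := c'0 j => c'j cj.
  have hor : x ord0 j <= a ord0 j - r \/ a ord0 j + r <= x ord0 j.
    by move: hj; rewrite ler_normr => /orP[] ?; [left|right]; lra.
  rewrite /g /upd; case: eqP => jk.
    rewrite /s -jk; case: hor => hor.
      have e1 : stepf (c j) (x ord0 j) = 0 by apply: stepf_le => //; lra.
      have e2 : stepf (c' j) (x ord0 j) = 0 by apply: stepf_le => //; lra.
      by rewrite e1 e2 subrr.
    have e1 : stepf (c j) (x ord0 j) = 1 by apply: stepf_ge => //; lra.
    have e2 : stepf (c' j) (x ord0 j) = 1 by apply: stepf_ge => //; lra.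
    by rewrite e1 e2 subrr.
  apply: bumpf_out => //; rewrite negb_and -!leNgt.
  by case: hor => hor; apply/orP; [left|right]; lra.
have gle x : `|tensor g x| <= K ^+ n.-1.
  rewrite /tensor normr_prod (bigD1 k)//= -[leRHS]mul1r; apply: ler_pM => //.
    exact: prodr_ge0.
    rewrite /g /upd eqxx /s ler_norml.
    have := B01 ((c k).2^-1 * x ord0 k + (- ((c k).2^-1 * (c k).1))).
    have := B01 ((c' k).2^-1 * x ord0 k + (- ((c' k).2^-1 * (c' k).1))).
    rewrite -/(stepf (c k) _) -/(stepf (c' k) _) => /andP[? ?] /andP[? ?].
    by apply/andP; split; lra.
  have -> : K ^+ n.-1 = \prod_(j < n | j != k) K.
    rewrite prodr_const (_ : #|_| = n.-1)//.
    rewrite -[in RHS](card_ord n) -(cardC1 k); apply: eq_card => j.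
    by rewrite !inE.
  apply: ler_prod => j jk; rewrite normr_ge0/=.
  rewrite /g /upd (negbTE jk); apply: le_trans (cK j); exact: bumpf_le.
have tm : measurable_fun setT (tensor g).
  apply: continuous_measurable_rV; apply: tensor_continuous => i.
  exact: (sg i 0).
have m1 : measurable_fun setT (fun x => G x ord0 k * tensor g x) by exact: measurable_funM.
have I0 : (\int[mu]_x `|(G x ord0 k * tensor g x)%:E| <= (K ^+ n.-1 * I)%:E)%E.
  apply: (@le_trans _ _ (\int[mu]_(x in ball a r) ((K ^+ n.-1)%:E * (N x)%:E))%E).
    rewrite [leRHS]integral_mkcond; apply: ge0_le_integral => //.
    - by apply/measurableT_comp => //; exact/measurable_EFinP.
    - apply: (measurable_restrictT _ _).1; first exact: measurable_ball_rV.
      by apply: measurable_funeM; apply: measurable_funTS; exact/measurable_EFinP.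
    - move=> x _; rewrite patchE; case: ifPn => [xB|/negP xB].
        rewrite abse_EFin -EFinM lee_fin normrM mulrC.
        by apply: ler_pM => //; exact: gle.
      have -> : G x ord0 k * tensor g x = 0.
        by rewrite gout ?mulr0// => h'; apply: xB; rewrite inE.
      by rewrite abse0; exact: lexx.
  rewrite ge0_integralZl//.
  - by rewrite EFinM lee_wpmul2l// lee_fin exprn_ge0.
  - exact: measurable_ball_rV.
  - by apply: measurable_funTS; exact/measurable_EFinP.
  - by move=> x _; rewrite lee_fin (le_trans _ (GN x k)).
  - by rewrite lee_fin exprn_ge0.
have int1 : mu.-integrable setT (EFin \o (fun x => G x ord0 k * tensor g x)).
  by apply/integrableP; split; [exact/measurable_EFinP|exact: le_lt_trans I0 (ltry _)].
rewrite -lee_fin; apply: le_trans I0.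
rewrite EFin_normr_Rintegral//; apply: le_abse_integral => //.
exact/measurable_EFinP.
Qed.

Definition cube (a : vec) (r : R) (j : 'I_n) : R * R := (a ord0 j - r, 2 * r).

(** The large cube is turned into the small one by replacing one side at a time, which costs [n]
    applications of [cube_avg_step]. The shortest side that occurs is [r], the full side of the half
    cube, hence [beta / r]. *)
Lemma cube_avg_half (u : vec -> R) (G : vec -> vec)
    (N : vec -> R) (r I : R) (a a' : vec) :
  continuous u -> (forall i, measurable_fun setT (fun x => G x ord0 i)) ->
  measurable_fun setT N -> (forall x i, `|G x ord0 i| <= N x) ->
  tensor_weak_gradient u G ->
  0 < r -> (forall j, `|a ord0 j - a' ord0 j| <= r / 2) ->
  (\int[mu]_(x in ball a r) (N x)%:E <= I%:E)%E ->
  `|cube_avg u (cube a r) - cube_avg u (cube a' (r / 2))| <=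
  n%:R * ((beta / r) ^+ n.-1 * I).
Proof.
move=> cu mG mN GN ibp r0 aa' NI.
have beta0 : 0 <= beta := le_trans (normr_ge0 _) (bb 0).
pose hyb m (j : 'I_n) := if (j < m)%N then cube a' (r / 2) j else cube a r j.
have H m : (m <= n)%N ->
    `|cube_avg u (hyb 0%N) - cube_avg u (hyb m)| <=
    m%:R * ((beta / r) ^+ n.-1 * I).
  elim: m => [|m IH] mn; first by rewrite subrr normr0 mul0r.
  rewrite -(subrKA (cube_avg u (hyb m))) -natr1 mulrDl mul1r.
  apply: le_trans (ler_normD _ _) _; apply: lerD; first exact/IH/ltnW.
  have hy0 m' j : 0 < (hyb m' j).2 by rewrite /hyb; case: ifP => _ /=; lra.
  have hya m' j : a ord0 j - r <= (hyb m' j).1 /\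
      (hyb m' j).1 + (hyb m' j).2 <= a ord0 j + r.
    have := aa' j; rewrite ler_norml /hyb => /andP[h1 h2].
    by case: ifP => _ /=; split; lra.
  apply: (@cube_avg_step u G N _ _ (Ordinal mn) _ r I a) => //.
  - move=> j jm; rewrite /hyb.
    have jm' : (nat_of_ord j == m) = false by apply/negbTE.
    by have -> : (j < m.+1)%N = (j < m)%N by rewrite ltnS leq_eqVlt jm'.
  - move=> j; rewrite ler_wpM2l// lef_pV2 ?posrE//.
    by rewrite /hyb; case: ifP => _ /=; lra.
have := H n (leqnn n); congr (`|_ - _| <= _).
by congr cube_avg; apply/funext => j; rewrite /hyb ltn_ord.
Qed.

(** The weight has integral 1 and absolute value at most (beta/(2r))^n on a cube of volume (2r)^n.
    As it is not known to be nonnegative, a factor [beta ^+ n] is lost. *)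
Lemma cube_avg_near (u : vec -> R) (a : vec) (r e eps : R) :
  continuous u -> 0 < r -> 0 <= eps ->
  (forall y, ball a r y -> `|u y - e| <= eps) ->
  `|cube_avg u (cube a r) - e| <= eps * beta ^+ n.
Proof.
move=> cu r0 eps0 ue.
have beta0 : 0 <= beta := le_trans (normr_ge0 _) (bb 0).
have r20 : 0 < 2 * r by rewrite mulr_gt0.
pose eta := tensor (fun j => bumpf (cube a r j)).
have sb i k : smooth1 k (bumpf (cube a r i)) by exact: smooth1_bumpf.
have cb i : continuous (bumpf (cube a r i)) by exact: (sb i 0).
have pb i : supp1 (bumpf (cube a r i)) by apply: bumpf_supp.
have [ieta eta1] := @tensor_integrable_integral R n (fun j => bumpf (cube a r j))
  (fun i => continuous_supp1_integrable (cb i) (pb i)).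
have {}eta1 : \int[mu]_x eta x = 1.
  rewrite eta1 big1// => i _; exact: integral_bumpf.
have iu : mu.-integrable setT (EFin \o (fun x => u x * eta x)).
  by apply: continuous_tensor_integrable.
have ie : mu.-integrable setT (EFin \o (fun x => e * eta x)).
  by apply: continuous_tensor_integrable => // x; exact: cst_continuous.
have -> : cube_avg u (cube a r) - e = \int[mu]_x ((u x - e) * eta x).
  rewrite -[X in _ - X]mulr1 -eta1 -RintegralZl// -RintegralB//.
  by apply: eq_Rintegral => x _; rewrite mulrBl.
have etaout x : ~ ball a r x -> eta x = 0.
  move=> /ball_rVP xa; have [j hj] : exists j, r <= `|a ord0 j - x ord0 j|.
    apply/not_existsP => hn; apply: xa; split => // j.
    by rewrite ltNge; apply/negP; exact: hn.
  rewrite /eta /tensor (bigD1 j)//= (_ : bumpf _ _ = 0) ?mul0r//.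
  apply: bumpf_out => //=; rewrite negb_and -!leNgt.
  by move: hj; rewrite ler_normr => /orP[] ?; apply/orP; [left|right]; lra.
have etale x : `|eta x| <= (beta / (2 * r)) ^+ n.
  rewrite /eta /tensor normr_prod -[n in leRHS]card_ord -prodr_const.
  by apply: ler_prod => j _; rewrite normr_ge0/=; exact: bumpf_le.
have int1 : mu.-integrable setT (EFin \o (fun x => (u x - e) * eta x)).
  apply: continuous_tensor_integrable => // x; apply: continuousB; first exact: cu.
  exact: cst_continuous.
rewrite -lee_fin EFin_normr_Rintegral//.
apply: le_trans (le_abse_integral mu measurableT _) _.
  by have /integrableP[] := int1.
apply: (@le_trans _ _ (\int[mu]_(x in ball a r)
    (eps * (beta / (2 * r)) ^+ n)%:E)%E).
  rewrite [leRHS]integral_mkcond; apply: ge0_le_integral => //.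
  - by apply/measurableT_comp => //; have /integrableP[] := int1.
  - by apply: (measurable_restrictT _ _).1 => //; exact: measurable_ball_rV.
  - move=> x _; rewrite patchE; case: ifPn => [|/negP] xB.
      rewrite abse_EFin lee_fin normrM; apply: ler_pM => //; apply: ue.
      by rewrite inE in xB.
    have -> : (u x - e) * eta x = 0.
      by rewrite etaout ?mulr0// => h'; apply: xB; rewrite inE.
    by rewrite abse0; exact: lexx.
rewrite integral_cst; last exact: measurable_ball_rV.
rewrite [X in (_ * X)%E](lebesgue_rV_ball _ r0) -EFinM lee_fin -mulrA -exprMn.
by rewrite divfK// gt_eqF.
Qed.

End cube_averages.

(** Either t <= a, or t/a >= 1 and t/a <= (t/a)^s. Integrated over a cube, this bounds the integral
    of N by that of N^s and takes the place of Hoelder's inequality. *)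
Lemma le_young_powR (R : realType) (s a t : R) : 1 <= s -> 0 < a -> 0 <= t ->
  t <= a + a / a `^ s * t `^ s.
Proof.
move=> s1 a0 t0; have [ta|ta] := leP t a.
  apply: le_trans ta _; rewrite lerDl mulr_ge0 ?powR_ge0// divr_ge0 ?powR_ge0//.
  exact: ltW.
apply: (@le_trans _ _ (a / a `^ s * t `^ s)); last by rewrite lerDr ltW.
have ta1 : 1 <= t / a by rewrite ler_pdivlMr// mul1r ltW.
have -> : t `^ s = a `^ s * (t / a) `^ s.
  by rewrite -powRM ?divr_ge0 ?(ltW a0)// mulrC divfK// gt_eqF.
rewrite mulrA divfK ?gt_eqF ?powR_gt0//.
have {1}-> : t = a * (t / a) by rewrite mulrC divfK// gt_eqF.
by rewrite ler_pM2l// le1r_powR.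
Qed.

Lemma geometric_telescope (R : realType) (U : nat -> R) (L D q : R) :
  0 <= D -> 0 < q < 1 ->
  (forall k, `|U k - U k.+1| <= D * q ^+ k) ->
  (forall e, 0 < e -> exists k, `|U k - L| <= e) ->
  `|U 0%N - L| <= D / (1 - q).
Proof.
move=> D0 /andP[q0 q1] UU UL; have q1' : 0 < 1 - q by rewrite subr_gt0.
have H k : `|U 0%N - U k| <= D * (1 - q ^+ k) / (1 - q).
  elim: k => [|k IH]; first by rewrite expr0 !subrr normr0 mulr0 mul0r.
  rewrite -(subrKA (U k)); apply: le_trans (ler_normD _ _) _.
  apply: le_trans (lerD IH (UU k)) _.
  rewrite [leRHS](_ : _ = D * (1 - q ^+ k) / (1 - q) + D * q ^+ k)//.
  by rewrite exprS; field; rewrite gt_eqF.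
apply/ler_addgt0Pr => e e0; have [k hk] := UL _ e0.
rewrite -(subrKA (U k)); apply: le_trans (ler_normD _ _) _; apply: lerD => //.
apply: le_trans (H k) _; rewrite ler_pM2r ?invr_gt0//.
by rewrite -[leRHS]mulr1 ler_wpM2l// gerBl exprn_ge0// ltW.
Qed.

Section morrey_cube.
Context {R : realType} {n : nat}.
Local Notation mu := (lebesgue_rV n).

(** A chain of cubes shrinks to [x] by halving. Averages of [u] over consecutive cubes differ by at
    most a constant times the radius times the mean size of the gradient. The radius loses a factor
    2 while the bound on the mean grows only by 2^(n/s) < 2, so the differences sum geometrically.
    The points [x] and [y] are compared through the average over the first cube. *)
Lemma morrey_cube (s : R) : (0 < n)%N -> n%:R < s ->
  exists2 C : R, 0 < C &
  forall (u : 'rV[R]_n -> R) (G : 'rV[R]_n -> 'rV[R]_n) (N : 'rV[R]_n -> R),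
  continuous u -> (forall i, measurable_fun setT (fun x => G x ord0 i)) ->
  measurable_fun setT N -> (forall x i, `|G x ord0 i| <= N x) ->
  tensor_weak_gradient u G ->
  forall (a : 'rV[R]_n) (r A : R), 0 < r -> 0 < A ->
  (\int[mu]_(x in ball a r) (N x `^ s)%:E <= ((2 * r) ^+ n * A `^ s)%:E)%E ->
  forall x y, ball a r x -> ball a r y -> `|u x - u y| <= C * r * A.
Proof.
move=> n0 ns.
have [B [b [beta [[sB dB] [B0 B1] B01 bb bout]]]] := @exists_smooth_step R.
have beta0 : 0 <= beta := le_trans (normr_ge0 _) (bb 0).
have s0 : 0 < s by apply: le_lt_trans ns; rewrite ler0n.
have s1 : 1 <= s by apply: ltW; apply: le_lt_trans ns; rewrite ler1n.
pose t : R := 2 `^ (n%:R / s).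
have t0 : 0 < t by rewrite powR_gt0.
have ts : t `^ s = 2 ^+ n by rewrite /t -powRrM divfK ?gt_eqF// powR_mulrn.
have t2 : t < 2.
  rewrite /t /powR ifF ?gt_eqF// -[ltRHS](@lnK _ 2) ?posrE// ltr_expR.
  rewrite -[ltRHS]mul1r ltr_pM2r ?ln_gt0 ?ltr1n//.
  by rewrite ltr_pdivrMr// mul1r.
pose q := t / 2.
have q01 : 0 < q < 1 by rewrite divr_gt0//= ltr_pdivrMr// mul1r.
have q1' : 0 < 1 - q by rewrite subr_gt0; case/andP: q01.
(* The cost of one halving: [cube_avg_half], with the integral of [N] bounded by
   [2 * (2 * rk k) ^+ n * Ak k], gives [D0 * (rk k * Ak k)]. *)
pose D0 : R := n%:R * beta ^+ n.-1 * 2 ^+ n.+1.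
have D00 : 0 <= D0 by rewrite /D0 !mulr_ge0 ?exprn_ge0.
exists (2 * (D0 / (1 - q)) + 1); first by rewrite ltr_wpDl// mulr_ge0 ?divr_ge0// ltW.
move=> u G N cu mG mN GN ibp a r A r0 A0 NA.
have N0 x : 0 <= N x by apply: le_trans (GN x (Ordinal n0)).
suff H x : ball a r x -> `|u x - cube_avg b u (cube a r)| <= D0 / (1 - q) * (r * A).
  move=> x y xa ya; rewrite -(subrKA (cube_avg b u (cube a r))).
  apply: le_trans (ler_normD _ _) _; rewrite [X in _ + X]distrC.
  apply: le_trans (lerD (H _ xa) (H _ ya)) _.
  by rewrite -mulrDl -[leRHS]mulrA ler_pM2r ?mulr_gt0//; lra.
move=> /ball_rVP[_ xa].
pose h k : R := 2^-1 ^+ k.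
have h0 k : 0 < h k by rewrite exprn_gt0// invr_gt0.
have h1 k : h k <= 1 by rewrite exprn_ile1// invf_le1// ler1n.
(* The original cube is contracted towards [x] by the factor 2^-k; the result still contains [x] and
   stays inside the original cube. *)
pose ak k : 'rV[R]_n := \row_j (x ord0 j + h k * (a ord0 j - x ord0 j)).
pose rk k := h k * r.
(* A bound for the L^s mean of [N] on the [k]-th cube, whose volume is 2^(nk) times smaller than
   that of the first. *)
pose Ak k := A * t ^+ k.
have rk0 k : 0 < rk k by rewrite mulr_gt0.
have Ak0 k : 0 < Ak k by rewrite mulr_gt0// exprn_gt0.
have Aks k : Ak k `^ s = A `^ s * (2 ^+ n) ^+ k.
  rewrite /Ak powRM ?exprn_ge0 ?(ltW t0) ?(ltW A0)//.
  by rewrite -(powR_mulrn k) ?(ltW t0)// -powRrM (mulrC k%:R) powRrM ts powR_mulrn// exprn_ge0.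
have sub k : ball (ak k) (rk k) `<=` ball a r.
  move=> z /ball_rVP[_ hz]; apply/ball_rVP; split => // j.
  have := hz j; rewrite mxE /rk => hzj; rewrite -(subrKA (ak k ord0 j)) mxE.
  apply: le_lt_trans (ler_normD _ _) _.
  have -> : a ord0 j - (x ord0 j + h k * (a ord0 j - x ord0 j)) =
    (1 - h k) * (a ord0 j - x ord0 j) by ring.
  rewrite normrM (@ger0_norm _ (1 - h k)) ?subr_ge0//.
  have : (1 - h k) * `|a ord0 j - x ord0 j| <= (1 - h k) * r.
    by rewrite ler_wpM2l ?subr_ge0// ltW.
  by move=> ?; lra.
have Nk k : (\int[mu]_(z in ball (ak k) (rk k)) (N z)%:E <=
    (2 * (2 * rk k) ^+ n * Ak k)%:E)%E.
  have mNs : measurable_fun (ball (ak k) (rk k)) (fun z => (N z `^ s)%:E).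
    apply: measurable_funTS; apply/measurable_EFinP.
    exact: (measurableT_comp (measurable_powR s) mN).
  (* [le_young_powR] with [a := Ak k]: each of the two terms integrates to at most
     [(2 * rk k) ^+ n * Ak k]. *)
  apply: (@le_trans _ _ (\int[mu]_(z in ball (ak k) (rk k))
      ((Ak k)%:E + (Ak k / Ak k `^ s)%:E * (N z `^ s)%:E))%E).
    apply: ge0_le_integral => //.
    - exact: measurable_ball_rV.
    - by move=> z _; rewrite lee_fin.
    - by apply: measurable_funTS; exact/measurable_EFinP.
    - apply: emeasurable_funD; first exact: measurable_cst.
      exact: measurable_funeM.
    - by move=> z _; rewrite -EFinM -EFinD lee_fin; exact: le_young_powR.
  have AA0 : 0 <= Ak k / Ak k `^ s by rewrite divr_ge0 ?powR_ge0// ltW.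
  rewrite ge0_integralD//; last 4 first.
  - exact: measurable_ball_rV.
  - by move=> z _; rewrite lee_fin ltW.
  - by move=> z _; rewrite -EFinM lee_fin mulr_ge0// powR_ge0.
  - exact: measurable_funeM.
  rewrite integral_cst; last exact: measurable_ball_rV.
  rewrite [X in (_ * X + _)%E](lebesgue_rV_ball _ (rk0 k)).
  rewrite ge0_integralZl//; last 2 first.
  - exact: measurable_ball_rV.
  - by move=> z _; rewrite lee_fin powR_ge0.
  have NAk : (\int[mu]_(z in ball (ak k) (rk k)) (N z `^ s)%:E <=
      ((2 * r) ^+ n * A `^ s)%:E)%E.
    apply: le_trans NA; apply: ge0_subset_integral => //; try exact: measurable_ball_rV.
    - apply: measurable_funTS; apply/measurable_EFinP.
      exact: (measurableT_comp (measurable_powR s) mN).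
    - by move=> z _; rewrite lee_fin powR_ge0.
  apply: le_trans (leeD2l _ (lee_wpmul2l _ NAk)) _; first by rewrite lee_fin.
  rewrite -!EFinM -EFinD lee_fin le_eqVlt; apply/orP; left; apply/eqP.
  rewrite Aks /rk /h !exprMn exprVn -!exprM mulnC.
  have p1 : A `^ s != 0 by rewrite gt_eqF// powR_gt0.
  have p2 : (2 : R) ^+ (n * k) != 0 by rewrite expf_neq0.
  by rewrite exprVn -exprM mulnC; field; rewrite p1 p2.
rewrite distrC; pose U k := cube_avg b u (cube (ak k) (rk k)).
have -> : cube_avg b u (cube a r) = U 0%N.
  have e1 : rk 0%N = r by rewrite /rk /h expr0 mul1r.
  have e2 : ak 0%N = a by apply/rowP => j; rewrite mxE /h expr0 mul1r; ring.
  by rewrite /U e1 e2.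
rewrite mulrAC; apply: (@geometric_telescope _ _ _ _ q) => //.
- by apply: mulr_ge0 => //; apply: mulr_ge0; exact: ltW.
- move=> k; have := @cube_avg_half R n B b beta sB dB B0 B1 B01 bb bout u G N
    (rk k) _ (ak k) (ak k.+1) cu mG mN GN ibp (rk0 k) _ (Nk k).
  have rkS : rk k / 2 = rk k.+1 by rewrite /rk /h exprS; field.
  rewrite rkS -/(U k) -/(U k.+1) => /(_ _)/le_trans; apply.
    move=> j; rewrite !mxE -rkS /rk.
    have -> : x ord0 j + h k * (a ord0 j - x ord0 j) -
      (x ord0 j + h k.+1 * (a ord0 j - x ord0 j)) = h k / 2 * (a ord0 j - x ord0 j).
      by rewrite /h exprS; field.
    rewrite normrM (@ger0_norm _ (h k / 2)) ?divr_ge0 ?(ltW (h0 k))//.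
    by rewrite [leRHS]mulrAC; apply: ler_wpM2l; rewrite ?divr_ge0 ?(ltW (h0 k)) ?ltW.
  rewrite /D0; case: (n) n0 => // m _ /=.
  have rn : rk k != 0 by rewrite gt_eqF.
  rewrite le_eqVlt; apply/orP; left; apply/eqP.
  have -> : r = rk k * 2 ^+ k.
    by rewrite /rk /h mulrAC -exprMn mulVf// expr1n mul1r.
  rewrite /Ak /q; move: (rk k) rn => rho rn.
  have k2 : (2 : R) ^+ k != 0 by rewrite expf_neq0.
  have rm : rho ^+ m != 0 by rewrite expf_neq0.
  by rewrite !exprMn !exprVn !exprS; field; rewrite k2 rm.
- move=> e e0.
  have ee0 : 0 < e / (beta ^+ n + 1) by rewrite divr_gt0// ltr_wpDl// exprn_ge0.
  have /nbhs_ballP[d /= d0 hd] : \forall y \near x, `|u x - u y| < e / (beta ^+ n + 1).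
    by have /cvgrPdist_lt := cu x; exact.
  have [k hk] : exists k, 2 * rk k < d.
    have hcv : (fun k => 2 * r * 2^-1 ^+ k) @ \oo --> (0 : R).
      rewrite -[X in _ --> X](mulr0 (2 * r)); apply: cvgMr.
      by apply: cvg_expr; rewrite gtr0_norm ?invr_gt0// invf_lt1// ltr1n.
    have /cvgrPdist_lt/(_ _ d0)[k _ hk] := hcv; exists k.
    have := hk k (leqnn k); rewrite /= sub0r normrN; apply: le_lt_trans.
    by rewrite /rk /h mulrA (le_trans _ (ler_norm _))// mulrAC.
  exists k; apply: le_trans (_ : e / (beta ^+ n + 1) * beta ^+ n <= _); last first.
    rewrite -mulrA ler_piMr ?(ltW e0)// mulrC ler_pdivrMr ?mul1r ?lerDl//.
    by rewrite ltr_wpDl// exprn_ge0.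
  apply: (cube_avg_near sB dB B0 B1 bb bout) => //; first exact: ltW.
  move=> y /ball_rVP[_ hy]; rewrite distrC; apply/ltW/hd/ball_rVP; split => // j.
  have := hy j; rewrite mxE => hyj; apply: lt_trans hk.
  rewrite -(subrKA (ak k ord0 j)) mxE; apply: le_lt_trans (ler_normD _ _) _.
  rewrite opprD addNKr normrN normrM (@gtr0_norm _ (h k))//.
  have : h k * `|a ord0 j - x ord0 j| <= h k * r by rewrite ler_pM2l// ltW.
  by rewrite -/(rk k) => ?; lra.
Qed.

End morrey_cube.

(** * The maximal inequality *)

Section maximal.
Context {R : realType} {n : nat}.
Local Notation mu := (lebesgue_rV n).
Local Notation vec := 'rV[R]_n.
Implicit Types (g : vec -> R).

Let cb (p : vec * R) : set vec := ball p.1 p.2.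

(** Greedy selection. The list is sorted by increasing radius, so that the recursion treats the
    larger cubes first. The head is then the smallest: either it meets a selected cube, whose triple
    contains it, or it is selected too. *)
Lemma vitali_cubes (s : seq (vec * R)) : (forall p, p \in s -> 0 < p.2) ->
  exists D : seq (vec * R), [/\ uniq D, {subset D <= s}, trivIset [set` D] cb &
    forall p, p \in s -> exists2 d, d \in D & cb p `<=` ball d.1 (3 * d.2)].
Proof.
pose le2 (p q : vec * R) := p.2 <= q.2.
have le2_trans : transitive le2 by move=> x y z; exact: le_trans.
wlog : s / sorted le2 s.
  have : sorted le2 (sort le2 s) by apply: sort_sorted => x y; exact: le_total.
  move=> /[swap] /[apply] H s0; have [|D [uD Ds tD DH]] := H.
    by move=> p; rewrite mem_sort; exact: s0.
  exists D; split => //; first by move=> x /Ds; rewrite mem_sort.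
  by move=> p; rewrite -(mem_sort le2); exact: DH.
elim: s => [_ _|p s IH /= ps s0]; first by exists [::]; split => // x y.
have [|D [uD Ds tD DH]] := IH (path_sorted ps).
  by move=> q qs; apply: s0; rewrite inE qs orbT.
have p0 : 0 < p.2 by apply: s0; rewrite mem_head.
have [[k kD [z [pz kz]]]|nD] := pselect (exists2 k, k \in D & cb p `&` cb k !=set0).
  exists D; split => //; first by move=> x /Ds xs; rewrite inE xs orbT.
  move=> q; rewrite inE => /predU1P[->|/DH//]; exists k => // y py.
  have pk : p.2 <= k.2 by have /allP := order_path_min le2_trans ps; apply; exact: Ds.
  have -> : 3 * k.2 = k.2 + k.2 + k.2 by lra.
  apply: (@ball_triangle _ _ p.1); last exact: le_ball pk _ py.
  by apply: (@ball_triangle _ _ z) => //; apply: le_ball pk _ _; exact: ball_sym.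
exists (p :: D); split.
- rewrite /= uD andbT; apply/negP => pD; apply: nD; exists p => //.
  by exists p.1; split; exact: ballxx.
- by move=> x; rewrite !inE => /predU1P[->|/Ds ->]; rewrite ?eqxx ?orbT.
- move=> x y /=; rewrite !inE => /predU1P[->|xD] /predU1P[->|yD] xy //.
  + by apply: contrapT => _; apply: nD; exists y.
  + by apply: contrapT => _; apply: nD; exists x => //; rewrite setIC.
  + exact: tD.
- move=> q; rewrite inE => /predU1P[->|/DH[d dD qd]]; last first.
    by exists d => //; rewrite inE dD orbT.
  exists p; first by rewrite mem_head.
  by apply: le_ball; rewrite ler_peMl ?ler1n// ltW.
Qed.

(** An enumeration of the cubes with rational centre and radius; an index that decodes to nothing
    gets radius 0, that is, the empty cube. *)
Definition rat_ball (k : nat) : vec * R :=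
  if (unpickle k : option ('rV[rat]_n * rat)) is Some q
  then (map_mx ratr q.1, ratr q.2) else (0, 0).

Definition cavg g (p : vec * R) : \bar R :=
  (((2 * p.2) ^+ n)^-1%:E * \int[mu]_(x in ball p.1 p.2) (g x)%:E)%E.

(* Countably many cubes, so that measurability is immediate. *)
Definition maxfun g (x : vec) : \bar R :=
  ereal_sup [set cavg g (rat_ball k) | k in [set k | cb (rat_ball k) x]].

Lemma ball_rV_gt0 (x y : vec) r : ball x r y -> 0 < r.
Proof. by move/ball_rVP => []. Qed.

Lemma rat_ball_near (x : vec) (r : R) : 0 < r ->
  exists k, ball x r `<=` cb (rat_ball k) /\ (rat_ball k).2 <= 2 * r.
Proof.
move=> r0; have r20 : 0 < r / 4 by rewrite divr_gt0.
have [q qx] := rat_rV_approx x r20.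
have [|e] := @rat_in_itvoo R (r + r / 4) (2 * r); first by lra.
rewrite in_itv/= => /andP[e1 e2].
exists (pickle (q, e)); rewrite /rat_ball pickleK /=; split; last exact: ltW.
move=> y xy; apply: (@le_ball _ _ _ (r / 4 + r)); first by rewrite addrC ltW.
by apply: ball_triangle xy; exact: ball_sym.
Qed.

Lemma cavg_ge0 g p : (forall x, 0 <= g x) -> (0 <= cavg g p)%E.
Proof.
move=> g0; rewrite /cavg; have [p0|p0] := ltP 0 p.2.
  apply: mule_ge0; last by apply: integral_ge0 => x _; rewrite lee_fin.
  by rewrite lee_fin invr_ge0 exprn_ge0// mulr_ge0// ltW.
rewrite (_ : ball p.1 p.2 = set0) ?integral_set0 ?mule0//.
by apply/seteqP; split => // x /ball_rV_gt0; rewrite ltNge p0.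
Qed.

Lemma le_cavg_maxfun g k x : cb (rat_ball k) x -> (cavg g (rat_ball k) <= maxfun g x)%E.
Proof. by move=> kx; apply: ereal_sup_ubound; exists k. Qed.

Lemma maxfun_ge0 g x : (forall x, 0 <= g x) -> (0 <= maxfun g x)%E.
Proof.
move=> g0; have [k [kx _]] := rat_ball_near x ltr01.
apply: le_trans (le_cavg_maxfun g (kx _ (ballxx _ ltr01))); exact: cavg_ge0.
Qed.

Lemma integral_cavg g p : 0 < p.2 ->
  (\int[mu]_(x in ball p.1 p.2) (g x)%:E = ((2 * p.2) ^+ n)%:E * cavg g p)%E.
Proof.
move=> p0; rewrite /cavg muleA -EFinM divff ?mul1e//.
by rewrite expf_neq0// gt_eqF// mulr_gt0.
Qed.

(** The maximal function ranges over rational cubes only. A cube centred at [x] is contained in one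
    of at most twice its radius, whence [4 * r] instead of [2 * r]. *)
Lemma integral_ball_maxfun g (x : vec) (r : R) :
  measurable_fun setT g -> (forall x, 0 <= g x) -> 0 < r ->
  (\int[mu]_(y in ball x r) (g y)%:E <= ((4 * r) ^+ n)%:E * maxfun g x)%E.
Proof.
move=> mg g0 r0; have [k [kx kr]] := rat_ball_near x r0.
have kxx : cb (rat_ball k) x by apply: kx; exact: ballxx.
have k0 := ball_rV_gt0 kxx.
apply: (@le_trans _ _ (\int[mu]_(y in cb (rat_ball k)) (g y)%:E)%E).
  apply: ge0_subset_integral => //; try exact: measurable_ball_rV.
    by apply: measurable_funTS; exact/measurable_EFinP.
  by move=> y _; rewrite lee_fin.
rewrite integral_cavg//; apply: lee_pmul.
- by rewrite lee_fin exprn_ge0// mulr_ge0// ltW.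
- exact: cavg_ge0.
- rewrite lee_fin lerXn2r ?nnegrE ?mulr_ge0 ?(ltW k0) ?(ltW r0)//; lra.
- exact: le_cavg_maxfun.
Qed.

Lemma maxfun_gtE g (c : \bar R) :
  [set x | (c < maxfun g x)%E] =
  \bigcup_(k in [set k | (c < cavg g (rat_ball k))%E]) cb (rat_ball k).
Proof.
apply/seteqP; split => x /=.
  by move=> /ereal_sup_gt[_ [k kx <-] ck]; exists k.
by move=> [k /= ck kx]; apply: lt_le_trans ck _; exact: le_cavg_maxfun.
Qed.

Lemma measurable_maxfun g : measurable_fun setT (maxfun g).
Proof.
apply: (measurability _ (ErealGenOInfty.measurableE R)) => // _ [_ [c ->] <-].
rewrite setTI (_ : _ @^-1` _ = [set x | (c%:E < maxfun g x)%E]).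
  by rewrite maxfun_gtE; apply: bigcup_measurable => k _; exact: measurable_ball_rV.
by apply/seteqP; split => x /=; rewrite in_itv/= andbT.
Qed.

(** The union is covered by the triples of disjoint selected cubes, each of which has measure less
    than 1/c times the integral of [g] over it; tripling costs 3^n and disjointness lets the
    integrals add up. *)
Lemma weak_type_finite g (c : R) (s : seq (vec * R)) :
  measurable_fun setT g -> (forall x, 0 <= g x) -> 0 < c ->
  (forall p, p \in s -> 0 < p.2 /\ (c%:E < cavg g p)%E) ->
  (c%:E * mu (\bigcup_(p in [set` s]) cb p) <= (3 ^+ n)%:E * \int[mu]_x (g x)%:E)%E.
Proof.
move=> mg g0 c0 hs.
have [|D [uD Ds tD DH]] := @vitali_cubes s; first by move=> p /hs[].
have mcb p : measurable (cb p) by exact: measurable_ball_rV.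
have sub : \bigcup_(p in [set` s]) cb p `<=`
    \big[setU/set0]_(i < size D) ball (nth (0, 0) D i).1 (3 * (nth (0, 0) D i).2).
  move=> x [p /= ps px]; have [d dD pd] := DH p ps.
  rewrite -(bigcup_mkord (size D)
    (fun i => ball (nth (0, 0) D i).1 (3 * (nth (0, 0) D i).2))); exists (index d D) => /=; first by rewrite index_mem.
  by rewrite nth_index//; exact: pd.
have mU : measurable (\bigcup_(p in [set` s]) cb p).
  by rewrite bigcup_seq; exact: bigsetU_measurable.
have le1 : (mu (\bigcup_(p in [set` s]) cb p) <=
    \sum_(d <- D) ((3 ^+ n) * (2 * d.2) ^+ n)%:E)%E.
  have := @content_subadditive _ _ _ mu (\bigcup_(p in [set` s]) cb p)
    (fun i => ball (nth (0, 0) D i).1 (3 * (nth (0, 0) D i).2)) (size D).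
  move=> /(_ (fun k _ => measurable_ball_rV _ _) mU sub)/le_trans; apply.
  rewrite (big_nth (0, 0)) big_mkord; apply: lee_sum => i _.
  have d0 : 0 < (nth (0, 0) D i).2 by have [] := hs _ (Ds _ (mem_nth (0, 0) (ltn_ord i))).
  rewrite [leLHS]lebesgue_rV_ball ?mulr_gt0//.
  by rewrite -exprMn mulrCA.
apply: le_trans (lee_wpmul2l _ le1) _; first by rewrite lee_fin ltW.
apply: (@le_trans _ _ ((3 ^+ n)%:E * \sum_(d <- D) \int[mu]_(x in cb d) (g x)%:E)%E).
  rewrite [X in (c%:E * X)%E]big_seq ge0_sume_distrr; last first.
    move=> d /Ds /hs[d0 _]; rewrite lee_fin mulr_ge0// ?exprn_ge0//.
    by rewrite mulr_ge0// ltW.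
  rewrite ge0_sume_distrr; last first.
    by move=> d _; apply: integral_ge0 => x _; rewrite lee_fin.
  rewrite [leRHS]big_seq; apply: lee_sum => d /Ds /hs[d0 cd].
  rewrite (integral_cavg _ d0) EFinM muleCA; apply: lee_wpmul2l.
    by rewrite lee_fin exprn_ge0.
  rewrite muleC; apply: lee_wpmul2l; last exact: ltW.
  by rewrite lee_fin exprn_ge0// mulr_ge0// ltW.
apply: lee_wpmul2l; first by rewrite lee_fin exprn_ge0.
rewrite -ge0_integral_bigsetU//.
- apply: ge0_subset_integral => //.
  + exact: bigsetU_measurable.
  + exact/measurable_EFinP.
  + by move=> x _; rewrite lee_fin.
- by apply: measurable_funTS; exact/measurable_EFinP.
- by move=> x _; rewrite lee_fin.
Qed.

(** The superlevel set is the increasing union of the finite unions over the first [N] rational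
    cubes, so the finite case passes to the limit. *)
Lemma weak_type g (c : R) :
  measurable_fun setT g -> (forall x, 0 <= g x) -> 0 < c ->
  (c%:E * mu [set x | c%:E < maxfun g x] <= (3 ^+ n)%:E * \int[mu]_x (g x)%:E)%E.
Proof.
move=> mg g0 c0.
pose F N := \bigcup_(k in [set k | (k < N)%N /\ (c%:E < cavg g (rat_ball k))%E]) cb (rat_ball k).
have mF N : measurable (F N) by apply: bigcup_measurable => k _; exact: measurable_ball_rV.
have ndF : nondecreasing_seq F.
  move=> N M NM; apply/subsetPset => x [k /= [kN ck] kx]; exists k => //=.
  by split => //; exact: leq_trans kN NM.
have UF : [set x | (c%:E < maxfun g x)%E] = \bigcup_N F N.
  rewrite maxfun_gtE; apply/seteqP; split => x.
    by move=> [k /= ck kx]; exists k.+1 => //; exists k.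
  by move=> [N _ [k /= [_ ck] kx]]; exists k.
have mUF : measurable (\bigcup_N F N) by exact: bigcupT_measurable.
rewrite UF; have cvF := nondecreasing_cvg_mu mF mUF ndF.
have cvcF : ((c%:E * mu (F N))%E @[N --> \oo] --> (c%:E * mu (\bigcup_N F N))%E).
  by apply: cvgeZl => //; exact: cvF.
rewrite -(cvg_lim _ cvcF)//; apply: lime_le; first by apply/cvg_ex; eexists; exact: cvcF.
apply: nearW => N.
pose s := [seq rat_ball k | k <- iota 0 N &
   (0 < (rat_ball k).2) && (c%:E < cavg g (rat_ball k))%E].
have FN : F N = \bigcup_(p in [set` s]) cb p.
  apply/seteqP; split => x.
    move=> [k /= [kN ck] kx]; exists (rat_ball k) => //=.
    apply/mapP; exists k => //; rewrite mem_filter mem_iota /= add0n kN andbT ck andbT.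
    exact: ball_rV_gt0 kx.
  move=> [p /= /mapP[k]]; rewrite mem_filter mem_iota /= add0n => /andP[/andP[_ ck] kN] -> kx.
  by exists k.
rewrite FN; apply: weak_type_finite => // p /mapP[k].
by rewrite mem_filter => /andP[/andP[? ?] _] ->.
Qed.

(** The part of [g] below [c] contributes at most [c] to any average, so an average above [2 * c]
    forces the average of the part above [c] to exceed [c]. *)
Lemma weak_type_trunc g (c : R) :
  measurable_fun setT g -> (forall x, 0 <= g x) -> 0 < c ->
  (c%:E * mu [set x | (2 * c)%R%:E < maxfun g x] <=
   (3 ^+ n)%:E * \int[mu]_(x in [set x | (c < g x)%R]) (g x)%:E)%E.
Proof.
move=> mg g0 c0.
have mA : measurable [set x | c < g x].
  rewrite (_ : [set x | c < g x] = setT `&` g @^-1` `]c, +oo[%classic).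
    by apply: mg.
  by apply/seteqP; split => x /=; rewrite in_itv/= andbT => // -[].
pose g1 := g \_ [set x | c < g x].
have mg1 : measurable_fun setT g1.
  by apply: (measurable_restrictT _ _).1 => //; exact: measurable_funTS.
have g10 x : 0 <= g1 x by rewrite /g1 patchE; case: ifP.
have gle x : g x <= c + g1 x.
  rewrite /g1 patchE; case: ifPn => [_|/negP h]; first by rewrite lerDr ltW.
  by rewrite [leRHS]addr0 leNgt; apply/negP => h'; apply: h; rewrite inE.
have avgle p : 0 < p.2 -> (cavg g p <= c%:E + cavg g1 p)%E.
  move=> p0; have pp : 0 < (2 * p.2) ^+ n by rewrite exprn_gt0// mulr_gt0.
  rewrite -(@lee_pmul2l _ ((2 * p.2) ^+ n)%:E) ?lte_fin// -integral_cavg//.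
  rewrite ge0_muleDr ?lee_fin ?(ltW c0) ?cavg_ge0// -integral_cavg//.
  rewrite muleC -[X in (_ * X)%E](lebesgue_rV_ball p.1 p0).
  rewrite -integral_cst; last exact: measurable_ball_rV.
  rewrite -ge0_integralD//.
  - apply: ge0_le_integral => //.
    + exact: measurable_ball_rV.
    + by move=> x _; rewrite lee_fin.
    + by apply: measurable_funTS; exact/measurable_EFinP.
    + apply: emeasurable_funD; first exact: measurable_cst.
      by apply: measurable_funTS; exact/measurable_EFinP.
    + by move=> x _; rewrite -EFinD lee_fin.
  - exact: measurable_ball_rV.
  - by move=> x _; rewrite lee_fin ltW.
  - by move=> x _; rewrite lee_fin.
  - by apply: measurable_funTS; exact/measurable_EFinP.
have sub : [set x | ((2 * c)%:E < maxfun g x)%E] `<=` [set x | (c%:E < maxfun g1 x)%E].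
  rewrite !maxfun_gtE => x [k /= ck kx]; exists k => //=.
  have := lt_le_trans ck (avgle _ (ball_rV_gt0 kx)).
  rewrite (_ : (2 * c)%R%:E = c%:E + c%:E)%E; last by rewrite -EFinD; congr EFin; lra.
  by rewrite lteD2lE.
have -> : (\int[mu]_(x in [set x | (c < g x)%R]) (g x)%:E = \int[mu]_x (g1 x)%:E)%E.
  rewrite integral_mkcond; apply: eq_integral => x _.
  by rewrite /g1 !patchE; case: ifP.
apply: le_trans (weak_type mg1 g10 c0); apply: lee_wpmul2l.
  by rewrite lee_fin ltW.
have mM h (d : R) : measurable [set x | (d%:E < maxfun h x)%E].
  by rewrite maxfun_gtE; apply: bigcup_measurable => k _; exact: measurable_ball_rV.
by apply: le_measure; rewrite ?inE//; exact: mM.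
Qed.

End maximal.

(** * The strong maximal inequality by dyadic levels *)

Section dyadic.
Context {R : realType}.

Lemma exists_dyadic_level (c0 r : R) : 0 < c0 -> 2 * c0 < r ->
  exists j : nat, 2 * (2 ^+ j * c0) < r <= 4 * (2 ^+ j * c0).
Proof.
move=> c00 cr.
have ex : exists j : nat, r <= 4 * (2 ^+ j * c0).
  pose k := (Num.truncn (r / (4 * c0))).+1; exists k.
  rewrite mulrCA -ler_pdivrMr ?mulr_gt0//.
  apply: (@le_trans _ _ k%:R); first by apply: ltW; exact: truncnS_gt.
  by rewrite -natrX ler_nat ltnW// ltn_expl.
case: (ex_minnP ex) => j rj jmin; exists j; rewrite rj andbT.
case: j rj jmin => [|j] rj jmin; first by rewrite expr0 mul1r.
rewrite ltNge; apply/negP => h; have := jmin j; rewrite ltnn.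
have -> : r <= 4 * (2 ^+ j * c0) by move: h; rewrite exprS; lra.
by move=> /(_ isT).
Qed.

(** If 2 c_j < m <= 4 c_j with c_j = 2^j c0, the single term of index j dominates m^q. For infinite
    m every term occurs and is at least (4 c0)^q, so the series diverges. *)
Lemma le_dyadic_series (c0 q : R) (m : \bar R) : 0 < c0 -> 0 < q ->
  ((2 * c0)%R%:E < m ->
   m `^ q <= \sum_(j <oo) (if (2 * (2 ^+ j * c0))%R%:E < m
     then ((4 * (2 ^+ j * c0)) `^ q)%:E else 0))%E.
Proof.
move=> c00 q0 cm.
pose F j : \bar R := if ((2 * (2 ^+ j * c0))%R%:E < m)%E
  then ((4 * (2 ^+ j * c0)) `^ q)%:E else 0%E.
rewrite -[leRHS]/(\sum_(j <oo) F j)%E.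
have F0 j : (0 <= F j)%E by rewrite /F; case: ifP => // _; rewrite lee_fin powR_ge0.
case: m cm @F F0 => [r| |] cm F F0; last by move: cm; rewrite ltNge leNye.
- have [|j /andP[j1 j2]] := @exists_dyadic_level c0 r c00 _; first by rewrite -lte_fin.
  apply: le_trans (nneseries_lim_ge j.+1 _) => //.
  rewrite big_nat_recr//=; apply: (@le_trans _ _ (F j)); last first.
    by apply: leeDr; apply: sume_ge0.
  rewrite /F lte_fin j1 lee_fin; apply: ge0_ler_powR => //; first exact: ltW.
    rewrite nnegrE; apply: le_trans (ltW j1).
    by rewrite !mulr_ge0 ?exprn_ge0 ?ltW.
  by rewrite nnegrE !mulr_ge0 ?exprn_ge0 ?ltW.
- rewrite /= gt_eqF//; set S := (X in (_ <= X)%E).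
  have S0 : (0 <= S)%E by apply: nneseries_ge0.
  pose w : R := (4 * c0) `^ q.
  have w0 : 0 < w by rewrite powR_gt0// mulr_gt0.
  have SN N : ((N%:R * w)%:E <= S)%E.
    apply: le_trans (nneseries_lim_ge N _) => //.
    elim: N => [|N IH]; first by rewrite mul0r big_geq.
    rewrite big_nat_recr//= -natr1 mulrDl mul1r EFinD; apply: leeD => //.
    rewrite /F ltry lee_fin; apply: ge0_ler_powR; rewrite ?nnegrE.
    + exact: ltW.
    + by rewrite mulr_ge0// ltW.
    + by rewrite !mulr_ge0 ?exprn_ge0 ?ltW.
    + rewrite ler_pM2l// ler_peMl ?(ltW c00)//.
      by rewrite exprn_ege1// ler1n.
  case: S S0 SN => [s| |]// s0 SN.
  have := SN (Num.truncn (s / w)).+1; rewrite lee_fin leNgt => /negP; case.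
  by rewrite -ltr_pdivrMr// truncnS_gt.
Qed.

(** The terms grow geometrically, so the sum is controlled by the last level below [t]. *)
Lemma dyadic_sum_le (c0 e t : R) (N : nat) : 0 < c0 -> 0 < e -> 0 <= t ->
  \sum_(j < N) (if 2 ^+ j * c0 < t then (2 ^+ j * c0) `^ e else 0) <=
  2 `^ e / (2 `^ e - 1) * t `^ e.
Proof.
move=> c00 e0 t0; set rho := 2 `^ e.
have rho1 : 1 < rho.
  rewrite /rho /powR ifF ?gt_eqF// expR_gt1 mulr_gt0// ln_gt0//.
  by rewrite ltr1n.
have rho1' : 0 < rho - 1 by rewrite subr_gt0.
have rho0 : 0 <= rho by apply: ltW; apply: lt_trans rho1.
have cS j : (2 ^+ j.+1 * c0) `^ e = rho * (2 ^+ j * c0) `^ e.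
  by rewrite exprS -mulrA powRM// mulr_ge0 ?exprn_ge0// ltW.
have full M : \sum_(j < M) (if 2 ^+ j * c0 < t then (2 ^+ j * c0) `^ e else 0) <=
    (2 ^+ M * c0) `^ e / (rho - 1).
  elim: M => [|M IH]; first by rewrite big_ord0 divr_ge0 ?powR_ge0// ltW.
  rewrite big_ord_recr/= cS.
  have -> : rho * (2 ^+ M * c0) `^ e / (rho - 1) =
    (2 ^+ M * c0) `^ e / (rho - 1) + (2 ^+ M * c0) `^ e.
    by field; rewrite gt_eqF.
  by apply: lerD => //; case: ifP => // _; exact: powR_ge0.
elim: N => [|N IH].
  by rewrite big_ord0 mulr_ge0 ?powR_ge0// divr_ge0// ltW.
rewrite big_ord_recr/=; case: ifP => [Nt|_]; last by rewrite addr0.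
apply: le_trans (lerD (full N) (lexx _)) _.
have -> : (2 ^+ N * c0) `^ e / (rho - 1) + (2 ^+ N * c0) `^ e =
  rho / (rho - 1) * (2 ^+ N * c0) `^ e by field; rewrite gt_eqF.
apply: ler_wpM2l; first by rewrite divr_ge0// ltW.
apply: ge0_ler_powR; rewrite ?nnegrE//; last exact: ltW.
  exact: ltW.
by rewrite mulr_ge0 ?exprn_ge0// ltW.
Qed.

End dyadic.

Section strong.
Context {R : realType} {n : nat}.
Local Notation mu := (lebesgue_rV n).
Local Notation vec := 'rV[R]_n.

(** Marcinkiewicz interpolation with a sum over dyadic levels c_j in place of an integral. The weak
    estimate for the part of [g] above c_j, weighted by (4 c_j)^q, leaves c_j^(q-1) g on the set
    where g > c_j; summing over j inside the integral recovers g^q. The constant does not involve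
    [c0]. *)
Lemma strong_type_cut (q c0 : R) (g : vec -> R) : 1 < q -> 0 < c0 ->
  measurable_fun setT g -> (forall x, 0 <= g x) ->
  (\int[mu]_(x in [set x | (2 * c0)%R%:E < maxfun g x]) (maxfun g x `^ q) <=
   (3 ^+ n * 4 `^ q * (2 `^ (q - 1) / (2 `^ (q - 1) - 1)))%R%:E *
     \int[mu]_x (g x `^ q)%:E)%E.
Proof.
move=> q1 c00 mg g0.
have q0 : 0 < q by apply: lt_trans q1.
have e0 : 0 < q - 1 by rewrite subr_gt0.
pose c j : R := 2 ^+ j * c0.
have cj0 j : 0 < c j by rewrite mulr_gt0// exprn_gt0.
pose w j : R := (4 * c j) `^ q.
pose A j : set vec := [set x | ((2 * c j)%:E < maxfun g x)%E].
have mA j : measurable (A j).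
  by rewrite /A maxfun_gtE; apply: bigcup_measurable => k _; exact: measurable_ball_rV.
have mA0 : measurable [set x | ((2 * c0)%:E < maxfun g x)%E].
  by rewrite maxfun_gtE; apply: bigcup_measurable => k _; exact: measurable_ball_rV.
pose Bs j : set vec := [set x | c j < g x].
have mB j : measurable (Bs j).
  rewrite (_ : Bs j = setT `&` g @^-1` `]c j, +oo[%classic).
    by apply: mg.
  by apply/seteqP; split => x /=; rewrite in_itv/= andbT => // -[].
pose F j : vec -> \bar R := (cst (w j)%:E \_ (A j)).
have mF j : measurable_fun setT (F j) by apply: (measurable_restrictT _ _).1.
have F0 j x : (0 <= F j x)%E.
  by rewrite /F patchE; case: ifP => _ //=; rewrite lee_fin powR_ge0.
pose K : R := 3 ^+ n * 4 `^ q.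
have K0 : 0 <= K by rewrite mulr_ge0 ?exprn_ge0 ?powR_ge0.
pose G j : vec -> \bar R := ((fun x => (K * (c j `^ (q - 1) * g x))%:E) \_ (Bs j)).
have mG j : measurable_fun setT (G j).
  apply: (measurable_restrictT _ _).1 => //; apply: measurable_funTS.
  by apply/measurable_EFinP; do 2 apply: measurable_funM => //.
have G0 j x : (0 <= G j x)%E.
  rewrite /G patchE; case: ifP => _ //=; rewrite lee_fin mulr_ge0// mulr_ge0//.
  exact: powR_ge0.
have FG j : (\int[mu]_x F j x <= \int[mu]_x G j x)%E.
  rewrite /F /G -!integral_mkcond integral_cst//.
  have -> : (\int[mu]_(x in Bs j) (K * (c j `^ (q - 1) * g x))%:E =
      (K * c j `^ (q - 1))%:E * \int[mu]_(x in Bs j) (g x)%:E)%E.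
    under eq_integral do rewrite mulrA EFinM.
    apply: ge0_integralZl => //.
    - by apply: measurable_funTS; exact/measurable_EFinP.
    - by move=> x _; rewrite lee_fin.
    - by rewrite lee_fin mulr_ge0 ?powR_ge0.
  have W := weak_type_trunc mg g0 (cj0 j).
  have wE : w j = 4 `^ q * c j `^ (q - 1) * c j.
    rewrite /w powRM//; last exact: ltW.
    by rewrite -mulrA [in RHS](mulrC (c j `^ _)) mulr_powRB1// ltW.
  rewrite wE EFinM -muleA.
  apply: le_trans (lee_wpmul2l _ W) _; first by rewrite lee_fin mulr_ge0 ?powR_ge0.
  have KE : 4 `^ q * c j `^ (q - 1) * 3 ^+ n = K * c j `^ (q - 1) by rewrite /K; ring.
  by rewrite muleA -EFinM KE.
have EF x : A 0%N x -> (maxfun g x `^ q <= \sum_(j <oo) F j x)%E.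
  rewrite /A/= /c expr0 mul1r => h.
  apply: le_trans (le_dyadic_series c00 q0 h) _.
  rewrite le_eqVlt; apply/orP; left; apply/eqP; apply: eq_eseriesr => j _.
  rewrite /F patchE; case: ifPn => [h1|h1].
    by rewrite ifT// inE.
  by rewrite ifF//; apply/negP; rewrite inE => h2; move/negP: h1; apply.
have A0 : [set x | ((2 * c0)%:E < maxfun g x)%E] = A 0%N.
  by rewrite /A /c expr0 mul1r.
have EG x : (\sum_(j <oo) G j x <=
   (K * (2 `^ (q - 1) / (2 `^ (q - 1) - 1)))%:E * (g x `^ q)%:E)%E.
  apply: lime_le; first by apply: is_cvg_nneseries.
  apply: nearW => N; rewrite big_mkord.
  have -> : (\sum_(j < N) G j x = (K * (g x *
      \sum_(j < N) (if 2 ^+ j * c0 < g x then (2 ^+ j * c0) `^ (q - 1) else 0)))%:E)%E.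
    rewrite mulr_sumr mulr_sumr -sumEFin; apply: eq_bigr => j _.
    rewrite /G patchE /c; case: ifPn => [|/negP] h.
      by rewrite ifT; [congr EFin; ring|rewrite inE in h].
    rewrite ifF ?mulr0//; apply/negP => h'; apply: h; by rewrite inE.
  rewrite -EFinM lee_fin -[leRHS]mulrA; apply: ler_wpM2l => //.
  rewrite -(mulr_powRB1 (g0 x) q0) mulrCA; apply: ler_wpM2l => //.
  exact: dyadic_sum_le.
rewrite A0; apply: (@le_trans _ _ (\int[mu]_(x in A 0%N) (\sum_(j <oo) F j x))%E).
  apply: ge0_le_integral => //.
  - by move=> x _; exact: poweR_ge0.
  - apply: measurable_funTS; apply: (measurableT_comp (measurable_poweR q)).
    exact: measurable_maxfun.
  - apply: measurable_funTS; apply: ge0_emeasurable_sum => //.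
apply: (@le_trans _ _ (\int[mu]_x (\sum_(j <oo) F j x))%E).
  apply: ge0_subset_integral => //.
  - by apply: ge0_emeasurable_sum.
  - by move=> x _; apply: nneseries_ge0.
rewrite integral_nneseries//.
apply: (@le_trans _ _ (\sum_(j <oo) \int[mu]_x G j x)%E).
  apply: lee_nneseries => [j _|j _]; last exact: FG.
  by move=> _; apply: integral_ge0 => x _; exact: F0.
rewrite -integral_nneseries// -ge0_integralZl//.
- apply: ge0_le_integral => //.
  + by move=> x _; apply: nneseries_ge0.
  + by apply: ge0_emeasurable_sum.
  + apply: measurable_funeM; apply/measurable_EFinP.
    exact: (measurableT_comp (measurable_powR q) mg).
- apply/measurable_EFinP; exact: (measurableT_comp (measurable_powR q) mg).
- by move=> x _; rewrite lee_fin powR_ge0.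
- have r1 : 1 <= (2 : R) `^ (q - 1) by rewrite -[leLHS](powRr0 2) ler_powR ?ler1n ?ltW.
  by rewrite lee_fin; apply: mulr_ge0 => //; apply: divr_ge0; rewrite ?powR_ge0 ?subr_ge0.
Qed.

(** The levels [c0] = 1/(k+1) exhaust the set where the maximal function is positive, and monotone
    convergence applies; elsewhere the integrand is 0^q = 0. *)
Lemma strong_type (q : R) : 1 < q -> exists2 C : R, 0 <= C &
  forall g : vec -> R, measurable_fun setT g -> (forall x, 0 <= g x) ->
  (\int[mu]_x (maxfun g x `^ q) <= C%:E * \int[mu]_x (g x `^ q)%:E)%E.
Proof.
move=> q1; have q0 : 0 < q by apply: lt_trans q1.
exists (3 ^+ n * 4 `^ q * (2 `^ (q - 1) / (2 `^ (q - 1) - 1))).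
  apply: mulr_ge0; first by apply: mulr_ge0; rewrite ?exprn_ge0 ?powR_ge0.
  have r1 : 1 <= (2 : R) `^ (q - 1).
    by rewrite -[leLHS](powRr0 2) ler_powR ?ler1n// subr_ge0 ltW.
  by apply: divr_ge0; rewrite ?powR_ge0 ?subr_ge0.
move=> g mg g0; set C := (X in (X%:E * _)%E).
pose E k : set vec := [set x | ((2 * k.+1%:R^-1)%R%:E < maxfun g x)%E].
have mE k : measurable (E k).
  by rewrite /E maxfun_gtE; apply: bigcup_measurable => j _; exact: measurable_ball_rV.
have ndE : nondecreasing_seq E.
  move=> k l kl; apply/subsetPset => x; rewrite /E /=; apply: le_lt_trans.
  by rewrite lee_fin ler_pM2l// lef_pV2 ?posrE ?ltr0n// ler_nat.
have mMq D : measurable_fun D (fun x => maxfun g x `^ q)%E.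
  apply: measurable_funTS; apply: (measurableT_comp (measurable_poweR q)).
  exact: measurable_maxfun.
have -> : (\int[mu]_x (maxfun g x `^ q) = \int[mu]_(x in \bigcup_k E k) (maxfun g x `^ q))%E.
  rewrite [RHS]integral_mkcond; apply: eq_integral => x _; rewrite patchE.
  case: ifPn => // /negP xE.
  suff -> : maxfun g x = 0%E by rewrite poweR0r// gt_eqF.
  apply/eqP; rewrite eq_le maxfun_ge0// andbT leNgt; apply/negP => M0.
  apply: xE; rewrite inE.
  have [k hk] : exists k : nat, ((2 * k.+1%:R^-1)%R%:E < maxfun g x)%E.
    case: (maxfun g x) M0 => [r| |]//; last by exists 0%N; rewrite ltry.
    rewrite lte_fin => r0; exists (Num.truncn (2 / r)); rewrite lte_fin.
    by rewrite ltr_pdivrMr ?ltr0n// mulrC -ltr_pdivrMr// truncnS_gt.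
  by exists k.
have := @ge0_nondecreasing_set_cvg_integral _ _ R E (fun x => maxfun g x `^ q)%E mu
  ndE mE (fun=> mMq _) (fun _ _ _ => poweR_ge0 _ _).
move=> cv; rewrite -(cvg_lim _ cv)//.
apply: lime_le; first by apply/cvg_ex; eexists; exact: cv.
by apply: nearW => k; apply: strong_type_cut.
Qed.

End strong.

(** * Lebesgue points *)

Section lebesgue_points.
Context {R : realType} {n : nat}.
Local Notation mu := (lebesgue_rV n).
Local Notation vec := 'rV[R]_n.

(** By the weak estimate, the set where all the maximal functions exceed 1/(m+1) has measure at most
    3^n (m+1) times the integral of any single [f k], hence measure 0. *)
Lemma ae_maxfun_small (f : nat -> vec -> R) :
  (forall k, measurable_fun setT (f k)) -> (forall k x, 0 <= f k x) ->
  (forall e : R, 0 < e -> exists k, (\int[mu]_x (f k x)%:E <= e%:E)%E) ->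
  \forall x \ae mu, forall c : R, 0 < c -> exists k, (maxfun (f k) x <= c%:E)%E.
Proof.
move=> mf f0 fe.
have H m : \forall x \ae mu, exists k, (maxfun (f k) x <= (m.+1%:R^-1)%:E)%E.
  pose A k : set vec := [set x | ((m.+1%:R^-1)%:E < maxfun (f k) x)%E].
  have mA k : measurable (A k).
    by rewrite /A maxfun_gtE; apply: bigcup_measurable => j _; exact: measurable_ball_rV.
  exists (\bigcap_k A k); split; first exact: bigcapT_measurable.
    apply/eqP; rewrite eq_le measure_ge0 andbT; apply/lee_addgt0Pr => e e0.
    rewrite add0e.
    have m0 : (0 : R) < m.+1%:R^-1 by rewrite invr_gt0 ltr0n.
    have e0' : 0 < e / 3 ^+ n * m.+1%:R^-1 by rewrite mulr_gt0// divr_gt0// exprn_gt0.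
    have [k hk] := fe _ e0'.
    apply: (@le_trans _ _ (mu (A k))).
      apply: le_measure; rewrite ?inE//; first exact: bigcapT_measurable.
      by move=> x; apply.
    rewrite -(@lee_pmul2l _ (m.+1%:R^-1)%:E) ?lte_fin//.
    apply: le_trans (weak_type (mf k) (f0 k) m0) _.
    apply: le_trans (lee_wpmul2l _ hk) _; first by rewrite lee_fin exprn_ge0.
    rewrite -!EFinM lee_fin le_eqVlt; apply/orP; left; apply/eqP.
    have h3 : (3 : R) ^+ n != 0 by rewrite expf_neq0.
    by rewrite mulrA mulrCA divff// mulr1 mulrC.
  move=> x /= hx k _; rewrite /A /= ltNge; apply/negP => h; apply: hx.
  by exists k.
move/ae_foralln: H; apply: filterS => x hx c c0.
have [k hk] := hx (Num.truncn c^-1); exists k; apply: le_trans hk _.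
rewrite lee_fin -[leRHS]invrK lef_pV2 ?posrE ?invr_gt0 ?ltr0n//.
by apply: ltW; exact: truncnS_gt.
Qed.

(** The upper half of the Lebesgue point property. It is stable under sums and nonnegative
    multiples, and applied to |Du - m|^s it already says that Du is close to Du(x) on average. *)
Definition avg_limsup_le (h : vec -> R) (x : vec) : Prop :=
  forall e : R, 0 < e -> exists2 d : R, 0 < d & forall r, 0 < r -> r < d ->
    (\int[mu]_(y in ball x r) (h y)%:E <= ((2 * r) ^+ n * (h x + e))%:E)%E.

Definition density0 (A : set vec) (x : vec) : Prop :=
  forall e : R, 0 < e -> exists2 d : R, 0 < d & forall r, 0 < r -> r < d ->
    (mu (A `&` ball x r) <= ((2 * r) ^+ n * e)%:E)%E.

Lemma density0S (A B : set vec) x : measurable A -> measurable B ->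
  A `<=` B -> density0 B x -> density0 A x.
Proof.
move=> mA mB AB dB e e0; have [d d0 hd] := dB e e0; exists d => // r r0 rd.
apply: le_trans (hd r r0 rd); apply: le_measure; rewrite ?inE.
- by apply: measurableI => //; exact: measurable_ball_rV.
- by apply: measurableI => //; exact: measurable_ball_rV.
- exact: setSI.
Qed.

Lemma density0_disjoint (A : set vec) x d : 0 < d ->
  A `&` ball x d = set0 -> density0 A x.
Proof.
move=> d0 Ad e e0; exists d => // r r0 rd.
rewrite (_ : A `&` ball x r = set0).
  by rewrite measure0 lee_fin mulr_ge0 ?exprn_ge0 ?mulr_ge0 ?ltW.
apply/seteqP; split => // y [Ay xy].
by rewrite -Ad; split => //; exact: le_ball (ltW rd) _ xy.
Qed.

Lemma density0U (A B : set vec) x : measurable A -> measurable B ->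
  density0 A x -> density0 B x -> density0 (A `|` B) x.
Proof.
move=> mA mB dA dB e e0; have e20 : 0 < e / 2 by rewrite divr_gt0.
have [d1 d10 h1] := dA _ e20; have [d2 d20 h2] := dB _ e20.
exists (Num.min d1 d2); first by rewrite lt_min d10.
move=> r r0; rewrite lt_min => /andP[rd1 rd2]; rewrite setIUl.
have mb := measurable_ball_rV x r.
apply: le_trans (measureU2 _ _ _) _; try exact: measurableI.
apply: le_trans (leeD (h1 r r0 rd1) (h2 r r0 rd2)) _.
by rewrite -EFinD lee_fin -mulrDr -splitr.
Qed.

(* These sets form a sigma-algebra containing the coordinate half-spaces, which proves
   the density theorem without approximation by continuous functions. *)
Definition density_set (A : set vec) : Prop :=
  measurable A /\ \forall x \ae mu,
    (~ A x -> density0 A x) /\ (A x -> density0 (~` A) x).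

Lemma density_setC A : density_set A -> density_set (~` A).
Proof.
move=> [mA dA]; split; first exact: measurableC.
apply: filterS dA => x [h1 h2]; rewrite setCK; split => [/contrapT//|]; exact: h1.
Qed.

(** At a point outside the union, finitely many sets together have density 0. The tail of the union,
    cut to a bounded cube, has measure tending to 0, so almost everywhere its maximal function, and
    with it its density, is as small as desired. At a point of the union one of the sets
    suffices. *)
Lemma density_set_bigcup (A : (set vec)^nat) :
  (forall k, density_set (A k)) -> density_set (\bigcup_k A k).
Proof.
move=> dA; have mA k : measurable (A k) by have [] := dA k.
have mU : measurable (\bigcup_k A k) by exact: bigcupT_measurable.
split => //.
pose B K : set vec := \big[setU/set0]_(k < K) A k.
have mB K : measurable (B K) by exact: bigsetU_measurable.
(* The cut makes the measures finite. Radius N + 2 leaves room for a cube of radius below 1 around a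
   point of norm below N + 1. *)
pose D (N K : nat) : set vec :=
  ((\bigcup_k A k) `\` B K) `&` ball (0 : vec) N.+2%:R.
have mD N K : measurable (D N K).
  by apply: measurableI; [exact: measurableD|exact: measurable_ball_rV].
have small N : \forall x \ae mu, forall c : R, 0 < c ->
    exists K, (maxfun (\1_(D N K)) x <= c%:E)%E.
  apply: ae_maxfun_small.
  - by move=> k; exact: measurable_indic.
  - by move=> k x; rewrite indicE.
  - move=> e e0.
    have D0 : mu (D N K) @[K --> \oo] --> 0%E.
      rewrite -(measure0 mu).
      have -> : set0 = \bigcap_K D N K.
        apply/esym/seteqP; split => // x hx.
        have [[[k _ Akx] _] _] := hx 0%N I.
        have [[_ nB] _] := hx k.+1 I; apply: nB.
        by rewrite /B -bigcup_mkord; exists k => //=.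
      apply: nonincreasing_cvg_mu => //.
      - apply: (@le_lt_trans _ _ (mu (ball (0 : vec) N.+2%:R))).
          apply: le_measure; rewrite ?inE//; first exact: measurable_ball_rV.
          exact: subIsetr.
        by rewrite [ltLHS]lebesgue_rV_ball ?ltr0n// ltry.
      - exact: bigcapT_measurable.
      - move=> K L KL; apply/subsetPset; apply: setSI; apply: setDS.
        exact: subset_bigsetU.
    have [K _ hK] : \forall K \near \oo, (mu (D N K) < e%:E)%E.
      apply: (D0 [set z | (z < e%:E)%E]); apply: open_nbhs_nbhs.
      split; last by rewrite /= lte_fin.
      exact: open_ereal_lt_ereal.
    exists K; rewrite integral_indic// setIT; apply: ltW; exact: (hK K (leqnn K)).
have dall : \forall x \ae mu, forall k,
   (~ A k x -> density0 (A k) x) /\ (A k x -> density0 (~` A k) x).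
  by apply/ae_foralln => k; have [] := dA k.
move/ae_foralln: small => small.
apply: filterS2 small dall => x small dall; split; last first.
  move=> [k _ Akx]; apply: (@density0S _ (~` A k)).
  - exact: measurableC.
  - exact: measurableC.
  - by apply: subsetC => y Aky; exists k.
  - exact: (dall k).2.
move=> nAx e e0.
pose N := Num.truncn `|x|.
have xN : `|x| < N.+1%:R by exact: truncnS_gt.
have c0 : 0 < e / 2 / 2 ^+ n by rewrite !divr_gt0// exprn_gt0.
have [K hK] := small N _ c0.
have dB : density0 (B K) x.
  have : forall k, density0 (A k) x.
    by move=> k; apply: (dall k).1 => Akx; apply: nAx; exists k.
  rewrite /B; elim: K {hK} => [_|K IH h].
    by rewrite big_ord0; apply: (@density0_disjoint _ _ 1) => //; rewrite set0I.
  rewrite big_ord_recr /=; apply: density0U => //; [exact: mB|exact: IH].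
have [d d0 hd] := dB _ (divr_gt0 e0 (ltr0n R 2)).
exists (Num.min d 1); first by rewrite lt_min d0/=.
move=> r r0; rewrite lt_min => /andP[rd r1].
have mb := measurable_ball_rV x r.
apply: (@le_trans _ _ (mu ((B K `&` ball x r) `|` (D N K `&` ball x r)))).
  apply: le_measure; rewrite ?inE.
  - exact: measurableI.
  - by apply: measurableU; exact: measurableI.
  - move=> y [Uy xy]; have [By|nBy] := pselect (B K y); [by left|right].
    split => //; split => //.
    move: xy; rewrite mx_norm_ball /ball_ /= sub0r normrN => xy.
    rewrite -(subrK x y); apply: le_lt_trans (ler_normD _ _) _.
    rewrite distrC -natr1 addrC; apply: ltrD => //; exact: lt_trans xy r1.
apply: le_trans (measureU2 _ _ _) _; try exact: measurableI.
have MD : (mu (D N K `&` ball x r) <= ((2 * r) ^+ n * (e / 2))%:E)%E.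
  have -> : mu (D N K `&` ball x r) = (\int[mu]_(y in ball x r) (\1_(D N K) y)%:E)%E.
    by rewrite integral_indic// setIC.
  apply: le_trans (integral_ball_maxfun _ _ _ _) _ => //.
  apply: le_trans (lee_wpmul2l _ hK) _.
    by rewrite lee_fin exprn_ge0// mulr_ge0// ltW.
  rewrite -EFinM lee_fin le_eqVlt; apply/orP; left; apply/eqP.
  have -> : 4 * r = 2 * (2 * r) by ring.
  rewrite [(2 * (2 * r)) ^+ n]exprMn; field.
  by rewrite expf_neq0.
apply: le_trans (leeD (hd r r0 rd) MD) _.
by rewrite -EFinD lee_fin -mulrDr -splitr.
Qed.

Lemma density_set_sigma : sigma_algebra setT density_set.
Proof.
split.
- split => //; apply: aeW => x; split => // _.
  by apply: (@density0_disjoint _ _ 1) => //; rewrite set0I.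
- by move=> A /density_setC; rewrite setTD.
- exact: density_set_bigcup.
Qed.

(** Off the hyperplane x_i = a every point has a cube lying on one side; the hyperplane is null
    because a line in direction [i] meets it once. *)
Lemma density_set_ray (i : 'I_n) (a : R) : density_set [set x | a < x ord0 i].
Proof.
have mS : measurable [set x : vec | a < x ord0 i].
  rewrite (_ : [set _ | _] = rV_coord i @^-1` `]a, +oo[%classic).
    by rewrite -[X in measurable X]setTI; exact: measurable_rV_coord.
  by apply/seteqP; split => x /=; rewrite in_itv/= andbT.
have mE : measurable [set x : vec | x ord0 i = a].
  rewrite (_ : [set _ | _] = rV_coord i @^-1` [set a]).
    by rewrite -[X in measurable X]setTI; exact: measurable_rV_coord.
  by apply/seteqP; split.
split => //; exists [set x : vec | x ord0 i = a]; split => //.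
  apply: (@lebesgue_rV_null_lines _ _ i) => // x.
  apply: (@sub_countable _ _ _ [set a - x ord0 i]); last exact: countable1.
  apply: subset_card_le => s /=; rewrite !mxE !eqxx mulr1 => <-.
  by rewrite addrAC subrr add0r.
move=> x /= hx; apply: contrapT => xa; apply: hx; split => [/negP|ax].
  rewrite -leNgt => ax; have {}ax : x ord0 i < a by rewrite lt_neqAle ax andbT; apply/eqP.
  have d0 : 0 < a - x ord0 i by rewrite subr_gt0.
  apply: (@density0_disjoint _ _ (a - x ord0 i)) => //.
  apply/seteqP; split => // y [/= ay /ball_rVP[_ /(_ i)]].
  by rewrite ltr_norml => /andP[]; lra.
have d0 : 0 < x ord0 i - a by rewrite subr_gt0.
apply: (@density0_disjoint _ _ (x ord0 i - a)) => //.
apply/seteqP; split => // y [/= /negP]; rewrite -leNgt => ay /ball_rVP[_ /(_ i)].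
by rewrite ltr_norml => /andP[]; lra.
Qed.

Lemma density_set_measurable (A : set vec) : measurable A -> density_set A.
Proof.
move: A; apply: smallest_sub; first exact: density_set_sigma.
rewrite -bigcup_seq => A [i _ [B mB <-]].
rewrite setTI; move: B mB.
suff : measurable `<=` [set B : set (measurableTypeR R) | density_set (rV_coord i @^-1` B)].
  by move=> h B mB; exact: h.
rewrite [X in X `<=` _](@RGenOInfty.measurableE R).
apply: smallest_sub.
  have [d0 dC dU] := density_set_sigma; split.
  - by rewrite /= preimage_set0.
  - by move=> B /= hB; rewrite setTD preimage_setC; exact: density_setC.
  - by move=> F hF; rewrite /= preimage_bigcup; exact: dU.
move=> _ [a ->] /=; rewrite (_ : _ @^-1` _ = [set x : vec | a < x ord0 i]).
  exact: density_set_ray.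
by apply/seteqP; split => x /=; rewrite in_itv/= andbT.
Qed.

Import HBNNSimple.

Lemma avg_limsup_le_indic (A : set vec) x : measurable A ->
  (~ A x -> density0 A x) -> avg_limsup_le (\1_A) x.
Proof.
move=> mA dA e e0; have [Ax|nAx] := pselect (A x).
  exists 1 => // r r0 _; rewrite indicE mem_set//.
  apply: (@le_trans _ _ (\int[mu]_(y in ball x r) cst 1%:E y)%E).
    apply: ge0_le_integral => //.
    - exact: measurable_ball_rV.
    - by apply: measurable_funTS; apply/measurable_EFinP; exact: measurable_indic.
    - by move=> y _; rewrite lee_fin indicE lern1 leq_b1.
  rewrite integral_cst; last exact: measurable_ball_rV.
  rewrite mul1e [leLHS]lebesgue_rV_ball// lee_fin ler_peMr ?exprn_ge0 ?mulr_ge0 ?ltW//.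
  by rewrite /= ltrDl.
have [d d0 hd] := dA nAx _ e0; exists d => // r r0 rd.
rewrite indicE memNset// add0r integral_indic//; last exact: measurable_ball_rV.
exact: hd.
Qed.

Lemma avg_limsup_leD (f g : vec -> R) x :
  measurable_fun setT f -> measurable_fun setT g ->
  (forall x, 0 <= f x) -> (forall x, 0 <= g x) ->
  avg_limsup_le f x -> avg_limsup_le g x -> avg_limsup_le (fun y => f y + g y) x.
Proof.
move=> mf mg f0 g0 hf hg e e0; have e20 : 0 < e / 2 by rewrite divr_gt0.
have [d1 d10 h1] := hf _ e20; have [d2 d20 h2] := hg _ e20.
exists (Num.min d1 d2); first by rewrite lt_min d10.
move=> r r0; rewrite lt_min => /andP[rd1 rd2].
under eq_integral do rewrite EFinD.
rewrite ge0_integralD//; last 5 first.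
- exact: measurable_ball_rV.
- by move=> y _; rewrite lee_fin.
- by apply: measurable_funTS; exact/measurable_EFinP.
- by move=> y _; rewrite lee_fin.
- by apply: measurable_funTS; exact/measurable_EFinP.
apply: le_trans (leeD (h1 r r0 rd1) (h2 r r0 rd2)) _.
rewrite -EFinD lee_fin -mulrDr; apply: ler_wpM2l; last lra.
by rewrite exprn_ge0// mulr_ge0// ltW.
Qed.

Lemma avg_limsup_leZ (f : vec -> R) (c : R) x : 0 <= c ->
  measurable_fun setT f -> (forall x, 0 <= f x) ->
  avg_limsup_le f x -> avg_limsup_le (fun y => c * f y) x.
Proof.
move=> c0 mf f0 hf e e0.
have c10 : 0 < c + 1 by rewrite ltr_wpDl.
have [d d0 hd] := hf _ (divr_gt0 e0 c10); exists d => // r r0 rd.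
under eq_integral do rewrite EFinM.
rewrite ge0_integralZl//; last 3 first.
- exact: measurable_ball_rV.
- by apply: measurable_funTS; exact/measurable_EFinP.
- by move=> y _; rewrite lee_fin.
apply: le_trans (lee_wpmul2l _ (hd r r0 rd)) _; first by rewrite lee_fin.
rewrite -EFinM lee_fin mulrCA; apply: ler_wpM2l.
  by rewrite exprn_ge0// mulr_ge0// ltW.
rewrite mulrDr lerD2l mulrA ler_pdivrMr// mulrC ler_wpM2l ?(ltW e0)//.
by rewrite lerDl.
Qed.

Lemma ae_avg_limsup_le_nnsfun (g : {nnsfun vec >-> R}) :
  \forall x \ae mu, avg_limsup_le (g : vec -> R) x.
Proof.
pose s : seq R := finmap.enum_fset (fset_set (range g)).
have H : \forall x \ae mu, forall i : nat,
    ~ (g @^-1` [set s`_i]) x -> density0 (g @^-1` [set s`_i]) x.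
  apply/ae_foralln => i.
  have [_] := density_set_measurable (measurable_sfunP g (measurable_set1 s`_i)).
  by apply: filterS => x [].
apply: filterS H => x H.
have -> : (g : vec -> R) = fun y =>
    \sum_(i < size s) (`|s`_i| * \1_(g @^-1` [set s`_i]) y).
  apply/funext => y; rewrite [LHS](fimfunEord g y); apply: eq_bigr => i _.
  rewrite indicE; case: (boolP (y \in _)) => [|_]; last by rewrite !mulr0.
  by rewrite inE /= => <-; rewrite ger0_norm.
have mi i : measurable_fun setT (fun y => `|s`_i| * \1_(g @^-1` [set s`_i]) y).
  by apply: measurable_funM => //; exact: measurable_indic.
rewrite (_ : (fun y => _) = fun y =>
    \sum_(i <- index_enum 'I_(size s)) (`|s`_i| * \1_(g @^-1` [set s`_i]) y))//.
elim: (index_enum _) => [|i t IH].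
  rewrite (_ : (fun y => _) = cst 0); last by apply/funext => y; rewrite big_nil.
  move=> e e0; exists 1 => // r r0 _; rewrite integral0 lee_fin add0r.
  by rewrite mulr_ge0 ?exprn_ge0 ?mulr_ge0 ?ltW.
rewrite (_ : (fun y => _) = fun y => `|s`_i| * \1_(g @^-1` [set s`_i]) y +
    \sum_(j <- t) (`|s`_j| * \1_(g @^-1` [set s`_j]) y)); last first.
  by apply/funext => y; rewrite big_cons.
apply: avg_limsup_leD => //.
- by apply: measurable_sum => j.
- by move=> y; apply: sumr_ge0 => j _; rewrite mulr_ge0.
- apply: avg_limsup_leZ => //.
  by apply: avg_limsup_le_indic => //; exact: H.
Qed.

(** Simple functions [g k] increase to [h], and the integral of [h - g k] tends to 0. Averages of
    [h] split into those of [g k], controlled by [g k x <= h x], and those of the remainder,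
    controlled by its maximal function. *)
Lemma ae_avg_limsup_le_integrable (h : vec -> R) :
  measurable_fun setT h -> (forall x, 0 <= h x) ->
  (\int[mu]_x (h x)%:E < +oo)%E -> \forall x \ae mu, avg_limsup_le h x.
Proof.
move=> mh h0 hoo.
have mhE : measurable_fun setT (EFin \o h) by exact/measurable_EFinP.
pose g : {nnsfun vec >-> R}^nat := nnsfun_approx measurableT mhE.
have ndg : nondecreasing_seq (g : (vec -> R)^nat) by exact: nd_nnsfun_approx.
have cg x : EFin \o g^~ x @ \oo --> (h x)%:E.
  by apply: cvg_nnsfun_approx => // y _; rewrite lee_fin.
have gh k x : g k x <= h x.
  rewrite -lee_fin; have <- := cvg_lim _ (cg x) => //.
  apply: lime_ge; first by apply/cvg_ex; exists (h x)%:E; exact: cg.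
  exists k => // m /= km; rewrite lee_fin; have /lefP := ndg _ _ km; exact.
have mg k : measurable_fun setT (g k) by exact: measurable_funP.
have small : \forall x \ae mu, forall c : R, 0 < c ->
    exists k, (maxfun (fun y => h y - g k y)%R x <= c%:E)%E.
  apply: ae_maxfun_small.
  - by move=> k; exact: measurable_funB.
  - by move=> k x; rewrite subr_ge0.
  - move=> e e0.
    have cv : (\int[mu]_x (g k x)%:E)%E @[k --> \oo] --> (\int[mu]_x (h x)%:E)%E.
      have -> : (\int[mu]_x (h x)%:E = \int[mu]_x limn (fun k => (g k x)%:E))%E.
        by apply: eq_integral => x _; apply/esym/cvg_lim => //; exact: cg.
      apply: (@cvg_monotone_convergence _ _ _ mu setT measurableT
        (fun k x => (g k x)%:E)).
      + by move=> k; exact/measurable_EFinP.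
      + by move=> k x _; rewrite lee_fin.
      + by move=> x _ k l kl; rewrite lee_fin; have /lefP := ndg _ _ kl; exact.
    have afin : (\int[mu]_x (h x)%:E)%E \is a fin_num.
      by rewrite ge0_fin_numE// integral_ge0// => x _; rewrite lee_fin.
    set a := (\int[mu]_x (h x)%:E)%E in cv afin.
    have [k _ hk] : \forall k \near \oo, (a - e%:E < \int[mu]_x (g k x)%:E)%E.
      apply: (cv [set z | (a - e%:E < z)%E]); apply: open_nbhs_nbhs.
      split; first exact: open_ereal_gt_ereal.
      by rewrite /= -(fineK afin) -EFinB lte_fin ltrBlDr ltrDl.
    exists k; have {}hk := hk k (leqnn k).
    have aE : (\int[mu]_x (h x - g k x)%:E + \int[mu]_x (g k x)%:E = a)%E.
      rewrite -ge0_integralD//.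
      - by apply: eq_integral => x _; rewrite -EFinD subrK.
      - by move=> x _; rewrite lee_fin subr_ge0.
      - by apply/measurable_EFinP; exact: measurable_funB.
      - by move=> x _; rewrite lee_fin.
      - exact/measurable_EFinP.
    have i1 : (0 <= \int[mu]_x (h x - g k x)%:E)%E.
      by apply: integral_ge0 => x _; rewrite lee_fin subr_ge0.
    have i2 : (0 <= \int[mu]_x (g k x)%:E)%E by apply: integral_ge0 => x _; rewrite lee_fin.
    move: aE hk i1 i2; rewrite -(fineK afin).
    case: (\int[mu]_x (h x - g k x)%:E)%E => [b| |]//;
      case: (\int[mu]_x (g k x)%:E)%E => [c| |]// [bc].
    by rewrite -EFinB lte_fin !lee_fin => *; lra.
have gall : \forall x \ae mu, forall k, avg_limsup_le (g k : vec -> R) x.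
  by apply/ae_foralln => k; exact: ae_avg_limsup_le_nnsfun.
apply: filterS2 small gall => x small gall e e0.
have c0 : 0 < e / 2 / 2 ^+ n by rewrite !divr_gt0// exprn_gt0.
have [k hk] := small _ c0.
have [d d0 hd] := gall k _ (divr_gt0 e0 (ltr0n R 2)).
exists d => // r r0 rd.
have -> : (\int[mu]_(y in ball x r) (h y)%:E =
    \int[mu]_(y in ball x r) ((h y - g k y)%:E + (g k y)%:E))%E.
  by apply: eq_integral => y _; rewrite -EFinD subrK.
rewrite ge0_integralD//; last 5 first.
- exact: measurable_ball_rV.
- by move=> y _; rewrite lee_fin subr_ge0.
- by apply: measurable_funTS; apply/measurable_EFinP; exact: measurable_funB.
- by move=> y _; rewrite lee_fin.
- by apply: measurable_funTS; exact/measurable_EFinP.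
have MD : (\int[mu]_(y in ball x r) (h y - g k y)%:E <= ((2 * r) ^+ n * (e / 2))%:E)%E.
  apply: le_trans (integral_ball_maxfun _ _ _ r0) _.
  - exact: measurable_funB.
  - by move=> y; rewrite subr_ge0.
  apply: le_trans (lee_wpmul2l _ hk) _.
    by rewrite lee_fin exprn_ge0// mulr_ge0// ltW.
  rewrite -EFinM lee_fin le_eqVlt; apply/orP; left; apply/eqP.
  have -> : 4 * r = 2 * (2 * r) by ring.
  rewrite [(2 * (2 * r)) ^+ n]exprMn; field.
  by rewrite expf_neq0.
apply: le_trans (leeD MD (hd r r0 rd)) _.
rewrite -EFinD lee_fin -mulrDr; apply: ler_wpM2l.
  by rewrite exprn_ge0// mulr_ge0// ltW.
by have := gh k x; lra.
Qed.

(** The property is local, so it may be read off the truncations of [h] to large cubes, which are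
    integrable. *)
Lemma ae_avg_limsup_le (h : vec -> R) :
  measurable_fun setT h -> (forall x, 0 <= h x) ->
  (forall r, (\int[mu]_(x in ball (0%R : vec) r) (h x)%:E < +oo)%E) ->
  \forall x \ae mu, avg_limsup_le h x.
Proof.
move=> mh h0 hoo.
pose B N := ball (0 : vec) N.+2%:R.
pose hN N : vec -> R := h \_ (B N).
have mB N : measurable (B N) by exact: measurable_ball_rV.
have H : \forall x \ae mu, forall N, avg_limsup_le (hN N) x.
  apply/ae_foralln => N; apply: ae_avg_limsup_le_integrable.
  - by apply: (measurable_restrictT _ _).1 => //; exact: measurable_funTS.
  - by move=> x; rewrite /hN patchE; case: ifP.
  - apply: le_lt_trans (hoo N.+2%:R); rewrite [leRHS]integral_mkcond.
    rewrite le_eqVlt; apply/orP; left; apply/eqP; apply: eq_integral => x _.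
    by rewrite /hN !patchE; case: ifP.
apply: filterS H => x H e e0.
pose N := Num.truncn `|x|.
have xN : `|x| < N.+1%:R by exact: truncnS_gt.
have sub r y : r < 1 -> ball x r y -> B N y.
  move=> r1; rewrite /B mx_norm_ball /ball_ /= sub0r normrN => xy.
  rewrite -(subrK x y); apply: le_lt_trans (ler_normD _ _) _.
  rewrite distrC -natr1 addrC; apply: ltrD => //; exact: lt_trans xy r1.
have [d d0 hd] := H N _ e0.
exists (Num.min d 1); first by rewrite lt_min d0/=.
move=> r r0; rewrite lt_min => /andP[rd r1].
have := hd r r0 rd; rewrite {2}/hN patchE ifT; last first.
  by rewrite inE; apply: (sub r) => //; exact: ballxx.
apply: le_trans; rewrite le_eqVlt; apply/orP; left; apply/eqP.
apply: eq_integral => y; rewrite inE => xy.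
by rewrite /hN patchE ifT// inE; exact: sub xy.
Qed.

End lebesgue_points.

(** * Sobolev functions *)

Section dot.
Context {R : realType} {n : nat}.
Local Notation vec := 'rV[R]_n.
Implicit Types x y z : 'rV[R]_n.

Lemma dotC x y : dot x y = dot y x.
Proof. by apply: eq_bigr => i _; rewrite mulrC. Qed.

Lemma dotDl x y z : dot (x + y) z = dot x z + dot y z.
Proof. by rewrite /dot -big_split; apply: eq_bigr => i _; rewrite mxE mulrDl. Qed.

Lemma dotDr x y z : dot z (x + y) = dot z x + dot z y.
Proof. by rewrite !(dotC z) dotDl. Qed.

Lemma dotZl (a : R) x y : dot (a *: x) y = a * dot x y.
Proof. by rewrite /dot mulr_sumr; apply: eq_bigr => i _; rewrite mxE mulrA. Qed.

Lemma dotZr (a : R) x y : dot x (a *: y) = a * dot x y.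
Proof. by rewrite dotC dotZl dotC. Qed.

Lemma dotNl x y : dot (- x) y = - dot x y.
Proof. by rewrite -scaleN1r dotZl mulN1r. Qed.

Lemma dotNr x y : dot x (- y) = - dot x y.
Proof. by rewrite dotC dotNl dotC. Qed.

Lemma dotBl x y z : dot (x - y) z = dot x z - dot y z.
Proof. by rewrite dotDl dotNl. Qed.

Lemma dotBr x y z : dot z (x - y) = dot z x - dot z y.
Proof. by rewrite dotDr dotNr. Qed.

Lemma dot0l x : dot 0 x = 0.
Proof. by rewrite -(scale0r x) dotZl mul0r. Qed.

Lemma dot0r x : dot x 0 = 0.
Proof. by rewrite dotC dot0l. Qed.

Lemma dot_delta x (i : 'I_n) : dot x (delta_mx ord0 i) = x ord0 i.
Proof.
rewrite /dot (bigD1 i)//= mxE !eqxx mulr1 big1 ?addr0// => j ji.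
by rewrite mxE eqxx (negbTE ji) mulr0.
Qed.

Lemma dot_ge0 x : 0 <= dot x x.
Proof. by apply: sumr_ge0 => i _; rewrite -expr2 sqr_ge0. Qed.

Lemma dot_eq0 x : dot x x = 0 -> x = 0.
Proof.
move=> /eqP; rewrite psumr_eq0; last by move=> i _; rewrite -expr2 sqr_ge0.
move=> /allP h; apply/rowP => i; rewrite mxE.
by have := h i (mem_index_enum _); rewrite /= mulf_eq0 orbb => /eqP.
Qed.

Lemma enorm_ge0 x : 0 <= enorm x.
Proof. exact: sqrtr_ge0. Qed.

Lemma sqr_enorm x : enorm x ^+ 2 = dot x x.
Proof. by rewrite sqr_sqrtr// dot_ge0. Qed.

Lemma enorm0 : enorm (0 : vec) = 0.
Proof. by rewrite /enorm dot0l sqrtr0. Qed.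

Lemma enorm_eq0 x : enorm x = 0 -> x = 0.
Proof. by move=> h; apply: dot_eq0; rewrite -sqr_enorm h expr0n. Qed.

Lemma enorm_gt0 x : x != 0 -> 0 < enorm x.
Proof.
move=> x0; rewrite lt_neqAle enorm_ge0 andbT; apply: contra x0 => /eqP h.
by apply/eqP/enorm_eq0.
Qed.

Lemma enormZ (a : R) x : enorm (a *: x) = `|a| * enorm x.
Proof.
by rewrite /enorm dotZl dotZr mulrA -expr2 sqrtrM ?sqr_ge0// sqrtr_sqr.
Qed.

Lemma cauchy_schwarz x y : `|dot x y| <= enorm x * enorm y.
Proof.
have [->|y0] := eqVneq y 0; first by rewrite dot0r enorm0 mulr0 normr0.
have b0 : 0 < dot y y by rewrite -sqr_enorm exprn_gt0// enorm_gt0.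
have := dot_ge0 (dot y y *: x - dot x y *: y).
rewrite dotBl !dotBr !dotZl !dotZr (dotC y x) => h.
have h2 : 0 <= dot y y * (dot x x * dot y y - dot x y ^+ 2).
  by apply: le_trans h _; rewrite le_eqVlt; apply/orP; left; apply/eqP; ring.
rewrite pmulr_rge0// subr_ge0 -!sqr_enorm -exprMn in h2.
by rewrite -(@ler_pXn2r _ 2)// ?nnegrE ?mulr_ge0 ?enorm_ge0// real_normK ?num_real.
Qed.

Lemma dot_le x y : dot x y <= enorm x * enorm y.
Proof. by apply: le_trans (cauchy_schwarz x y); exact: ler_norm. Qed.

Lemma enormD x y : enorm (x + y) <= enorm x + enorm y.
Proof.
rewrite -(@ler_pXn2r _ 2)// ?nnegrE ?addr_ge0 ?enorm_ge0//.
rewrite sqr_enorm dotDl !dotDr (dotC y x) sqrrD !sqr_enorm.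
by have := dot_le x y; lra.
Qed.

Lemma enormN x : enorm (- x) = enorm x.
Proof. by rewrite -scaleN1r enormZ normrN1 mul1r. Qed.

Lemma enormB x y : enorm (x - y) <= enorm x + enorm y.
Proof. by apply: le_trans (enormD _ _) _; rewrite enormN. Qed.

Lemma coord_le_enorm x (i : 'I_n) : `|x ord0 i| <= enorm x.
Proof.
rewrite -(@ler_pXn2r _ 2)// ?nnegrE ?enorm_ge0// sqr_enorm real_normK ?num_real// expr2.
rewrite /dot (bigD1 i)//= lerDl; apply: sumr_ge0 => j _.
by rewrite -expr2 sqr_ge0.
Qed.

Lemma norm_le_enorm x : `|x| <= enorm x.
Proof. by apply: norm_rV_le; [exact: enorm_ge0|exact: coord_le_enorm]. Qed.

Lemma enorm_le_sum x : enorm x <= \sum_i `|x ord0 i|.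
Proof.
rewrite -(@ler_pXn2r _ 2)// ?nnegrE ?enorm_ge0 ?sumr_ge0// sqr_enorm /dot.
elim: (index_enum _) => [|i s IH]; first by rewrite !big_nil expr0n.
rewrite !big_cons sqrrD real_normK ?num_real// expr2 -addrA lerD2l.
apply: le_trans IH _; rewrite lerDr mulrn_wge0// mulr_ge0//.
exact: sumr_ge0.
Qed.

Lemma enorm_le_norm x : enorm x <= n%:R * `|x|.
Proof.
apply: le_trans (enorm_le_sum x) _.
rewrite -[n in n%:R]card_ord -sumr_const mulr_suml; apply: ler_sum => i _.
by rewrite mul1r; exact: norm_coord_le.
Qed.

Lemma dot_continuous (f g : vec -> vec) : continuous f -> continuous g ->
  continuous (fun x => dot (f x) (g x)).
Proof.
have cc (h : vec -> vec) (i : 'I_n) :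
    continuous h -> continuous (fun x => h x ord0 i).
  move=> ch x; apply: (@continuous_comp _ _ _ h (fun y : vec => y ord0 i)).
    exact: ch.
  by apply: differentiable_continuous; exact: differentiable_coord.
move=> cf cg x; rewrite /dot; elim: (index_enum _) => [|i s IH].
  rewrite (_ : (fun _ => _) = cst 0); first exact: cst_continuous.
  by apply/funext => y; rewrite big_nil.
rewrite (_ : (fun _ => _) = (fun y =>
    f y ord0 i * g y ord0 i + \sum_(j <- s) f y ord0 j * g y ord0 j)).
  apply: (@continuousD _ _ _ (fun y => f y ord0 i * g y ord0 i)) IH.
  by apply: (@continuousM _ _ (fun y => f y ord0 i)); exact: cc.
by apply/funext => y; rewrite big_cons.
Qed.

Lemma enorm_continuous : continuous (@enorm R n).
Proof.
move=> x; apply: (@continuous_comp _ _ _ (fun y => dot y y) (@Num.sqrt R)).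
  by apply: dot_continuous => y; exact: cvg_id.
exact: sqrt_continuous.
Qed.

Lemma measurable_enorm (G : vec -> vec) :
  (forall i, measurable_fun setT (fun x => G x ord0 i)) ->
  measurable_fun setT (fun x => enorm (G x)).
Proof.
move=> mG; apply: (measurableT_comp (continuous_measurable_fun (@sqrt_continuous R))).
by apply: measurable_sum => i; exact: measurable_funM.
Qed.

End dot.

(** * Weak gradients tested on products *)

Section weak_gradients.
Context {R : realType} {n : nat}.
Local Notation mu := (lebesgue_rV n).
Local Notation vec := 'rV[R]_n.
Local Notation leb := (@lebesgue_measure R).

Lemma weak_gradient_tensor (u : vec -> R) (Du : vec -> vec) :
  weak_gradient u Du -> tensor_weak_gradient u Du.
Proof.
move=> h i g g' sg cg dg.
rewrite -(h i _ (tensor_test_function sg cg)); apply: eq_Rintegral => x _.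
by rewrite (tensor_partial _ dg).
Qed.

Lemma supp1_derive (g g' : R -> R) : (forall x : R, is_derive x 1 g (g' x)) ->
  supp1 g -> supp1 g'.
Proof.
move=> dg [M gM]; exists M => s Ms.
rewrite -[LHS](@derive_val _ _ _ _ _ _ _ (dg s)).
rewrite (@near_eq_derive _ _ _ _ (cst (0 : R))) ?derive_cst//.
near=> y; apply: gM; near: y.
have cn : {for s, continuous (fun y : R => `|y|)} by exact: norm_continuous.
exact: (cvgr_gt _ cn _ Ms).
Unshelve. all: by end_near. Qed.

Lemma integral_derive_supp1 (g g' : R -> R) :
  (forall x : R, is_derive x 1 g (g' x)) -> continuous g' -> supp1 g ->
  (\int[leb]_s g' s = 0)%R.
Proof.
move=> dg cg' sg; have sg' := supp1_derive dg sg.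
have [M gM] := sg; have [M' gM'] := sg'.
pose b := `|M| + `|M'| + 1.
have b0 : 0 < b by rewrite ltr_wpDl.
have hM := ler_norm M; have hM' := ler_norm M'.
have nM := normr_ge0 M; have nM' := normr_ge0 M'.
rewrite (@integral_derive1 _ g g' (- b) b)//.
- by rewrite !gM ?subrr// ?normrN gtr0_norm// /b; lra.
- by lra.
- move=> s; rewrite -ler_norml -ltNge => h; apply: gM'.
  by apply: lt_trans h; rewrite /b; lra.
Qed.

(** Both integrals factor. For i = k the claim reduces to the vanishing of the integral of (z g)' =
    g + z g'; otherwise factor [i] contributes the integral of g', which is 0. *)
Lemma tensor_weak_gradient_coord (k : 'I_n) :
  @tensor_weak_gradient R n (fun x => x ord0 k) (fun=> delta_mx ord0 k).
Proof.
move=> i g h sg cg dg.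
have cgc j : continuous (g j) by exact: (sg j 0%N).
have ch : continuous h by exact: (smooth1_derive dg (sg i) 0).
have sh := supp1_derive dg (cg i).
have ig j := continuous_supp1_integrable (cgc j) (cg j).
pose f j : R -> R := if j == k then fun z => z * upd g i h j z else upd g i h j.
have cf j : continuous (f j).
  have cu : continuous (upd g i h j) by rewrite /upd; case: ifP.
  rewrite /f; case: ifP => // _ z.
  by apply: (@continuousM _ _ id); [exact: cvg_id|exact: cu].
have sf j : supp1 (f j).
  have [M hM] : supp1 (upd g i h j) by rewrite /upd; case: ifP.
  by exists M => z zM; rewrite /f; case: ifP => _; rewrite hM ?mulr0.
have -> : (\int[mu]_x (x ord0 k * tensor (upd g i h) x) = \int[mu]_x tensor f x)%R.
  apply: eq_Rintegral => x _; rewrite /tensor (bigD1 k)//= [RHS](bigD1 k)//= /f eqxx mulrA.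
  by congr (_ * _); apply: eq_bigr => j /negbTE ->.
have [_ ->] := tensor_integrable_integral (fun j => continuous_supp1_integrable (cf j) (sf j)).
have -> : (\int[mu]_x ((delta_mx ord0 k : vec) ord0 i * tensor g x) =
    (i == k)%:R * \prod_j \int[leb]_s g j s)%R.
  have [itg <-] := tensor_integrable_integral ig.
  rewrite -RintegralZl//; apply: eq_Rintegral => x _.
  by rewrite mxE eqxx.
have [ik|ik] := eqVneq i k.
  subst i; rewrite mul1r (bigD1 k)//= [in RHS](bigD1 k)//= -mulNr.
  congr (_ * _); last by apply: eq_bigr => j /negbTE jk; rewrite /f /upd jk.
  rewrite /f eqxx /upd eqxx; apply/eqP; rewrite -addr_eq0 addrC; apply/eqP.
  have izh : leb.-integrable setT (EFin \o (fun z => z * h z)).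
    apply: continuous_supp1_integrable.
      by move=> z; apply: (@continuousM _ _ id); [exact: cvg_id|exact: ch].
    by have [M hM] := sh; exists M => z zM; rewrite hM ?mulr0.
  have czg : continuous (fun z : R => g k z + z * h z).
    move=> z; apply: (@continuousD _ _ _ (g k)); first exact: cgc.
    by apply: (@continuousM _ _ id); [exact: cvg_id|exact: ch].
  rewrite -RintegralD//.
  apply: (@integral_derive_supp1 (fun z => z * g k z)).
  - move=> z; apply: (is_derive_eq (is_deriveM (is_derive_id _ _) (dg z))).
    by rewrite /GRing.scale /= mulr1 addrC.
  - exact: czg.
  - by have [M hM] := cg k; exists M => z zM; rewrite hM ?mulr0.
rewrite mul0r oppr0 (bigD1 i)//= /f (negbTE ik) /upd eqxx.
by rewrite (integral_derive_supp1 dg ch (cg i)) mul0r.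
Qed.

(** Differentiability at a point compares [u] with a linear function, and Morrey's inequality has to
    be applied to the difference, which need not lie in L^p. The sum defining [dot m x] is
    subtracted one coordinate at a time. *)
Lemma tensor_weak_gradient_sub_dot (u : vec -> R) (Du : vec -> vec) (m : vec) :
  continuous u -> (forall i g, (forall i, continuous (g i)) -> (forall i, supp1 (g i)) ->
    mu.-integrable setT (EFin \o (fun x => Du x ord0 i * tensor g x))) ->
  tensor_weak_gradient u Du ->
  tensor_weak_gradient (fun x => u x - dot m x) (fun x => Du x - m).
Proof.
move=> cu iD hu i g h sg cg dg.
have cgc j : continuous (g j) by exact: (sg j 0%N).
have ch : continuous h by exact: (smooth1_derive dg (sg i) 0).
have sh := supp1_derive dg (cg i).
have cup j : continuous (upd g i h j) by rewrite /upd; case: ifP.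
have sup j : supp1 (upd g i h j) by rewrite /upd; case: ifP.
have iu : mu.-integrable setT (EFin \o (fun x => u x * tensor (upd g i h) x)).
  exact: continuous_tensor_integrable.
have ic (k : 'I_n) : mu.-integrable setT (EFin \o (fun x : vec => x ord0 k * tensor (upd g i h) x)).
  apply: continuous_tensor_integrable => //; exact: continuous_rV_coord.
have [itg _] := tensor_integrable_integral (fun j => continuous_supp1_integrable (cgc j) (cg j)).
have H (s : seq 'I_n) :
    mu.-integrable setT (EFin \o (fun x : vec =>
      (u x - \sum_(k <- s) m ord0 k * x ord0 k) * tensor (upd g i h) x)) /\
    (\int[mu]_x ((u x - \sum_(k <- s) m ord0 k * x ord0 k) * tensor (upd g i h) x) =
     - \int[mu]_x ((Du x ord0 i - \sum_(k <- s) m ord0 k * (i == k)%:R) * tensor g x))%R /\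
    mu.-integrable setT (EFin \o (fun x : vec =>
      (Du x ord0 i - \sum_(k <- s) m ord0 k * (i == k)%:R) * tensor g x)).
  elim: s => [|k s [IH1 [IH2 IH3]]].
    have -> : (fun x : vec => (u x - \sum_(k <- [::]) m ord0 k * x ord0 k) *
        tensor (upd g i h) x) = (fun x => u x * tensor (upd g i h) x).
      by apply/funext => x; rewrite big_nil subr0.
    have -> : (fun x : vec => (Du x ord0 i - \sum_(k <- [::]) m ord0 k * (i == k)%:R) *
        tensor g x) = (fun x => Du x ord0 i * tensor g x).
      by apply/funext => x; rewrite big_nil subr0.
    by split => //; split; [exact: hu|exact: iD].
  have E1 x : (u x - \sum_(k <- k :: s) m ord0 k * x ord0 k) * tensor (upd g i h) x =
    (u x - \sum_(k <- s) m ord0 k * x ord0 k) * tensor (upd g i h) x -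
    m ord0 k * (x ord0 k * tensor (upd g i h) x).
    by rewrite big_cons; ring.
  have E2 x : (Du x ord0 i - \sum_(k <- k :: s) m ord0 k * (i == k)%:R) * tensor g x =
    (Du x ord0 i - \sum_(k <- s) m ord0 k * (i == k)%:R) * tensor g x -
    m ord0 k * ((i == k)%:R * tensor g x).
    by rewrite big_cons; ring.
  have iZ1 : mu.-integrable setT (EFin \o (fun x : vec =>
     m ord0 k * (x ord0 k * tensor (upd g i h) x))).
    exact: (integrableZl measurableT (m ord0 k) (ic k)).
  have iZ0 : mu.-integrable setT (EFin \o (fun x : vec => (i == k)%:R * tensor g x)).
    exact: (integrableZl measurableT (i == k)%:R itg).
  have iZ2 : mu.-integrable setT (EFin \o (fun x : vec =>
     m ord0 k * ((i == k)%:R * tensor g x))).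
    exact: (integrableZl measurableT (m ord0 k) iZ0).
  have -> : (fun x : vec => (u x - \sum_(k <- k :: s) m ord0 k * x ord0 k) *
      tensor (upd g i h) x) =
    (fun x => (u x - \sum_(k <- s) m ord0 k * x ord0 k) * tensor (upd g i h) x -
      m ord0 k * (x ord0 k * tensor (upd g i h) x)) by exact/funext.
  have -> : (fun x : vec => (Du x ord0 i - \sum_(k <- k :: s) m ord0 k * (i == k)%:R) *
      tensor g x) =
    (fun x => (Du x ord0 i - \sum_(k <- s) m ord0 k * (i == k)%:R) * tensor g x -
      m ord0 k * ((i == k)%:R * tensor g x)) by exact/funext.
  split; first exact: (integrableB measurableT IH1 iZ1).
  split; last exact: (integrableB measurableT IH3 iZ2).
  rewrite !RintegralB// !RintegralZl// IH2.
  have := tensor_weak_gradient_coord k sg cg dg.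
  have -> : (\int[mu]_x ((delta_mx ord0 k : vec) ord0 i * tensor g x) =
      \int[mu]_x ((i == k)%:R * tensor g x))%R.
    by apply: eq_Rintegral => x _; rewrite mxE eqxx.
  by rewrite RintegralZl// => ->; ring.
have [_ [H2 _]] := H (index_enum 'I_n).
rewrite /dot H2; congr (- _); apply: eq_Rintegral => x _; rewrite !mxE.
congr ((_ - _) * _); rewrite (bigD1 i)//= eqxx mulr1 big1 ?addr0// => k ki.
by rewrite eq_sym (negbTE ki) mulr0.
Qed.

End weak_gradients.

Lemma powRD_le (R : realType) (p a b : R) : 0 < p -> 0 <= a -> 0 <= b ->
  (a + b) `^ p <= 2 `^ p * (a `^ p + b `^ p).
Proof.
move=> p0 a0 b0; wlog ab : a b a0 b0 / a <= b.
  move=> H; have [/H|/ltW/H] := leP a b; first exact.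
  by rewrite (addrC b) (addrC (b `^ p)); exact.
apply: (@le_trans _ _ ((2 * b) `^ p)).
  apply: ge0_ler_powR; rewrite ?nnegrE ?(ltW p0) ?addr_ge0 ?mulr_ge0//; lra.
by rewrite powRM// ler_wpM2l ?powR_ge0// lerDr powR_ge0.
Qed.

(** * Integrability, the pointwise Sobolev estimate and differentiability almost everywhere *)

Section lp.
Context {R : realType} {n : nat}.
Local Notation mu := (lebesgue_rV n).
Local Notation vec := 'rV[R]_n.

Lemma LpP (p : R) (f : vec -> R) : 0 < p ->
  Lp p f <-> measurable_fun setT f /\ (\int[mu]_x (`|f x| `^ p)%:E < +oo)%E.
Proof.
move=> p0.
have E : ((\int[mu]_x (`|f x| `^ p)%:E) `^ p^-1 = 'N[mu]_p%:E [EFin \o f])%E.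
  by rewrite unlock; congr (_ `^ _)%E; apply: eq_integral => x _.
split.
  case/andP => /[!inE]/= mf; rewrite /finite_norm -E => /lty_poweRy h; split => //.
  by apply: h; rewrite invr_neq0// gt_eqF.
case=> mf foo; apply/andP; rewrite !inE/=; split => //.
by rewrite /finite_norm -E; exact: poweR_lty.
Qed.

Lemma Lp_vec_normE (p : R) (G : vec -> vec) :
  Lp_vec_norm p G = ((\int[mu]_x (enorm (G x) `^ p)%:E) `^ p^-1)%E.
Proof.
rewrite /Lp_vec_norm unlock; congr (poweR _ _); apply: eq_integral => x _.
by rewrite abse_EFin ger0_norm ?enorm_ge0// poweR_EFin.
Qed.

Lemma measurable_enorm_powR (p : R) (G : vec -> vec) :
  (forall i, measurable_fun setT (fun x => G x ord0 i)) ->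
  measurable_fun setT (fun x => (enorm (G x) `^ p)%:E).
Proof.
move=> mG; apply/measurable_EFinP.
exact: (measurableT_comp (measurable_powR p) (measurable_enorm mG)).
Qed.

Lemma enorm_powR_le (p : R) (x : vec) : 0 < p ->
  enorm x `^ p <= n%:R `^ p * \sum_i `|x ord0 i| `^ p.
Proof.
move=> p0; set S := \sum_i _.
have S0 : 0 <= S by apply: sumr_ge0 => i _; exact: powR_ge0.
have H i : `|x ord0 i| <= S `^ p^-1.
  have {1}-> : `|x ord0 i| = (`|x ord0 i| `^ p) `^ p^-1.
    by rewrite -powRrM mulfV ?gt_eqF// powRr1.
  apply: ge0_ler_powR; rewrite ?nnegrE ?powR_ge0 ?invr_ge0 ?(ltW p0)//.
  by rewrite /S (bigD1 i)//= lerDl sumr_ge0// => j _; exact: powR_ge0.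
apply: (@le_trans _ _ ((n%:R * S `^ p^-1) `^ p)).
  apply: ge0_ler_powR; rewrite ?nnegrE ?enorm_ge0 ?mulr_ge0 ?powR_ge0 ?(ltW p0)//.
  apply: le_trans (enorm_le_sum x) _; rewrite -[n in n%:R]card_ord -sumr_const mulr_suml.
  by apply: ler_sum => i _; rewrite mul1r.
by rewrite powRM ?powR_ge0// -powRrM mulVf ?gt_eqF// powRr1.
Qed.

Lemma Lp_vecP (p : R) (G : vec -> vec) : 0 < p ->
  Lp_vec p G <-> (forall i, measurable_fun setT (fun x => G x ord0 i)) /\
    (\int[mu]_x (enorm (G x) `^ p)%:E < +oo)%E.
Proof.
move=> p0; split.
  move=> h; have mG i : measurable_fun setT (fun x => G x ord0 i).
    by have /(LpP _ p0)[] := h i.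
  have mGi i : measurable_fun setT (fun x => (`|G x ord0 i| `^ p)%:E).
    apply/measurable_EFinP; apply: (measurableT_comp (measurable_powR p)).
    exact: measurableT_comp.
  split => //.
  apply: (@le_lt_trans _ _ (\int[mu]_x ((n%:R `^ p)%:E *
      \sum_i (`|G x ord0 i| `^ p)%:E))%E).
    apply: ge0_le_integral => //.
    - by move=> x _; rewrite lee_fin powR_ge0.
    - exact: measurable_enorm_powR.
    - by apply: measurable_funeM; apply: emeasurable_sum.
    - by move=> x _; rewrite sumEFin -EFinM lee_fin enorm_powR_le.
  rewrite ge0_integralZl//; last 2 first.
  - by apply: emeasurable_sum.
  - by move=> x _; apply: sume_ge0 => i _; rewrite lee_fin powR_ge0.
  rewrite ge0_integral_sum//.
  apply: lte_mul_pinfty; rewrite ?lee_fin ?powR_ge0//.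
  by apply/lte_sum_pinfty => i _; have /(LpP _ p0)[] := h i.
move=> [mG Goo] i; apply: (LpP _ p0).2; split; first exact: mG.
apply: le_lt_trans Goo; apply: ge0_le_integral => //.
- apply/measurable_EFinP; apply: (measurableT_comp (measurable_powR p)).
  exact: measurableT_comp.
- exact: measurable_enorm_powR.
- move=> x _; rewrite lee_fin; apply: ge0_ler_powR; rewrite ?nnegrE ?enorm_ge0 ?(ltW p0)//.
  exact: coord_le_enorm.
Qed.

(** On a bounded cube N^s <= 1 + N^p is enough. *)
Lemma ball_integral_powR_lt (p s r : R) (x : vec) (N : vec -> R) : 0 < s -> s < p ->
  measurable_fun setT N -> (forall y, 0 <= N y) ->
  (\int[mu]_y (N y `^ p)%:E < +oo)%E ->
  (\int[mu]_(y in ball x r) (N y `^ s)%:E < +oo)%E.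
Proof.
move=> s0 sp mN N0 Noo.
have mNp q D : measurable_fun D (fun y => (N y `^ q)%:E).
  apply: measurable_funTS; apply/measurable_EFinP.
  exact: (measurableT_comp (measurable_powR q) mN).
have mb := measurable_ball_rV x r.
apply: (@le_lt_trans _ _ (\int[mu]_(y in ball x r) (1%:E + (N y `^ p)%:E))%E).
  apply: ge0_le_integral => //.
  - by move=> y _; rewrite lee_fin powR_ge0.
  - by apply: emeasurable_funD => //; exact: measurable_cst.
  - move=> y _; rewrite -EFinD lee_fin; have [N1|N1] := leP (N y) 1.
      apply: (@le_trans _ _ 1); last by rewrite lerDl powR_ge0.
      have -> : 1 = (1 : R) `^ s by rewrite powR1.
      by apply: ge0_ler_powR; rewrite ?nnegrE ?(ltW s0).
    apply: (@le_trans _ _ (N y `^ p)); last by rewrite lerDr.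
    by apply: ler_powR; exact: ltW.
rewrite ge0_integralD//; last by move=> y _; rewrite lee_fin powR_ge0.
apply: lte_add_pinfty.
  rewrite integral_cst// mul1e.
  have [r0|r0] := ltP 0 r; first by rewrite [ltLHS]lebesgue_rV_ball// ltry.
  rewrite (_ : ball x r = set0) ?measure0 ?ltry//.
  by apply/seteqP; split => // y /ball_rVP[]; rewrite ltNge r0.
apply: le_lt_trans Noo; apply: ge0_subset_integral => //.
by move=> y _; rewrite lee_fin powR_ge0.
Qed.

Lemma locally_integrable_tensor (f : vec -> R) (g : 'I_n -> R -> R) :
  measurable_fun setT f ->
  (forall r, (\int[mu]_(x in ball (0%R : vec) r) `|f x|%:E < +oo)%E) ->
  (forall i, continuous (g i)) -> (forall i, supp1 (g i)) ->
  mu.-integrable setT (EFin \o (fun x => f x * tensor g x)).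
Proof.
move=> mf floc cg sg; have [M hM] := tensor_supp sg.
pose Ki i := projT1 (cid (continuous_supp1_bounded (cg i) (sg i))).
pose K := \prod_i Ki i.
have Kle x : `|tensor g x| <= K.
  rewrite /tensor normr_prod; apply: ler_prod => i _; rewrite normr_ge0/= /Ki.
  by case: cid => k /= hk; exact: hk.
have K0 : 0 <= K by apply: le_trans (Kle 0).
have mt := continuous_measurable_rV (tensor_continuous cg).
have mft : measurable_fun setT (fun x => f x * tensor g x) by exact: measurable_funM.
have mb := measurable_ball_rV (0 : vec) (`|M| + 1).
have mfb : measurable_fun (ball (0 : vec) (`|M| + 1)) (fun x => (`|f x|)%:E).
  by apply: measurable_funTS; apply/measurable_EFinP; exact: measurableT_comp.
apply/integrableP; split; first exact/measurable_EFinP.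
apply: (@le_lt_trans _ _
    (\int[mu]_(x in ball (0%R : vec) (`|M| + 1)) (K%:E * (`|f x|)%:E))%E).
  rewrite [leRHS]integral_mkcond; apply: ge0_le_integral => //.
  - by apply/measurableT_comp => //; exact/measurable_EFinP.
  - by apply: (measurable_restrictT _ _).1 => //; exact: measurable_funeM.
  - move=> x _; rewrite patchE; case: ifPn => [xB|/negP xB].
      by rewrite abse_EFin -EFinM lee_fin normrM mulrC ler_wpM2r.
    have -> : (EFin \o (fun x => f x * tensor g x)) x = 0%E.
      rewrite /= hM ?mulr0//; apply: le_lt_trans (ler_norm _) _.
      rewrite ltNge; apply/negP => h; apply: xB; rewrite inE.
      rewrite mx_norm_ball /ball_ /= sub0r normrN; lra.
    by rewrite abse0; exact: lexx.
rewrite ge0_integralZl//; first by apply: lte_mul_pinfty; rewrite ?lee_fin.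
Qed.

(** Morrey's inequality on the cube of radius 2 |x - y| centred at [x]. Only the maximal function at
    [x] enters and [y] is arbitrary, which is what a comparison of [x] with an unknown foot point
    requires. *)
Lemma sobolev_lipschitz (p s : R) : (0 < n)%N -> n%:R < s -> s < p ->
  exists2 C : R, 0 < C & forall (u : vec -> R) (Du : vec -> vec),
    continuous u -> sobolev_W1 p u Du -> forall (x y : vec) (A : R), 0 < A ->
    (maxfun (fun z => enorm (Du z) `^ s)%R x <= (A `^ s)%:E)%E ->
    `|u x - u y| <= C * `|x - y| * A.
Proof.
move=> n0 ns sp; have [C C0 HC] := @morrey_cube R n s n0 ns.
have s0 : 0 < s by apply: le_lt_trans ns; rewrite ler0n.
have p0 : 0 < p by apply: lt_trans sp.
exists (C * 2 * 2 `^ (n%:R / s)); first by rewrite !mulr_gt0 ?powR_gt0.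
move=> u Du cu [_ /(Lp_vecP _ p0)[mDu Doo] wDu] x y A A0 MA.
have [->|xy] := eqVneq x y; first by rewrite !subrr !normr0 mulr0 mul0r.
have xy0 : 0 < `|x - y| by rewrite normr_gt0 subr_eq0.
pose r := 2 * `|x - y|.
have r0 : 0 < r by rewrite mulr_gt0.
have mN := measurable_enorm mDu.
have mNs : measurable_fun setT (fun z => enorm (Du z) `^ s).
  exact: (measurableT_comp (measurable_powR s) mN).
(* The factor 2^(n/s) absorbs the passage from (2r)^n to the (4r)^n of [integral_ball_maxfun]. *)
pose A' := 2 `^ (n%:R / s) * A.
have A'0 : 0 < A' by rewrite mulr_gt0 ?powR_gt0.
have -> : C * 2 * 2 `^ (n%:R / s) * `|x - y| * A = C * r * A' by rewrite /r /A'; ring.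
apply: (HC u Du (fun z => enorm (Du z)) cu mDu mN _ (weak_gradient_tensor wDu) x r A' r0 A'0).
- by move=> z i; exact: coord_le_enorm.
- apply: le_trans (integral_ball_maxfun x mNs _ r0) _; first by move=> z; exact: powR_ge0.
  apply: le_trans (lee_wpmul2l _ MA) _.
    by rewrite lee_fin exprn_ge0// mulr_ge0// ltW.
  rewrite -EFinM lee_fin /A' powRM ?powR_ge0 ?(ltW A0)// -powRrM divfK ?gt_eqF//.
  rewrite powR_mulrn// mulrA -exprMn.
  by have -> : 2 * r * 2 = 4 * r by ring.
- exact: ballxx.
- rewrite mx_norm_ball /ball_ /= /r; lra.
Qed.

(** Morrey's inequality for u - m.x on small cubes around [x], with [m] close to Du(x). Rational [m]
    are used because the Lebesgue point property of |Du - m|^s holds off a null set depending on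
    [m], and only countably many such sets may be discarded. *)
Lemma sobolev_ae_differentiable (p : R) (u : vec -> R) (Du : vec -> vec) :
  (0 < n)%N -> n%:R < p -> continuous u -> sobolev_W1 p u Du ->
  \forall x \ae mu, forall e : R, 0 < e -> exists2 d : R, 0 < d &
    forall y, `|y - x| < d -> `|u y - u x - dot (Du x) (y - x)| <= e * `|y - x|.
Proof.
move=> n0 np cu [_ + wDu].
have p0 : 0 < p by apply: le_lt_trans np; rewrite ler0n.
move=> /(Lp_vecP _ p0)[mDu Doo].
pose s := (n%:R + p) / 2.
have ns : n%:R < s by rewrite /s; lra.
have sp : s < p by rewrite /s; lra.
have s0 : 0 < s by apply: le_lt_trans ns; rewrite ler0n.
have [C C0 HC] := @morrey_cube R n s n0 ns.
have mDm (m : vec) i : measurable_fun setT (fun x => (Du x - m) ord0 i).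
  rewrite (_ : (fun x => _) = (fun x => Du x ord0 i - m ord0 i)).
    by apply: measurable_funB.
  by apply/funext => x; rewrite !mxE.
have mN (m : vec) := measurable_enorm (mDm m).
have mNs (m : vec) : measurable_fun setT (fun z => enorm (Du z - m) `^ s).
  exact: (measurableT_comp (measurable_powR s) (mN m)).
have loc (m : vec) r (x : vec) : (\int[mu]_(y in ball x r) (enorm (Du y - m) `^ s)%:E < +oo)%E.
  have mb := measurable_ball_rV x r.
  have mDs : measurable_fun setT (fun y => (enorm (Du y) `^ s)%:E).
    exact: measurable_enorm_powR.
  apply: (@le_lt_trans _ _ (\int[mu]_(y in ball x r)
     ((2 `^ s)%:E * ((enorm (Du y) `^ s)%:E + (enorm m `^ s)%:E)))%E).
    apply: ge0_le_integral => //.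
    - by move=> y _; rewrite lee_fin powR_ge0.
    - by apply: measurable_funTS; apply/measurable_EFinP.
    - apply: measurable_funeM; apply: emeasurable_funD; last exact: measurable_cst.
      exact: measurable_funTS.
    - move=> y _; rewrite -EFinD -EFinM lee_fin.
      apply: le_trans (powRD_le s0 (enorm_ge0 _) (enorm_ge0 _)).
      by apply: ge0_ler_powR; rewrite ?nnegrE ?addr_ge0 ?enorm_ge0 ?(ltW s0)// enormB.
  rewrite ge0_integralZl//; last 2 first.
  - apply: emeasurable_funD; last exact: measurable_cst.
    exact: measurable_funTS.
  - by move=> y _; rewrite adde_ge0// lee_fin powR_ge0.
  apply: lte_mul_pinfty; rewrite ?lee_fin ?powR_ge0//.
  rewrite ge0_integralD//; last 3 first.
  - by move=> y _; rewrite lee_fin powR_ge0.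
  - exact: measurable_funTS.
  - by move=> y _; rewrite lee_fin powR_ge0.
  apply: lte_add_pinfty.
    apply: ball_integral_powR_lt sp _ _ Doo => //.
    - exact: measurable_enorm.
    - by move=> y; exact: enorm_ge0.
  rewrite integral_cst//; have [r0|r0] := ltP 0 r.
    by rewrite [X in (_ * X)%E]lebesgue_rV_ball// ltry.
  rewrite (_ : ball x r = set0) ?measure0 ?mule0 ?ltry//.
  by apply/seteqP; split => // y /ball_rVP[]; rewrite ltNge r0.
have H : \forall x \ae mu, forall q : nat, forall m : 'rV[rat]_n, unpickle q = Some m ->
    avg_limsup_le (fun y => enorm (Du y - map_mx ratr m) `^ s) x.
  apply/ae_foralln => q; case: (unpickle q : option 'rV[rat]_n) => [m|]; last first.
    by apply: aeW => x m.
  have : \forall x \ae mu, avg_limsup_le (fun y => enorm (Du y - map_mx ratr m) `^ s) x.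
    apply: (ae_avg_limsup_le (mNs _) _ (fun r => loc _ r 0)) => y.
    exact: powR_ge0.
  by apply: filterS => x hx _ [<-].
apply: filterS H => x H e e0.
pose c := C * 4 * 2 `^ s^-1 + n%:R * n%:R + 1.
have c0 : 0 < c by rewrite ltr_wpDl// addr_ge0// ?mulr_ge0 ?powR_ge0// ltW.
pose t := e / c.
have t0 : 0 < t by rewrite divr_gt0.
have tn0 : 0 < t / n%:R by rewrite divr_gt0// ltr0n.
have [m /ball_rVP[_ hm]] := rat_rV_approx (Du x) tn0.
pose M : vec := map_mx ratr m.
have DM : enorm (Du x - M) <= t.
  apply: le_trans (enorm_le_norm _) _; rewrite mulrC -ler_pdivlMr ?ltr0n//.
  by apply: norm_rV_le => [|j]; [exact: ltW|rewrite !mxE; apply: ltW; have := hm j; rewrite mxE].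
have [d d0 hd] := H (pickle m) m (pickleK m) (t `^ s) (powR_gt0 s t0).
exists (d / 2); first by rewrite divr_gt0.
move=> y yd; have [->|xy] := eqVneq y x.
  by rewrite !subrr dot0r subrr !normr0 mulr0.
have xy0 : 0 < `|y - x| by rewrite normr_gt0 subr_eq0.
pose r := 2 * `|y - x|.
have r0 : 0 < r by rewrite mulr_gt0.
(* [A] satisfies A^s = 2 t^s: one t^s for the distance from Du(x) to the rational vector, one for
   the error allowed in the average. *)
pose A := 2 `^ s^-1 * t.
have A0 : 0 < A by rewrite mulr_gt0 ?powR_gt0.
have As : A `^ s = 2 * t `^ s.
  by rewrite /A powRM ?powR_ge0 ?(ltW t0)// -powRrM mulVf ?gt_eqF// powRr1.
have iD i g : (forall i, continuous (g i)) -> (forall i, supp1 (g i)) ->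
    mu.-integrable setT (EFin \o (fun x => Du x ord0 i * tensor g x)).
  apply: locally_integrable_tensor => // r'.
  have h1p : 1 < p by apply: le_lt_trans np; rewrite ler1n.
  have := ball_integral_powR_lt r' 0 ltr01 h1p (measurable_enorm mDu)
    (fun y => enorm_ge0 _) Doo.
  apply: le_lt_trans; apply: ge0_le_integral => //.
  - exact: measurable_ball_rV.
  - apply: measurable_funTS; apply/measurable_EFinP; exact: measurableT_comp.
  - by apply: measurable_funTS; exact: measurable_enorm_powR.
  - by move=> z _; rewrite lee_fin powRr1 ?enorm_ge0// coord_le_enorm.
have := HC (fun z => u z - dot M z) (fun z => Du z - M) (fun z => enorm (Du z - M)) _
  (mDm M) (mN M) _ (tensor_weak_gradient_sub_dot M cu iD (weak_gradient_tensor wDu))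
  x r A r0 A0 _ y x _ (ballxx _ r0).
have -> : u y - dot M y - (u x - dot M x) =
  (u y - u x - dot (Du x) (y - x)) + dot (Du x - M) (y - x).
  by rewrite dotBl !dotBr; ring.
set a := u y - _ - _; set b := dot _ _.
move=> hab; have {}hab : `|a + b| <= C * r * A.
  apply: hab.
  - move=> z; apply: (@continuousB _ _ _ u); first exact: cu.
    apply: dot_continuous => w; [exact: cst_continuous|exact: cvg_id].
  - by move=> z i; exact: coord_le_enorm.
  - apply: le_trans (hd r r0 _) _; first by rewrite /r -ltr_pdivlMl// mulrC.
    rewrite lee_fin; apply: ler_wpM2l; first by rewrite exprn_ge0// mulr_ge0// ltW.
    rewrite As -/M mulr_natl mulr2n lerD2r.
    by apply: ge0_ler_powR; rewrite ?nnegrE ?enorm_ge0 ?(ltW s0) ?(ltW t0).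
  - rewrite mx_norm_ball /ball_ /= distrC /r; lra.
have hb : `|b| <= t * (n%:R * `|y - x|).
  apply: le_trans (cauchy_schwarz _ _) _; apply: ler_pM; rewrite ?enorm_ge0//.
  exact: enorm_le_norm.
have -> : a = (a + b) - b by ring.
apply: le_trans (ler_normB _ _) _; apply: le_trans (lerD hab hb) _.
have -> : C * r * A + t * (n%:R * `|y - x|) =
  (C * 2 * 2 `^ s^-1 + n%:R) * t * `|y - x| by rewrite /r /A; ring.
rewrite ler_wpM2r//; rewrite /t mulrA ler_pdivrMr// mulrC ler_wpM2l ?(ltW e0)//.
rewrite /c; have : 0 <= C * 2 * 2 `^ s^-1 by rewrite !mulr_ge0 ?powR_ge0// ltW.
have : n%:R <= (n%:R * n%:R : R) by rewrite ler_peMl ?ler0n// ler1n.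
lra.
Qed.

End lp.

(** * The Hopf-Lax formula *)

Section directional_derivatives.
Context {R : realType} {n : nat}.
Local Notation vec := 'rV[R]_n.

Lemma compact_enorm_le (r : R) (C : set vec) : closed C ->
  compact [set z | enorm z <= r /\ C z].
Proof.
move=> cC; apply: bounded_closed_compact.
  exists r; split; first exact: num_real.
  move=> y ry z [zr _] /=; apply: le_trans (norm_le_enorm z) _.
  by apply: le_trans zr _; exact: ltW.
apply: closedI => //.
apply: (@closed_comp _ _ (fun z : vec => enorm z) [set y | y <= r]).
  by move=> z _; exact: enorm_continuous.
exact: closed_le.
Qed.

Lemma compact_pos_lb (K : set vec) (f : vec -> R) : compact K -> continuous f ->
  (forall x, K x -> 0 < f x) -> exists2 d : R, 0 < d & forall x, K x -> d <= f x.
Proof.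
move=> cK cf f0; have [->|/set0P K0] := eqVneq K set0; first by exists 1.
have [c cK' hc] := EVT_min_rV K0 cK (continuous_subspaceT cf).
exists (f c); first by apply: f0; rewrite inE in cK'.
by move=> x Kx; apply: hc; rewrite inE.
Qed.

Lemma continuous_enorm (V : normedModType R) (f : vec -> V) :
  (forall x e, 0 < e -> exists2 d : R, 0 < d &
    forall y, enorm (y - x) < d -> `|f y - f x| < e) -> continuous f.
Proof.
move=> h x A /nbhs_ballP[e /= e0 eA]; have [d d0 hd] := h x e e0.
have n0 : (0 : R) < n%:R + 1 by rewrite ltr_wpDl.
apply/nbhs_ballP; exists (d / (n%:R + 1)) => /=; first by rewrite divr_gt0.
move=> y; rewrite mx_norm_ball /ball_ /= distrC => xy; apply: eA.
rewrite -ball_normE /= distrC; apply: hd.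
apply: le_lt_trans (enorm_le_norm _) _.
apply: (@le_lt_trans _ _ ((n%:R + 1) * `|y - x|)); first by rewrite ler_wpM2r// lerDl.
by rewrite mulrC -ltr_pdivlMr.
Qed.

Lemma continuous_sub (f g : vec -> R) : continuous f -> continuous g ->
  continuous (fun x => f x - g x).
Proof. by move=> cf cg x; exact: (@continuousB _ _ _ f g x (cf x) (cg x)). Qed.

Lemma continuous_add (f g : vec -> R) : continuous f -> continuous g ->
  continuous (fun x => f x + g x).
Proof. by move=> cf cg x; exact: (@continuousD _ _ _ f g x (cf x) (cg x)). Qed.

Lemma continuous_dotl (v : vec) : continuous (fun x => dot x v).
Proof. by apply: dot_continuous => x; [exact: cvg_id|exact: cst_continuous]. Qed.

Lemma continuous_dotr (v : vec) : continuous (dot v).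
Proof. by apply: dot_continuous => x; [exact: cst_continuous|exact: cvg_id]. Qed.

Lemma continuous_enorm_sub (f : vec -> vec) (c : vec) : continuous f ->
  continuous (fun x => enorm (f x - c)).
Proof.
move=> cf x.
have -> : (fun x => enorm (f x - c)) = @enorm R n \o (fun x => f x - c) by [].
apply: continuous_comp; last exact: enorm_continuous.
by apply: (@continuousB _ _ _ f (cst c)); [exact: cf|exact: cst_continuous].
Qed.

Lemma closed_ge_continuous (f : vec -> R) (e : R) : continuous f ->
  closed [set x | e <= f x].
Proof.
move=> cf; apply: (@closed_comp _ _ f [set y | e <= y]); last exact: closed_ge.
by move=> x _; exact: cf.
Qed.

Implicit Types (w : vec -> R) (x e : vec).

Lemma derivable_lin w x e : derivable w x e ->
  forall eps : R, 0 < eps -> exists2 d : R, 0 < d & forall s, `|s| < d ->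
    `|w (x + s *: e) - w x - s * 'D_e w x| <= eps * `|s|.
Proof.
move=> dw eps eps0;
have /cvgrPdist_le/(_ _ eps0) : (fun s : R => s^-1 *: ((w \o shift x) (s *: e) - w x)) @ 0^'
    --> 'D_e w x := dw.
move=> /nbhs_ballP[d /= d0 hd]; exists d => // s sd.
have [->|s0] := eqVneq s 0.
  by rewrite scale0r addr0 subrr mul0r subr0 normr0 mulr0.
have sb : ball 0 d s by rewrite -ball_normE /= sub0r normrN.
have /= := hd s sb s0; rewrite [s *: e + x]addrC -/('D_e w x) distrC => h'.
have -> : w (x + s *: e) - w x - s * 'D_e w x =
    (s^-1 *: (w (x + s *: e) - w x) - 'D_e w x) * s.
  by rewrite mulrBl /GRing.scale /= -mulrA mulrCA mulVf// mulr1 [_ * s]mulrC.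
by rewrite normrM ler_wpM2r.
Qed.

Lemma derivable_of_lin w x e (a : R) :
  (forall eps : R, 0 < eps -> exists2 d : R, 0 < d & forall s, `|s| < d ->
    `|w (x + s *: e) - w x - s * a| <= eps * `|s|) ->
  derivable w x e /\ 'D_e w x = a.
Proof.
move=> h.
suff hc : (fun s : R => s^-1 *: ((w \o shift x) (s *: e) - w x)) @ 0^' --> a.
  by split; [apply/cvg_ex; exists a|exact: cvg_lim].
apply/cvgrPdist_le => eps eps0; have [d d0 hd] := h _ eps0.
apply/nbhs_ballP; exists d => //= s; rewrite -ball_normE /= sub0r normrN => sd s0.
have := hd s sd; rewrite [s *: e + x]addrC [leLHS in _ -> leLHS <= _]distrC.
have -> : w (x + s *: e) - w x - s * a =
    (s^-1 *: (w (x + s *: e) - w x) - a) * s.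
  by rewrite mulrBl /GRing.scale /= -mulrA mulrCA mulVf// mulr1 [_ * s]mulrC.
by rewrite normrM ler_pM2r ?normr_gt0.
Qed.

Lemma continuous_shift w (c : vec) : continuous w -> continuous (fun x => w (x + c)).
Proof.
move=> cw; have -> : (fun x => w (x + c)) = w \o shift c by [].
move=> x; apply: continuous_comp; last exact: cw.
by apply: (@continuousD _ _ _ id (cst c)); [exact: cvg_id|exact: cst_continuous].
Qed.

(* The right slope at x is at most a and the left slope at least b. *)
Definition kink w e (a b d : R) : set vec := [set x | forall h : R, 0 < h < d ->
  w (x + h *: e) - w x <= h * a /\ w (x - h *: e) - w x <= - (h * b)].

Lemma closed_kink w e (a b d : R) : continuous w -> closed (kink w e a b d).
Proof.
move=> cw.
rewrite (_ : kink w e a b d = \bigcap_(h in [set h | 0 < h < d])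
   ([set x | - (h * a) <= w x - w (x + h *: e)] `&`
    [set x | h * b <= w x - w (x - h *: e)])); last first.
  apply/seteqP; split=> x hx h /hx /=.
    by move=> [h1 h2]; split; lra.
  by move=> [h1 h2]; split; lra.
apply: closed_bigI => h _; apply: closedI.
  by apply: closed_ge_continuous; apply: continuous_sub => //; exact: continuous_shift.
by apply: closed_ge_continuous; apply: continuous_sub => //; exact: (@continuous_shift _ (- (h *: e))).
Qed.

Lemma kink_not_derivable w e (a b d : R) x : a < b -> 0 < d ->
  kink w e a b d x -> ~ derivable w x e.
Proof.
move=> ab d0 hk /derivable_lin dw.
have eps0 : 0 < (b - a) / 4 by rewrite divr_gt0// subr_gt0.
have [d' d'0 hd'] := dw _ eps0.
pose h := Num.min d d' / 2.
have m0 : 0 < Num.min d d' by rewrite lt_min d0.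
have h0 : 0 < h by rewrite divr_gt0.
have hm : h < Num.min d d' by rewrite /h; lra.
have [hd hd2] : h < d /\ h < d' by move: hm; rewrite lt_min => /andP[].
have hb : 0 < h < d by rewrite h0.
have [k1 k2] := hk h hb.
have /ler_normlP[l1 l2] : `|w (x + h *: e) - w x - h * 'D_e w x| <= (b - a) / 4 * `|h|.
  by apply: hd'; rewrite gtr0_norm.
have /ler_normlP[l3 l4] : `|w (x + (- h) *: e) - w x - (- h) * 'D_e w x| <= (b - a) / 4 * `|- h|.
  by apply: hd'; rewrite normrN gtr0_norm.
rewrite scaleNr normrN in l3 l4; rewrite gtr0_norm// in l1 l2 l3 l4.
have : 0 < h * (b - a) by rewrite mulr_gt0// subr_gt0.
lra.
Qed.

Lemma countable_separated (A : set R) (d : R) : 0 < d ->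
  (forall s s', A s -> A s' -> s < s' -> d <= s' - s) -> countable A.
Proof.
move=> d0 hA; apply/countable_injP; exists (fun s => pickle (Num.floor (s / d))).
move=> s s'; rewrite !inE => As As' /(pcan_inj (@pickleK int)) ss'.
wlog lt : s s' As As' ss' / s < s'.
  move=> W; case: (ltgtP s s') => // [|h]; first exact: W.
  by apply/esym; apply: W => //.
have := hA _ _ As As' lt.
have := floorD1_gt (s' / d); have := floor_le (s / d).
rewrite ss' ler_pdivlMr// ltr_pdivrMr// intrD mulrDl mul1r; lra.
Qed.

(** Suppose two kink points of a line lie at distance h < d. The right slope at the first gives an
    increment at most h a, the left slope at the second gives the same increment at least h b, which
    contradicts a < b. So kink points are separated by [d]. *)
Lemma kink_lines w e (a b d : R) x : a < b -> 0 < d ->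
  countable [set s | kink w e a b d (x + s *: e)].
Proof.
move=> ab d0; apply: (countable_separated d0) => s s' k1 k2 ss'.
rewrite leNgt; apply/negP => h.
have hb : 0 < s' - s < d by rewrite subr_gt0 ss'.
have [h1 _] := k1 _ hb; have [_ h2] := k2 _ hb.
have E1 : x + s *: e + (s' - s) *: e = x + s' *: e by rewrite -addrA -scalerDl subrKC.
have E2 : x + s' *: e - (s' - s) *: e = x + s *: e by rewrite -addrA -scalerBl subKr.
rewrite E1 in h1; rewrite E2 in h2.
have : 0 < (s' - s) * (b - a) by rewrite mulr_gt0// subr_gt0.
lra.
Qed.

Lemma measurable_partial (w : vec -> R) (i : 'I_n) : continuous w ->
  measurable [set x | derivable w x (delta_mx ord0 i)] ->
  measurable_fun setT (partial w i).
Proof.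
move=> cw mD; set D := [set x | _] in mD; set e : vec := delta_mx ord0 i.
(* Where the limit does not exist, the derivative takes the default value [point], so [partial w i]
   is constant off [D]. On [D] it is the limit of the difference quotients with steps 1/(k+1). *)
have -> : partial w i = fun x => if x \in D then partial w i x else point.
  apply/funext => x; case: ifPn => //; rewrite notin_setE => nD.
  rewrite /partial /derive; apply: getPN => l hl; apply: nD.
  by apply/cvg_ex; exists l.
apply: measurable_fun_if => //.
- by apply: (@measurable_fun_bool _ _ _ _ true); rewrite setTI preimage_mem_true.
- rewrite setTI preimage_mem_true.
  apply: (@measurable_fun_cvg _ vec R D
     (fun (k : nat) (x : vec) => k.+1%:R * (w (x + k.+1%:R^-1 *: e) - w x))).
    move=> k; apply: measurable_funTS; apply: continuous_measurable_rV.
    move=> x; apply: (@continuousM R vec (cst k.+1%:R) (fun x => w (x + k.+1%:R^-1 *: e) - w x)).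
      exact: cst_continuous.
    apply: continuous_sub => //; exact: continuous_shift.
  move=> x Dx; apply/cvgrPdist_le => eps eps0.
  have [d d0 hd] := derivable_lin Dx eps0.
  exists (Num.truncn d^-1) => // k /= hk.
  have k0 : (0 : R) < k.+1%:R^-1 by rewrite invr_gt0.
  have kd : k.+1%:R^-1 < d.
    rewrite invf_plt ?posrE//; apply: lt_le_trans (truncnS_gt _) _.
    by rewrite ler_nat ltnS.
  have := hd k.+1%:R^-1; rewrite gtr0_norm// => /(_ kd) h.
  have k1 : (0 : R) < k.+1%:R by [].
  have E (a b : R) : k.+1%:R * a - b = k.+1%:R * (a - k.+1%:R^-1 * b).
    by rewrite mulrBr mulrA divff ?pnatr_eq0// mul1r.
  rewrite distrC E normrM gtr0_norm// -ler_pdivlMl// [leRHS]mulrC; exact: h.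

Qed.

(** With rational slopes and thresholds 1/(k+1), the set of non-differentiability is exactly a
    countable union of kink sets. These are closed, which gives measurability, and meet lines in
    countable sets, which gives measure 0. *)
Lemma kink_null (w : vec -> R) (i : 'I_n) : continuous w ->
  (forall x, ~ derivable w x (delta_mx ord0 i) -> exists a b : rat, exists k : nat,
    ratr a < ratr b :> R /\ kink w (delta_mx ord0 i) (ratr a) (ratr b) (k.+1%:R^-1) x) ->
  measurable [set x | derivable w x (delta_mx ord0 i)] /\
  \forall x \ae lebesgue_rV n, derivable w x (delta_mx ord0 i).
Proof.
move=> cw hw; pose e : vec := delta_mx ord0 i.
pose K (p : rat * rat * nat) : set vec :=
  [set x | ratr p.1.1 < ratr p.1.2 :> R /\ kink w e (ratr p.1.1) (ratr p.1.2) (p.2.+1%:R^-1) x].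
have k0 (k : nat) : (0 : R) < k.+1%:R^-1 by rewrite invr_gt0.
have ND : ~` [set x | derivable w x e] = \bigcup_p K p.
  apply/seteqP; split=> x.
    by move=> /hw [a [b [k h]]]; exists (a, b, k).
  by move=> [p _ [ab kx]]; exact: (kink_not_derivable ab (k0 _) kx).
have mND : measurable (~` [set x | derivable w x e]).
  rewrite ND; apply: countable_bigcupT_measurable; first exact: countableP.
  move=> p; rewrite /K; case: (pselect (ratr p.1.1 < ratr p.1.2 :> R)) => h.
    rewrite (_ : [set x | _] = kink w e (ratr p.1.1) (ratr p.1.2) (p.2.+1%:R^-1)).
      by apply: closed_measurable_rV; exact: closed_kink.
    by apply/seteqP; split=> x // [].
  rewrite (_ : [set x | _] = set0) //.
  by apply/seteqP; split=> x // [].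
split; first by rewrite -[X in measurable X]setCK; exact: measurableC.
exists (~` [set x | derivable w x e]); split => //.
apply: (@lebesgue_rV_null_lines _ _ i) => // x.
rewrite ND (_ : [set s | _] = \bigcup_p [set s | K p (x + s *: e)]); last first.
  by apply/seteqP; split=> s -[p ? ?]; exists p.
apply: bigcup_countable => [|p _]; first exact: countableP.
case: (pselect (ratr p.1.1 < ratr p.1.2 :> R)) => h.
  apply: sub_countable (kink_lines w e x h (k0 p.2)); apply: subset_card_le.
  by move=> s [].
rewrite (_ : [set s | _] = set0) //.
by apply/seteqP; split=> s // [].
Qed.

End directional_derivatives.

Lemma le_poweR_inv (R : realType) (p e : R) (I : \bar R) : 0 < p -> 0 <= e -> (0 <= I)%E ->
  (I <= (e `^ p)%:E)%E -> (I `^ p^-1 <= e%:E)%E.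
Proof.
move=> p0 e0 I0 h.
have -> : e%:E = ((e `^ p)%:E `^ p^-1)%E.
  by rewrite poweR_EFin -powRrM divff ?gt_eqF// powRr1.
have pV : 0 <= p^-1 by rewrite invr_ge0 ltW.
by apply: (gt0_ler_poweR pV) => //; rewrite in_itv /= leey andbT// lee_fin powR_ge0.
Qed.

(** * The Legendre transform and its maximizers *)

Section hamiltonian.
Context {R : realType} {n : nat} (H : 'rV[R]_n -> R).
Local Notation vec := 'rV[R]_n.
Local Notation mu := (lebesgue_rV n).
Context (H_ge0 : forall x, 0 <= H x) (H_convex : strictly_convex H)
  (H_C1 : class_C 1 H) (H0 : H 0 = 0) (H_superlinear : superlinear H)
  (H_doubling : exists2 C : R, 1 < C &
       forall x, x != 0 -> H (2 *: x) / H x > 2 * C)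
  (H_spheres : exists2 C' : R, 1 < C' &
       forall r : R, 0 < r ->
         sup (H @` boundary (eball r)) < C' * inf (H @` boundary (eball r))).
Local Notation L := (legendre H).

Lemma H_continuous : continuous H.
Proof. by move=> x; apply: differentiable_continuous; exact: (H_C1.1 x). Qed.

Lemma H_gt0 z : z != 0 -> 0 < H z.
Proof.
move=> z0; have h : 0 < (2^-1 : R) < 1 by rewrite invr_gt0 ltr0n invf_lt1// ltr1n.
have := H_convex z0 h; rewrite scaler0 addr0 H0 mulr0 addr0 => h2.
by have := le_lt_trans (H_ge0 _) h2; rewrite pmulr_rgt0// invr_gt0.
Qed.

Lemma H_superlinear_gt (M : R) :
  exists2 r : R, 0 < r & forall z, r < enorm z -> M * enorm z < H z.
Proof.
have [r hr] := H_superlinear M; exists (Num.max r 1); first by rewrite lt_max ltr01 orbT.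
move=> z; rewrite gt_max => /andP[/hr h z1].
by rewrite -ltr_pdivlMr// (lt_trans _ z1).
Qed.

(** By superlinearity H(z) > |v| |z| beyond some radius, where the objective is negative, while it
    is 0 at the origin. The maximum over a closed ball is therefore global. *)
Lemma exists_legendre_max (v : vec) :
  exists q, forall z, dot z v - H z <= dot q v - H q.
Proof.
have [r r0 hr] := H_superlinear_gt (enorm v).
have cK := @compact_enorm_le _ _ r _ (@closedT vec).
have K0 : [set z : vec | enorm z <= r /\ setT z] !=set0.
  by exists 0; rewrite /= enorm0; split => //; exact: ltW.
have cf : continuous (fun z => dot z v - H z).
  exact: (continuous_sub (@continuous_dotl _ _ v) H_continuous).
have [q _ hq] := EVT_max_rV K0 cK (continuous_subspaceT cf).
exists q => z; have [zr|zr] := leP (enorm z) r; first by apply: hq; rewrite inE.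
apply: (@le_trans _ _ (dot 0 v - H 0)).
  rewrite dot0l H0 subrr subr_le0; apply: ltW.
  apply: le_lt_trans (hr _ zr); rewrite mulrC; exact: dot_le.
by apply: hq; rewrite inE /= enorm0; split => //; exact: ltW.
Qed.

(* The gradient of L; only the subgradient inequality and continuity are used. *)
Definition argmax (v : vec) : vec := projT1 (cid (exists_legendre_max v)).
Local Notation Q := argmax.

Lemma argmaxP v z : dot z v - H z <= dot (Q v) v - H (Q v).
Proof. by rewrite /argmax; case: cid. Qed.

Lemma legendreE v : L v = dot (Q v) v - H (Q v).
Proof.
rewrite /legendre; set A := [set _ | _ in _].
have hA : ubound A (dot (Q v) v - H (Q v)) by move=> _ [z _ <-]; exact: argmaxP.
have A0 : A !=set0 by exists (dot (Q v) v - H (Q v)); exists (Q v).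
apply/eqP; rewrite eq_le; apply/andP; split; first exact: ge_sup.
by apply: ub_le_sup; [exists (dot (Q v) v - H (Q v))|exists (Q v)].
Qed.

Lemma fenchel_le z v : dot z v - H z <= L v.
Proof. by rewrite legendreE; exact: argmaxP. Qed.

(** With two distinct maximizers, strict convexity would make their midpoint better than both. *)
Lemma argmax_uniq v q : L v = dot q v - H q -> Q v = q.
Proof.
move=> Lq; apply/eqP; apply: contrapT => /negP qQ.
have h : 0 < (2^-1 : R) < 1 by rewrite invr_gt0 ltr0n invf_lt1// ltr1n.
have := H_convex qQ h.
have := fenchel_le (2^-1 *: Q v + (1 - 2^-1) *: q) v.
rewrite dotDl !dotZl; have := legendreE v; rewrite Lq; lra.
Qed.

Lemma legendre_ge0 v : 0 <= L v.
Proof. by have := fenchel_le 0 v; rewrite dot0l H0 subrr. Qed.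

Lemma legendre0 : L 0 = 0.
Proof.
apply/eqP; rewrite eq_le legendre_ge0 andbT legendreE dot0r sub0r oppr_le0.
exact: H_ge0.
Qed.

Lemma argmax0 : Q 0 = 0.
Proof. by apply: argmax_uniq; rewrite legendre0 dot0l H0 subrr. Qed.

Lemma legendre_subgradient v v' : L v + dot (Q v) (v' - v) <= L v'.
Proof.
have := fenchel_le (Q v) v'; have := legendreE v; rewrite dotBr; lra.
Qed.

Lemma argmax_bounded (M : R) : exists2 r : R, 0 < r &
  forall v, enorm v <= M -> enorm (Q v) <= r.
Proof.
have [r r0 hr] := H_superlinear_gt M; exists r => // v vM.
rewrite leNgt; apply/negP => /hr h.
have := argmaxP v 0; rewrite dot0l H0 subrr.
have : dot (Q v) v <= M * enorm (Q v).
  by apply: le_trans (dot_le _ _) _; rewrite mulrC ler_wpM2r ?enorm_ge0.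
lra.
Qed.

Lemma legendre_lip (M : R) : exists2 r : R, 0 < r & forall v v',
  enorm v <= M -> enorm v' <= M -> `|L v - L v'| <= r * enorm (v - v').
Proof.
have [r r0 hr] := argmax_bounded M; exists r => // v v' vM v'M.
have B w w' : enorm w <= M -> L w - L w' <= r * enorm (w - w').
  move=> wM; have := legendre_subgradient w w'.
  rewrite -(opprB w w') dotNr.
  have : dot (Q w) (w - w') <= r * enorm (w - w').
    by apply: le_trans (dot_le _ _) _; rewrite ler_wpM2r ?enorm_ge0// hr.
  lra.
rewrite ler_norml B// andbT lerNl opprB -(enormN (v - v')) opprB.
exact: B.
Qed.

Lemma legendre_continuous : continuous L.
Proof.
apply: continuous_enorm => v e e0.
have [r r0 hr] := legendre_lip (enorm v + 1).
exists (Num.min 1 (e / r)); first by rewrite lt_min ltr01 divr_gt0.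
move=> w; rewrite lt_min => /andP[w1 w2].
apply: (@le_lt_trans _ _ (r * enorm (w - v))); last by rewrite mulrC -ltr_pdivlMr.
apply: hr; last by rewrite lerDl.
rewrite -(subrK v w) addrC; apply: le_trans (enormD _ _) _.
by rewrite lerD2l ltW.
Qed.

(** At distance at least [e] from [Q v] the objective for [v] falls short of its maximum by some d >
    0, by compactness and uniqueness. The shortfall at [Q v'] is at most (Q v' - Q v).(v' - v),
    hence small for [v'] near [v]. *)
Lemma argmax_near (v : vec) (e : R) : 0 < e ->
  exists2 d : R, 0 < d & forall v', enorm (v' - v) < d -> enorm (Q v' - Q v) < e.
Proof.
move=> e0; have [r r0 hr] := argmax_bounded (enorm v + 1).
have clC : closed [set z | e <= enorm (z - Q v)].
  apply: (@closed_ge_continuous _ _ (fun z => enorm (z - Q v))).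
  by apply: (continuous_enorm_sub (f := id)) => z; exact: cvg_id.
have [d d0 hd] : exists2 d : R, 0 < d & forall z,
    enorm z <= r /\ e <= enorm (z - Q v) -> d <= L v - (dot z v - H z).
  apply: (@compact_pos_lb _ _ [set z | enorm z <= r /\ e <= enorm (z - Q v)]).
  - exact: (@compact_enorm_le _ _ r _ clC).
  - apply: (@continuous_sub _ _ (cst (L v))); first exact: cst_continuous.
    exact: (continuous_sub (@continuous_dotl _ _ v) H_continuous).
  - move=> z [zr ez]; rewrite subr_gt0 lt_neqAle fenchel_le andbT.
    apply/eqP => /esym/argmax_uniq h.
    by move: ez; rewrite h subrr enorm0 leNgt e0.
have r20 : 0 < 2 * r by rewrite mulr_gt0.
exists (Num.min 1 (d / (2 * r))); first by rewrite lt_min ltr01 divr_gt0.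
move=> v'; rewrite lt_min => /andP[v1 v2].
have v'b : enorm v' <= enorm v + 1.
  by rewrite -(subrK v v') addrC; apply: le_trans (enormD _ _) _; rewrite lerD2l ltW.
have vb : enorm v <= enorm v + 1 by rewrite lerDl.
rewrite ltNge; apply/negP => h.
have := hd (Q v') (conj (hr _ v'b) h).
have := legendre_subgradient v v'; have := legendreE v'.
have : dot (Q v' - Q v) (v' - v) <= 2 * r * enorm (v' - v).
  apply: le_trans (dot_le _ _) _; rewrite ler_wpM2r ?enorm_ge0//.
  apply: le_trans (enormB _ _) _; have := hr _ v'b; have := hr _ vb; lra.
rewrite ltr_pdivlMr// mulrC in v2.
rewrite dotBl !dotBr; lra.
Qed.

Lemma argmax_continuous : continuous Q.
Proof.
apply: continuous_enorm => v e e0; have [d d0 hd] := argmax_near v e0.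
by exists d => // w /hd; apply: le_lt_trans; exact: norm_le_enorm.
Qed.

(** The supremum is tested at the vector of length [M] in direction [v]; the constant is the maximum
    of H on the ball of radius [M]. *)
Lemma legendre_coercive (M : R) : 0 <= M -> exists c : R, forall v, M * enorm v - c <= L v.
Proof.
move=> M0.
have cK := @compact_enorm_le _ _ M _ (@closedT vec).
have K0 : [set z : vec | enorm z <= M /\ setT z] !=set0 by exists 0; rewrite /= enorm0.
have [c _ hc] := EVT_max_rV K0 cK (continuous_subspaceT H_continuous).
exists (H c) => v; have [->|v0] := eqVneq v 0.
  by rewrite enorm0 mulr0 sub0r (le_trans _ (legendre_ge0 _))// oppr_le0.
pose z := (M / enorm v) *: v.
have ev := enorm_gt0 v0.
have zM : enorm z = M.
  by rewrite enormZ ger0_norm ?divr_ge0 ?enorm_ge0// divfK// gt_eqF.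
have Hz : H z <= H c by apply: hc; rewrite inE /= zM.
have := fenchel_le z v; rewrite {1}/z dotZl -sqr_enorm expr2 mulrA divfK ?gt_eqF//.
lra.
Qed.

(** The gradient of H at [a] works: by convexity it is a subgradient, so [a] attains the supremum.
    Were the subgradient inequality to fail towards [z], a difference quotient with small step would
    exceed H(z) - H(a), against convexity. *)
Lemma exists_fenchel_dual (a : vec) : exists v, L v = dot a v - H a.
Proof.
exists (gradient H a); apply/eqP; rewrite eq_le fenchel_le andbT legendreE.
set z := Q _.
suff h : dot (gradient H a) (z - a) <= H z - H a.
  by move: h; rewrite dotBr !(dotC (gradient H a)); lra.
have [->|za] := eqVneq z a; first by rewrite !subrr dot0r.
have dH := H_C1.1 a.
have DE : 'D_(z - a) H a = dot (gradient H a) (z - a).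
  rewrite deriveE// {1}(row_sum_delta (z - a)) linear_sum /dot; apply: eq_bigr => i _.
  by rewrite linearZ /= !mxE /partial deriveE// mulrC.
rewrite -DE leNgt; apply/negP => h.
have [d _] := @derivableP _ _ _ H a (z - a) (diff_derivable dH).
have hn : \forall s \near (0 : R)^', H z - H a < s^-1 *: ((H \o shift a) (s *: (z - a)) - H a).
  exact: (cvgr_gt _ d _ h).
have /nbhs_ballP[e /= e0 he] := hn.
pose t := Num.min (e / 2) 2^-1.
have t0 : 0 < t by rewrite /t lt_min divr_gt0//= invr_gt0.
have t1 : t < 1.
  by rewrite /t gt_min; apply/orP; right; rewrite invf_lt1// ltr1n.
have te : t < e by rewrite /t gt_min; apply/orP; left; lra.
have tb : ball 0 e t by rewrite -ball_normE /= sub0r normrN gtr0_norm.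
have /= := he t tb; rewrite gt_eqF// => /(_ isT).
rewrite /GRing.scale /= mulrC ltr_pdivlMr//.
have -> : t *: (z - a) + a = t *: z + (1 - t) *: a.
  by rewrite scalerBr scalerBl scale1r addrAC addrA.
have t01 : 0 < t < 1 by rewrite t0.
by have := H_convex za t01; lra.
Qed.

(** Equality in Fenchel's inequality forces [Q v = a], so the defect is positive wherever [Q v] is
    away from [a], and bounded below there once |v| <= M. *)
Lemma argmax_stable (a : vec) (M e : R) : 0 < e -> exists2 d : R, 0 < d &
  forall v, enorm v <= M -> L v - dot a v + H a < d -> enorm (Q v - a) < e.
Proof.
move=> e0.
have cn : continuous (fun v => enorm (Q v - a)).
  by apply: (continuous_enorm_sub (f := Q)); exact: argmax_continuous.
have clC := @closed_ge_continuous _ _ _ e cn.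
have [d d0 hd] : exists2 d : R, 0 < d & forall v,
    enorm v <= M /\ e <= enorm (Q v - a) -> d <= L v - dot a v + H a.
  apply: (@compact_pos_lb _ _ [set z | enorm z <= M /\ e <= enorm (Q z - a)]).
  - exact: (@compact_enorm_le _ _ M _ clC).
  - apply: (@continuous_add _ _ _ (cst (H a))); last exact: cst_continuous.
    exact: (continuous_sub legendre_continuous (@continuous_dotr _ _ a)).
  - move=> v [_ ev]; have := fenchel_le a v; rewrite le_eqVlt => /orP[/eqP h|]; last lra.
    by move: ev; rewrite (argmax_uniq (esym h)) subrr enorm0 leNgt e0.
exists d => // v vM h; rewrite ltNge; apply/negP => h'.
by have := hd v (conj vM h'); lra.
Qed.

Lemma boundary_eball_le (r : R) (z : vec) : boundary (eball r) z -> enorm z <= r.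
Proof.
case=> cz _; have cl : closed [set z : vec | enorm z <= r].
  apply: (@closed_comp _ _ (fun z : vec => enorm z) [set y | y <= r]).
    by move=> w _; exact: enorm_continuous.
  exact: closed_le.
have := closure_subset (_ : eball r `<=` [set z : vec | enorm z <= r]).
move=> h; have {}h := h (fun w hw => ltW hw); move/h: cz.
by rewrite -(closure_id _).1.
Qed.

Lemma boundary_eball (r : R) (x : vec) : 0 < r -> enorm x = r -> boundary (eball r) x.
Proof.
move=> r0 xr; split; last by move=> /interior_subset /=; rewrite /eball /= xr ltxx.
move=> A /nbhs_ballP[e /= e0 eA].
pose t : R := Num.min 2^-1 (e / (2 * r)).
have t0 : 0 < t by rewrite lt_min invr_gt0 ltr0n divr_gt0// mulr_gt0.
have t1 : t <= 2^-1 by rewrite ge_min lexx.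
have te : t * r < e.
  have : t <= e / (2 * r) by rewrite ge_min lexx orbT.
  by rewrite ler_pdivlMr ?mulr_gt0//; lra.
exists ((1 - t) *: x); split.
  by rewrite /eball /= enormZ xr ger0_norm ?gtr_pMl//; lra.
apply: eA; rewrite mx_norm_ball /ball_ /=.
have -> : x - (1 - t) *: x = t *: x by rewrite scalerBl scale1r subKr.
apply: le_lt_trans (norm_le_enorm _) _.
by rewrite enormZ xr gtr0_norm.
Qed.

(** Pointwise form of the condition on spheres. Since [sup] and [inf] bound their sets only when
    these are bounded, compactness of the ball and H >= 0 are called upon. *)
Lemma sphere_compare : exists2 C' : R, 1 < C' &
  forall x y, enorm x = enorm y -> H x <= C' * H y.
Proof.
have [C' C'1 hC'] := H_spheres; exists C' => // x y xy.
have [x0|x0] := eqVneq x 0.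
  by rewrite x0 H0 mulr_ge0// ltW// (lt_trans _ C'1).
have r0 := enorm_gt0 x0; have hr := hC' _ r0.
have cK := @compact_enorm_le _ _ (enorm x) _ (@closedT vec).
have K0 : [set z : vec | enorm z <= enorm x /\ setT z] !=set0 by exists x.
have [c _ hc] := EVT_max_rV K0 cK (continuous_subspaceT H_continuous).
have bx := boundary_eball r0 erefl; have bY := boundary_eball r0 (esym xy).
have h1 : H x <= sup (H @` boundary (eball (enorm x))).
  apply: ub_le_sup; last by exists x.
  by exists (H c) => _ [z bz <-]; apply: hc; rewrite inE; split => //; exact: boundary_eball_le.
have h2 : inf (H @` boundary (eball (enorm x))) <= H y.
  by apply: ge_inf; [exists 0 => _ [z _ <-]; exact: H_ge0|exists y].
apply: le_trans h1 _; apply: le_trans (ltW hr) _.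
by rewrite ler_pM2l// (lt_trans _ C'1).
Qed.

(* Test the supremum L v at z = 2^-k (|q| / |v|) v, where q = Q v. *)
Lemma argmax_growth : exists2 K : R, 0 < K &
  forall v, enorm (Q v) * enorm v <= K * L v.
Proof.
have [C C1 hC] := H_doubling; have [C' C'1 hC'] := sphere_compare.
have C0 : 0 < C by apply: lt_trans C1.
have C'0 : 0 < C' by apply: lt_trans C'1.
have C20 : 0 < 2 * C by rewrite mulr_gt0.
have half q : H (2^-1 *: q) <= (2 * C)^-1 * H q.
  have [->|q0] := eqVneq q 0; first by rewrite scaler0 H0 mulr0.
  have q20 : 2^-1 *: q != 0 by rewrite scaler_eq0 invr_eq0 pnatr_eq0.
  have := hC _ q20; rewrite scalerA divff ?pnatr_eq0// scale1r.
  rewrite ltr_pdivlMr ?H_gt0// => h.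
  by rewrite mulrC ler_pdivlMr// mulrC ltW.
have halfk k q : H (2^-1 ^+ k *: q) <= (2 * C)^-1 ^+ k * H q.
  elim: k => [|k IH]; first by rewrite !expr0 scale1r mul1r.
  rewrite exprS -scalerA; apply: le_trans (half _) _.
  by rewrite exprS -mulrA ler_pM2l ?invr_gt0.
(* This choice makes C' (2C)^-k <= 2^-k / 2, so that H at the test vector uses up at most half of
   the linear term. *)
have [k hk] : exists k : nat, 2 * C' <= C ^+ k.
  have bern k : 1 + k%:R * (C - 1) <= C ^+ k.
    elim: k => [|k IH]; first by rewrite expr0 mul0r addr0.
    rewrite exprS; apply: (@le_trans _ _ (C * (1 + k%:R * (C - 1)))); last by rewrite ler_pM2l.
    rewrite -natr1; have : 0 <= k%:R * (C - 1) * (C - 1).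
      by rewrite -mulrA mulr_ge0// mulr_ge0// subr_ge0 ltW.
    lra.
  have Cm : 0 < C - 1 by rewrite subr_gt0.
  exists (Num.truncn (2 * C' / (C - 1))).+1; apply: le_trans (bern _).
  have := truncnS_gt (2 * C' / (C - 1)); rewrite ltr_pdivrMr//; lra.
exists (2 ^+ k.+1) => [|v]; first by rewrite exprn_gt0.
set q := Q v.
have L0 := legendre_ge0 v.
have [v0|v0] := eqVneq v 0.
  by rewrite {1}v0 enorm0 mulr0 mulr_ge0// exprn_ge0.
have ev := enorm_gt0 v0; have eq0 := enorm_ge0 q.
pose t := 2^-1 ^+ k * (enorm q / enorm v).
have h0 : 0 <= (2^-1 : R) ^+ k by rewrite exprn_ge0// invr_ge0.
have t0 : 0 <= t by rewrite mulr_ge0// divr_ge0// ltW.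
have zE : enorm (t *: v) = enorm (2^-1 ^+ k *: q).
  by rewrite !enormZ !ger0_norm// /t -!mulrA mulVf ?mulr1// gt_eqF.
have F := fenchel_le (t *: v) v.
have Lq := legendreE v; rewrite -/q in Lq.
have dq := dot_le q v.
have Hz := hC' _ _ zE.
have Hq := halfk k q.
have zv : dot (t *: v) v = 2^-1 ^+ k * (enorm q * enorm v).
  rewrite dotZl -sqr_enorm /t -mulrA; congr (_ * _).
  by rewrite expr2 mulrA divfK// gt_eqF.
pose P := enorm q * enorm v.
have P0 : 0 <= P by rewrite mulr_ge0// ltW.
(* Since L v >= 0, H(q) <= q.v <= |q| |v| = P. Halving [k] times and passing to the direction of [v]
   leaves at most 2^-k P / 2, against a linear term equal to 2^-k P. *)
have HP : H (t *: v) <= 2^-1 ^+ k * (2^-1 * P).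
  apply: le_trans Hz _; apply: (@le_trans _ _ (C' * ((2 * C)^-1 ^+ k * P))).
    rewrite ler_pM2l//; apply: le_trans Hq _.
    rewrite ler_wpM2l ?exprn_ge0 ?invr_ge0 ?(ltW C20)//; rewrite /P; lra.
  rewrite invfM exprMn -!mulrA mulrCA; apply: ler_wpM2l => //.
  rewrite mulrA; apply: ler_wpM2r => //.
  rewrite exprVn ler_pdivrMr ?exprn_gt0//; lra.
rewrite -/P in zv *.
have E : 2 ^+ k.+1 * (2^-1 ^+ k * (2^-1 * P)) = P.
  rewrite exprS exprVn; field; by rewrite expf_neq0.
rewrite -E ler_pM2l ?exprn_gt0//; lra.
Qed.

(** * Minimizing velocities and the gradient of w *)

Section hopf.
Context (u : vec -> R) (u_cont : continuous u) (B : R) (u_bnd : forall x, `|u x| <= B)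
  (t : R) (t0 : 0 < t).
Local Notation w := (hopf_lax H u t).

(* The minimization is over velocities v, where y = x - t v. *)
Definition hopf_cost (x v : vec) : R := u (x - t *: v) + t * L v.

Definition hopf_min (x v : vec) : Prop := forall v', hopf_cost x v <= hopf_cost x v'.

(** Beating the velocity 0 means t L(v) <= 2 B, and L grows at least linearly. The radius depends on
    [t] but not on [x]. *)
Lemma hopf_cost_bounded : exists2 rho : R, 0 <= rho &
  forall x v, hopf_cost x v <= hopf_cost x 0 -> enorm v <= rho.
Proof.
have [c hc] := legendre_coercive (@ler01 R).
have B0 : 0 <= B by apply: le_trans (u_bnd 0).
have c0 : 0 <= c.
  by have := hc 0; rewrite enorm0 mulr0 sub0r legendre0 oppr_le0.
exists (2 * B / t + c); first by rewrite addr_ge0// divr_ge0 ?mulr_ge0// ltW.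
move=> x v; rewrite /hopf_cost legendre0 mulr0 addr0 scaler0 subr0.
have /ler_normlP[_ ux] := u_bnd x; have /ler_normlP[uv _] := u_bnd (x - t *: v).
move=> h; have hv := hc v; rewrite mul1r in hv.
have : t * (enorm v - c) <= 2 * B.
  by have := ler_wpM2l (ltW t0) hv; lra.
rewrite -ler_pdivlMl// mulrC; lra.
Qed.

Lemma hopf_cost_continuous x : continuous (hopf_cost x).
Proof.
apply: continuous_add.
  have -> : (fun v => u (x - t *: v)) = u \o (fun v => x - t *: v) by [].
  move=> v; apply: continuous_comp; last exact: u_cont.
  apply: (@continuousB _ _ _ (cst x) (fun v => t *: v)); first exact: cst_continuous.
  exact: scaler_continuous.
move=> v; apply: (@continuousM _ _ (cst t) L); first exact: cst_continuous.
exact: legendre_continuous.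
Qed.

Lemma exists_hopf_min x : exists v, hopf_min x v.
Proof.
have [rho rho0 hrho] := hopf_cost_bounded.
have cK := @compact_enorm_le _ _ rho _ (@closedT vec).
have K0 : [set z : vec | enorm z <= rho /\ setT z] !=set0 by exists 0; rewrite /= enorm0.
have [v _ hv] := EVT_min_rV K0 cK (continuous_subspaceT (hopf_cost_continuous (x := x))).
exists v => z; have [zr|zr] := leP (hopf_cost x z) (hopf_cost x 0).
  by apply: hv; rewrite inE /=; split => //; exact: (hrho x).
apply: le_trans (ltW zr); apply: hv; rewrite inE /= enorm0; by split.
Qed.

Lemma hopf_laxE x v : hopf_min x v -> w x = hopf_cost x v.
Proof.
move=> hv; rewrite /hopf_lax; set A := [set _ | _ in _].
have yE y : x - t *: (t^-1 *: (x - y)) = y.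
  by rewrite scalerA divff ?gt_eqF// scale1r subKr.
have hA : lbound A (hopf_cost x v).
  by move=> _ [y _ <-]; have := hv (t^-1 *: (x - y)); rewrite {2}/hopf_cost yE.
have Av : A (hopf_cost x v).
  by exists (x - t *: v) => //; rewrite subKr scalerA mulVf ?gt_eqF// scale1r.
apply/eqP; rewrite eq_le; apply/andP; split.
  by apply: ge_inf => //; exists (hopf_cost x v).
by apply: lb_le_inf => //; exists (hopf_cost x v).
Qed.

Local Opaque hopf_lax legendre argmax.

Lemma hopf_lax_le x v : w x <= hopf_cost x v.
Proof. by have [v' hv'] := exists_hopf_min x; rewrite (hopf_laxE hv'). Qed.

(** Moving the point by z and the velocity by z/t keeps the foot point fixed, so the value of [u]
    cancels and the change is due to L alone. *)
Lemma hopf_cost_shift x z v : hopf_cost (x + z) (v + t^-1 *: z) =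
  hopf_cost x v + t * (L (v + t^-1 *: z) - L v).
Proof.
rewrite /hopf_cost.
have -> : x + z - t *: (v + t^-1 *: z) = x - t *: v.
  by rewrite scalerDr scalerA divff ?gt_eqF// scale1r opprD addrACA subrr addr0.
lra.
Qed.

Lemma hopf_lax_lip : exists2 r : R, 0 < r & forall x x', enorm (x' - x) <= t ->
  w x' <= w x + r * enorm (x' - x).
Proof.
have [rho rho0 hrho] := hopf_cost_bounded.
have [r r0 hr] := legendre_lip (rho + 1).
exists r => // x x' xx'; have [v hv] := exists_hopf_min x.
set z := x' - x in xx' *; have -> : x' = x + z by rewrite /z subrKC.
apply: le_trans (hopf_lax_le _ (v + t^-1 *: z)) _.
rewrite hopf_cost_shift (hopf_laxE hv) lerD2l.
have vr : enorm v <= rho := hrho _ _ (hv 0).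
have ez : enorm (t^-1 *: z) = t^-1 * enorm z by rewrite enormZ gtr0_norm// invr_gt0.
have ez1 : enorm (t^-1 *: z) <= 1 by rewrite ez ler_pdivrMl// mulr1.
have vr1 : enorm v <= rho + 1 by lra.
have vzr : enorm (v + t^-1 *: z) <= rho + 1.
  by apply: le_trans (enormD _ _) _; exact: lerD.
have /ler_normlP[_ h] := hr _ _ vzr vr1; rewrite (addrAC v) subrr add0r ez in h.
have := ler_wpM2l (ltW t0) h; rewrite mulrCA (mulrA t) divff ?gt_eqF// mul1r; lra.
Qed.

Lemma hopf_lax_continuous : continuous w.
Proof.
have [r r0 hr] := hopf_lax_lip; apply: continuous_enorm => x e e0.
exists (Num.min t (e / r)); first by rewrite lt_min t0 divr_gt0.
move=> y; rewrite lt_min => /andP[yt ye].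
rewrite ltr_pdivlMr// mulrC in ye.
have h1 := hr _ _ (ltW yt); have xy : enorm (x - y) = enorm (y - x) by rewrite -enormN opprB.
have := hr y x; rewrite xy => /(_ (ltW yt)) h2.
rewrite ltr_norml; move: (w x) (w y) (r * _) h1 h2 ye => a b c h1 h2 ye.
by apply/andP; split; lra.
Qed.

(** The minimizer at [x], shifted with the point, is a competitor at the new point, and the
    subgradient at the shifted velocity bounds the change of L. As [s] may have either sign, this
    bounds right slopes from above and left slopes from below. *)
Lemma hopf_lax_coord_le x v (s : R) i : hopf_min x v ->
  w (x + s *: delta_mx ord0 i) - w x <=
    s * Q (v + t^-1 *: (s *: delta_mx ord0 i)) ord0 i.
Proof.
move=> hv; set z := s *: delta_mx ord0 i.
have := hopf_lax_le (x + z) (v + t^-1 *: z).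
rewrite hopf_cost_shift (hopf_laxE hv).
have := legendre_subgradient (v + t^-1 *: z) v.
rewrite opprD addrA subrr sub0r dotNr /z !dotZr dot_delta -/z => h.
have := ler_wpM2l (ltW t0) h; rewrite mulrBr (mulrA t t^-1) divff ?gt_eqF// mul1r; lra.
Qed.

Lemma argmax_coord_near v i (e : R) : 0 < e -> exists2 d : R, 0 < d &
  forall s : R, `|s| < d ->
    `|Q (v + t^-1 *: (s *: delta_mx ord0 i)) ord0 i - Q v ord0 i| < e.
Proof.
move=> e0; have [d d0 hd] := argmax_near v e0.
have ed : 0 < enorm (delta_mx ord0 i : vec) + 1 by rewrite ltr_wpDl// enorm_ge0.
exists (d * t / (enorm (delta_mx ord0 i : vec) + 1)); first by rewrite divr_gt0// mulr_gt0.
move=> s; rewrite ltr_pdivlMr// => hs.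
have : enorm (v + t^-1 *: (s *: delta_mx ord0 i) - v) < d.
  rewrite (addrAC v) subrr add0r enormZ enormZ gtr0_norm ?invr_gt0// ltr_pdivrMl// mulrC [t * _]mulrC.
  apply: le_lt_trans hs; rewrite mulrC ler_wpM2l//; lra.
move=> /hd; apply: le_lt_trans; apply: le_trans (coord_le_enorm _ i).
by rewrite !mxE.
Qed.

(** For s > 0 and s < 0 the one-sided estimate squeezes an existing derivative between values of Q
    near [v], which is continuous. *)
Lemma hopf_lax_derive x v i : hopf_min x v -> derivable w x (delta_mx ord0 i) ->
  'D_(delta_mx ord0 i) w x = Q v ord0 i.
Proof.
move=> hv dw.
suff h e : 0 < e -> `|'D_(delta_mx ord0 i) w x - Q v ord0 i| <= e.
  apply/eqP; rewrite -subr_eq0 -normr_le0; apply/ler_addgt0Pr => e e0.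
  by rewrite add0r; exact: h.
move=> e0; have e20 : 0 < e / 2 by rewrite divr_gt0.
have [d d0 hd] := derivable_lin dw e20.
have [d' d'0 hd'] := argmax_coord_near v i e20.
pose h := Num.min d d' / 2.
have m0 : 0 < Num.min d d' by rewrite lt_min d0.
have h0 : 0 < h by rewrite divr_gt0.
have hm : h < Num.min d d' by rewrite /h gtr_pMr// invf_lt1// ltr1n.
have [hd1 hd2] : h < d /\ h < d' by move: hm; rewrite lt_min => /andP[].
have nh : `|h| = h by rewrite gtr0_norm.
have nh' : `|- h| = h by rewrite normrN.
have := hd h; have := hd (- h); rewrite nh nh' => /(_ hd1)/ler_normlP[l1 l2] /(_ hd1)/ler_normlP[l3 l4].
have := hd' h; have := hd' (- h); rewrite nh nh' => /(_ hd2)/ltW/ler_normlP[k1 k2] /(_ hd2)/ltW/ler_normlP[k3 k4].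
move: l1 l2 l3 l4 k1 k2 k3 k4 (hopf_lax_coord_le h i hv) (hopf_lax_coord_le (- h) i hv).
move: (Q (v + t^-1 *: (h *: _)) _ _) (Q (v + t^-1 *: (- h *: _)) _ _) => qp qm.
move: (w (x + h *: _)) (w (x + - h *: _)) (Q v ord0 i) ('D_ _ _ _) (w x) => wp wm q D wx.
move: h0; clear => h0 l1 l2 l3 l4 k1 k2 k3 k4 U1 U2.
have A1 : D <= qp + e / 2 by rewrite -(ler_pM2l h0); lra.
have A2 : qm - e / 2 <= D by rewrite -(ler_pM2l h0); lra.
by rewrite ler_norml; apply/andP; split; lra.
Qed.

(** The upper estimate comes from a minimizer at [x]. For the lower one, a minimizer at [x + s *: E]
    is carried back to [x]; it is almost minimal there, so compactness and the common value [a]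
    force its coordinate of Q close to [a]. *)
Lemma hopf_lax_derivable x i (a : R) :
  (forall v, hopf_min x v -> Q v ord0 i = a) -> derivable w x (delta_mx ord0 i).
Proof.
move=> ha; have [v hv] := exists_hopf_min x.
suff h : forall eps : R, 0 < eps -> exists2 d : R, 0 < d & forall s, `|s| < d ->
  `|w (x + s *: delta_mx ord0 i) - w x - s * a| <= eps * `|s| by have [] := derivable_of_lin h.
move=> e e0; have [rho rho0 hrho] := hopf_cost_bounded.
have [r r0 hr] := legendre_lip (rho + 1).
have [r' r'0 hr'] := hopf_lax_lip.
have [d1 d10 hd1] := argmax_coord_near v i e0.
set E : vec := delta_mx ord0 i.
have cQ : continuous (fun v => `|Q v ord0 i - a|).
  have -> : (fun v => `|Q v ord0 i - a|) = Num.norm \o (fun v => Q v ord0 i - a) by [].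
  move=> z; apply: continuous_comp; last exact: norm_continuous.
  have -> : (fun v => Q v ord0 i - a) = (fun v => (v : vec) ord0 i - a) \o Q by [].
  apply: continuous_comp; first exact: argmax_continuous.
  apply: (@continuousB _ _ _ (fun v : vec => v ord0 i) (cst a)); last exact: cst_continuous.
  exact: coord_continuous.
have clC := @closed_ge_continuous _ _ _ e cQ.
(* Among bounded velocities whose coordinate of Q is at least [e] away from [a], the excess of the
   cost over w(x) is at least [d2]: an excess 0 would mean a minimizer. *)
have [d2 d20 hd2] : exists2 d : R, 0 < d & forall v,
    enorm v <= rho + 1 /\ e <= `|Q v ord0 i - a| -> d <= hopf_cost x v - w x.
  apply: (@compact_pos_lb _ _ [set z | enorm z <= rho + 1 /\ e <= `|Q z ord0 i - a|]).
  - exact: (@compact_enorm_le _ _ (rho + 1) _ clC).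
  - apply: (@continuous_sub _ _ _ (cst (w x))); last exact: cst_continuous.
    exact: hopf_cost_continuous.
  - move=> z [_ ez]; rewrite subr_gt0 lt_neqAle hopf_lax_le andbT.
    apply/eqP => wz; have /ha h : hopf_min x z by move=> v'; rewrite -wz; exact: hopf_lax_le.
    by move: ez; rewrite h subrr normr0 leNgt e0.
have eE : 0 < enorm E + 1 by rewrite ltr_wpDl// enorm_ge0.
have rr0 : 0 < r + r' by rewrite addr_gt0.
(* In this range the velocity carried back to [x] has excess below [d2]: [r'] accounts for the
   change of w, [r] for that of L, and the bound by [t] keeps the shift of the velocity below 1. *)
pose d3 := Num.min t (d2 / (r + r')) / (enorm E + 1).
have d30 : 0 < d3 by rewrite divr_gt0// lt_min t0 divr_gt0.
exists (Num.min d1 d3); first by rewrite lt_min d10.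
move=> s; rewrite lt_min => /andP[s1 s3].
have sE : enorm (s *: E) < Num.min t (d2 / (r + r')).
  rewrite ltr_pdivlMr// in s3; rewrite enormZ; apply: le_lt_trans s3.
  by rewrite ler_wpM2l// lerDl.
have [sEt sEd] : enorm (s *: E) < t /\ enorm (s *: E) * (r + r') < d2.
  by move: sE; rewrite lt_min (ltr_pdivlMr _ _ rr0) => /andP[].
have [v' hv'] := exists_hopf_min (x + s *: E).
have U1 := hopf_lax_coord_le s i hv; rewrite -/E in U1.
have U2 := hopf_lax_coord_le (- s) i hv'; rewrite -/E in U2.
have EE : x + s *: E + - s *: E = x by rewrite scaleNr addrK.
rewrite EE in U2.
set v'' := v' + t^-1 *: (- s *: E) in U2.
have en : enorm (- s *: E) = enorm (s *: E) by rewrite scaleNr enormN.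
have ez : enorm (t^-1 *: (- s *: E)) = t^-1 * enorm (s *: E).
  by rewrite enormZ en gtr0_norm// invr_gt0.
have ez1 : enorm (t^-1 *: (- s *: E)) <= 1 by rewrite ez ler_pdivrMl// mulr1 ltW.
have vr : enorm v' <= rho := hrho _ _ (hv' 0).
have vr1 : enorm v' <= rho + 1 by lra.
have vzr : enorm v'' <= rho + 1.
  by apply: le_trans (enormD _ _) _; exact: lerD.
have q2 : `|Q v'' ord0 i - a| < e.
  rewrite ltNge; apply/negP => h; have := hd2 _ (conj vzr h).
  have := hopf_cost_shift (x + s *: E) (- s *: E) v'; rewrite EE -/v'' => ->.
  rewrite -(hopf_laxE hv').
  have /ler_normlP[_ h3] := hr _ _ vzr vr1; rewrite {2}/v'' (addrAC v') subrr add0r ez in h3.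
  have := ler_wpM2l (ltW t0) h3; rewrite mulrCA (mulrA t) divff ?gt_eqF// mul1r.
  have := hr' x (x + s *: E); rewrite [x + _]addrC addrK => /(_ (ltW sEt)).
  move: sEd d20; move: (w x) (w _) (enorm _) (t * _) => wx wy en' tL; lra.
have q1 := hd1 s s1; rewrite -/E (ha _ hv) in q1.
set q := Q _ _ _ in U2 q2; set p := Q _ _ _ in U1 q1.
have S1 : s * (p - a) <= e * `|s|.
  rewrite mulrC; apply: le_trans (ler_norm _) _; rewrite normrM ler_wpM2r// ltW//.
have S2 : - (s * (q - a)) <= e * `|s|.
  rewrite -mulrN mulrC; apply: le_trans (ler_norm _) _; rewrite normrM normrN ler_wpM2r// ltW//.
move: U1 U2 S1 S2; clearbody p q.
rewrite ler_norml; move: (w x) (w _) => wx wy *; apply/andP; split; lra.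
Qed.

(** Without a derivative, two minimizers differ in coordinate [i] of Q. The one with the smaller
    coordinate bounds the right slope above, the other bounds the left slope below, and two
    rationals fit strictly between. *)
Lemma hopf_lax_kink x i : ~ derivable w x (delta_mx ord0 i) ->
  exists a b : rat, exists k : nat,
    ratr a < ratr b :> R /\ kink w (delta_mx ord0 i) (ratr a) (ratr b) (k.+1%:R^-1) x.
Proof.
move=> nd; have [v hv] := exists_hopf_min x.
have [v' hv' /eqP nv] : exists2 v', hopf_min x v' & Q v' ord0 i <> Q v ord0 i.
  apply: contrapT => h; apply: nd; apply: (@hopf_lax_derivable _ _ (Q v ord0 i)) => v' hv'.
  by apply: contrapT => h'; apply: h; exists v'.
wlog lt : v v' hv hv' nv / Q v ord0 i < Q v' ord0 i.
  move=> W; case: (ltgtP (Q v ord0 i) (Q v' ord0 i)) => [||e]; first exact: W.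
    by apply: W => //; rewrite eq_sym.
  by rewrite e eqxx in nv.
have [b] := rat_in_itvoo lt; rewrite inE /= => /itvP hb.
have qb : Q v ord0 i < ratr b by rewrite hb.
have [a] := rat_in_itvoo qb; rewrite inE /= => /itvP ha.
have qa : Q v ord0 i < ratr a by rewrite ha.
have bq : ratr b < Q v' ord0 i by rewrite hb.
have ea : 0 < ratr a - Q v ord0 i by rewrite subr_gt0.
have eb : 0 < Q v' ord0 i - ratr b by rewrite subr_gt0.
have [d d0 hd] := argmax_coord_near v i ea.
have [d' d'0 hd'] := argmax_coord_near v' i eb.
pose m := Num.min d d'.
have m0 : 0 < m by rewrite lt_min d0.
exists a, b, (Num.truncn m^-1); split; first by rewrite ha.
move=> h /andP[h0 hk].
have hm : h < m.
  apply: lt_le_trans hk _; rewrite invf_ple ?posrE// ltW// truncnS_gt//.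
have [h1 h2] : h < d /\ h < d' by move: hm; rewrite lt_min => /andP[].
have nh : `|h| = h by rewrite gtr0_norm.
have nh' : `|- h| = h by rewrite normrN.
have := hd h; rewrite nh => /(_ h1); rewrite ltr_norml => /andP[_ k1].
have := hd' (- h); rewrite nh' => /(_ h2); rewrite ltr_norml => /andP[k2 _].
split.
  apply: le_trans (hopf_lax_coord_le h i hv) _; rewrite ler_pM2l//; lra.
rewrite -scaleNr; apply: le_trans (hopf_lax_coord_le (- h) i hv') _.
rewrite mulNr lerN2 ler_pM2l//; lra.
Qed.

Let w_cont : continuous w.
Proof. exact: hopf_lax_continuous. Qed.

Let w_kink (i : 'I_n) := @kink_null R n w i w_cont (fun x => @hopf_lax_kink x i).

Lemma measurable_hopf_gradient (i : 'I_n) :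
  measurable_fun setT (fun x => gradient w x ord0 i).
Proof.
rewrite (_ : (fun x => _) = partial w i); last by apply/funext => x; rewrite mxE.
by apply: measurable_partial => //; exact: (w_kink i).1.
Qed.

Lemma ae_hopf_gradient : \forall x \ae mu,
  forall v, hopf_min x v -> gradient w x = Q v.
Proof.
have h : \forall x \ae mu, forall i : 'I_n, derivable w x (delta_mx ord0 i).
  by apply: filter_forall => i; exact: (w_kink i).2.
apply: filterS h => x hx v hv; apply/rowP => i; rewrite mxE.
exact: (hopf_lax_derive hv (hx i)).
Qed.

End hopf.

Local Opaque hopf_lax legendre argmax.

(** * Bounds by the maximal function and convergence in L^p *)

Context (n_gt0 : (0 < n)%N) (p s : R) (n_lt_s : n%:R < s) (s_lt_p : s < p).

Definition maxgrad (Du : vec -> vec) : vec -> \bar R :=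
  maxfun (fun z => enorm (Du z) `^ s).

Let s0 : 0 < s.
Proof. exact: le_lt_trans n_lt_s. Qed.

Let p0 : 0 < p.
Proof. exact: lt_trans s_lt_p. Qed.

Lemma maxgrad_ge0 Du x : (0 <= maxgrad Du x)%E.
Proof. by apply: maxfun_ge0 => z; exact: powR_ge0. Qed.

Lemma sobolev_increment_bound : exists2 C : R, 0 < C &
  forall (u : vec -> R) Du, continuous u -> sobolev_W1 p u Du ->
  forall t x v A, 0 < t -> hopf_min u t x v -> 0 < A ->
    (maxgrad Du x <= (A `^ s)%:E)%E -> L v <= C * A * enorm v.
Proof.
have [C C0 hC] := sobolev_lipschitz n_gt0 n_lt_s s_lt_p.
exists C => // u Du cu su t x v A t0 hv A0 hM.
have := hv 0; rewrite /hopf_cost scaler0 subr0 legendre0 mulr0 addr0.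
have /ler_normlP[_] := hC u Du cu su x (x - t *: v) A A0 hM.
rewrite subKr; move: (L v) (u x) (u _) => l a b h1 h2.
have h3 : `|t *: v| <= t * enorm v.
  by apply: le_trans (norm_le_enorm _) _; rewrite enormZ gtr0_norm.
rewrite -(ler_pM2l t0); apply: (@le_trans _ _ (C * `|t *: v| * A)); first by lra.
rewrite [leRHS](_ : _ = C * (t * enorm v) * A); last by ring.
by rewrite ler_pM2r// ler_pM2l.
Qed.

(** [argmax_growth] gives |Q v| |v| <= K C A |v|, to be divided by |v|; for v = 0 the claim holds
    because [Q 0 = 0]. *)
Lemma argmax_hopf_bound : exists2 K : R, 0 < K &
  forall (u : vec -> R) Du, continuous u -> sobolev_W1 p u Du ->
  forall t x v A, 0 < t -> hopf_min u t x v -> 0 < A ->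
    (maxgrad Du x <= (A `^ s)%:E)%E -> enorm (Q v) <= K * A.
Proof.
have [C C0 hC] := sobolev_increment_bound.
have [K K0 hK] := argmax_growth.
exists (K * C) => [|u Du cu su t x v A t0 hv A0 hM]; first exact: mulr_gt0.
have [->|v0] := eqVneq v 0.
  by rewrite argmax0 enorm0 !mulr_ge0// ltW.
have ev := enorm_gt0 v0; rewrite -(ler_pM2r ev); apply: le_trans (hK v) _.
rewrite -!mulrA ler_pM2l// mulrA; exact: (hC u Du cu su t x v A).
Qed.

(** Since [A] has to be positive and finite, M^(1/s) cannot always be inserted: for M = 0
    arbitrarily small [A] are admissible, and for infinite M the right-hand side is infinite. *)
Lemma le_maxgrad_powR Du x (e K : R) : 0 <= e -> 0 < K ->
  (forall A, 0 < A -> (maxgrad Du x <= (A `^ s)%:E)%E -> e <= K * A) ->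
  ((e `^ p)%:E <= (K `^ p)%:E * maxgrad Du x `^ (p / s))%E.
Proof.
move=> e0 K0; have := maxgrad_ge0 Du x; case: (maxgrad Du x) => [m| |] // m0 h; last first.
  by rewrite poweRyr ?gt_eqF ?divr_gt0// gt0_muley ?leey// lte_fin powR_gt0.
rewrite lee_fin in m0; rewrite poweR_EFin -EFinM lee_fin.
have [m00|m_neq0] := eqVneq m 0.
  have -> : e = 0.
    apply/eqP; rewrite eq_le e0 andbT; apply/ler_addgt0Pr => d d0; rewrite add0r.
    have := h (d / K); rewrite mulrCA divff ?gt_eqF// mulr1; apply; first exact: divr_gt0.
    by rewrite m00 lee_fin powR_ge0.
  by rewrite powR0 ?gt_eqF// mulr_ge0 ?powR_ge0.
have m1 : 0 < m by rewrite lt_neqAle eq_sym m_neq0.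
have := h (m `^ s^-1); rewrite powR_gt0// => /(_ isT).
rewrite -powRrM mulVf ?gt_eqF// powRr1// lexx => /(_ isT) hm.
apply: (@le_trans _ _ ((K * m `^ s^-1) `^ p)).
  by rewrite ge0_ler_powR ?nnegrE ?(ltW p0)// mulr_ge0 ?powR_ge0// ltW.
by rewrite powRM ?powR_ge0 ?(ltW K0)// -powRrM [s^-1 * p]mulrC.
Qed.

(** The strong inequality with exponent p/s > 1, applied to |Du|^s. *)
Lemma maxgrad_integral : exists2 C : R, 0 <= C &
  forall Du, Lp_vec p Du -> (\int[mu]_x (maxgrad Du x `^ (p / s)) <=
    C%:E * \int[mu]_x (enorm (Du x) `^ p)%:E)%E.
Proof.
have q1 : 1 < p / s by rewrite ltr_pdivlMr// mul1r.
have [C C0 hC] := @strong_type R n _ q1; exists C => // Du /(Lp_vecP _ p0)[mDu _].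
have E : (\int[mu]_x ((enorm (Du x) `^ s) `^ (p / s))%:E = \int[mu]_x (enorm (Du x) `^ p)%:E)%E.
  by apply: eq_integral => x _; rewrite -powRrM mulrCA divff ?gt_eqF// mulr1.
rewrite -E; apply: hC; last by move=> x; exact: powR_ge0.
by apply/measurable_EFinP; exact: (measurable_enorm_powR s mDu).
Qed.

Lemma measurable_maxgrad_powR Du (q : R) :
  measurable_fun setT (fun x => (maxgrad Du x `^ q)%E).
Proof. by apply: measurableT_comp (measurable_poweR q) _; exact: measurable_maxfun. Qed.

Lemma ae_hopf_gradient_le : exists2 K : R, 0 < K &
  forall (u : vec -> R) Du B, continuous u -> (forall x, `|u x| <= B) -> sobolev_W1 p u Du ->
  forall t, 0 < t -> \forall x \ae mu,
    ((enorm (gradient (hopf_lax H u t) x) `^ p)%:E <=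
      (K `^ p)%:E * maxgrad Du x `^ (p / s))%E.
Proof.
have [K K0 hK] := argmax_hopf_bound.
exists K => // u Du B cu bu su t t0.
apply: filterS (ae_hopf_gradient cu bu t0).
move=> x hx; have [v hv] := exists_hopf_min cu bu t0 x.
rewrite (hx v hv); apply: le_maxgrad_powR => //; first exact: enorm_ge0.
by move=> A A0 hA; exact: (hK u Du cu su t x v A).
Qed.

Lemma hopf_gradient_integral_le : exists2 K : R, 0 <= K &
  forall (u : vec -> R) Du B, continuous u -> (forall x, `|u x| <= B) -> sobolev_W1 p u Du ->
  forall t, 0 < t ->
    (\int[mu]_x (enorm (gradient (hopf_lax H u t) x) `^ p)%:E <=
     K%:E * \int[mu]_x (enorm (Du x) `^ p)%:E)%E.
Proof.
have [K K0 hK] := ae_hopf_gradient_le.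
have [C C0 hC] := maxgrad_integral.
exists (K `^ p * C) => [|u Du B cu bu su t t0]; first by rewrite mulr_ge0// powR_ge0.
have [_ LDu _] := su.
have mg := measurable_hopf_gradient cu bu t0.
apply: (@le_trans _ _ (\int[mu]_x ((K `^ p)%:E * maxgrad Du x `^ (p / s)))%E).
  apply: ae_ge0_le_integral => //.
  - by move=> x _; rewrite lee_fin powR_ge0.
  - exact: (measurable_enorm_powR p mg).
  - by move=> x _; rewrite mule_ge0 ?poweR_ge0// lee_fin powR_ge0.
  - by apply: measurable_funeM; exact: measurable_maxgrad_powR.
  - by apply: filterS (hK u Du B cu bu su t t0).
rewrite ge0_integralZl//; last 3 first.
- exact: measurable_maxgrad_powR.
- by move=> x _; exact: poweR_ge0.
- by rewrite lee_fin powR_ge0.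
by rewrite EFinM -muleA lee_wpmul2l ?lee_fin ?powR_ge0//; exact: hC.
Qed.

(* Comparing v with the velocity dual to Du x, at which Fenchel's inequality is an
   equality, shows that v and Du x nearly satisfy that equality too. *)
Lemma argmax_hopf_cvg (u : vec -> R) Du x : continuous u -> sobolev_W1 p u Du ->
  (maxgrad Du x < +oo)%E ->
  (forall e, 0 < e -> exists2 d, 0 < d & forall y, `|y - x| < d ->
     `|u y - u x - dot (Du x) (y - x)| <= e * `|y - x|) ->
  forall e, 0 < e -> exists2 d, 0 < d & forall t v, 0 < t < d -> hopf_min u t x v ->
    enorm (Q v - Du x) < e.
Proof.
move=> cu su Moo dx e e0.
have [C C0 hC] := sobolev_increment_bound.
have [A A0 hA] : exists2 A, 0 < A & (maxgrad Du x <= (A `^ s)%:E)%E.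
  have := maxgrad_ge0 Du x; move: Moo; case: (maxgrad Du x) => [m| |]// _ m0.
  exists ((m + 1) `^ s^-1); first by rewrite powR_gt0// ltr_wpDl.
  by rewrite -powRrM mulVf ?gt_eqF// powRr1 ?lee_fin ?lerDl// addr_ge0.
have CA0 : 0 <= C * A + 1 by rewrite addr_ge0// mulr_ge0// ltW.
(* L(v) is at least (C A + 1) |v| - c, and minimality bounds it by C A |v|; so |v| <= c, whatever
   [t] is. *)
have [c hc] := legendre_coercive CA0.
have [d1 d10 hd1] := argmax_stable (Du x) c e0.
have [v0 hv0] := exists_fenchel_dual (Du x).
pose rho := `|c| + enorm v0.
have rho0 : 0 <= rho by rewrite addr_ge0// enorm_ge0.
have r1 : 0 < rho + 1 by rewrite ltr_wpDl.
(* With this accuracy eta of the linear approximation, the total error eta t (|v| + |v0|) stays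
   below [t * d1], the defect tolerated by [argmax_stable]. *)
have eta0 : 0 < d1 / (rho + 1) by rewrite divr_gt0.
have [d d0 hd] := dx _ eta0.
exists (d / (rho + 1)) => [|t v /andP[t0 td] hv]; first exact: divr_gt0.
have Lv := hC u Du cu su t x v A t0 hv A0 hA.
have vc : enorm v <= c.
  by have := hc v; move: Lv; move: (L v) (enorm v) => l q; lra.
apply: hd1 => //.
have near z : enorm z <= rho ->
    `|u (x - t *: z) - u x + t * dot (Du x) z| <= d1 / (rho + 1) * (t * enorm z).
  move=> zr.
  have tz : `|x - t *: z - x| <= t * enorm z.
    rewrite addrAC subrr sub0r normrN; apply: le_trans (norm_le_enorm _) _.
    by rewrite enormZ gtr0_norm.
  have := hd (x - t *: z); rewrite {2}addrAC subrr sub0r dotNr dotZr opprK => h.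
  apply: le_trans (h _) _; last by rewrite ler_pM2l.
  apply: le_lt_trans tz _; apply: (@le_lt_trans _ _ (t * (rho + 1))).
    by rewrite ler_pM2l//; lra.
  by rewrite -ltr_pdivlMr.
have vr : enorm v <= rho by apply: le_trans vc _; rewrite (le_trans (ler_norm c))// lerDl enorm_ge0.
have v0r : enorm v0 <= rho by rewrite lerDr.
have /ler_normlP[k1 k2] := near _ vr; have /ler_normlP[k3 k4] := near _ v0r.
have := hv v0; rewrite /hopf_cost hv0 => k5.
have vv : enorm v + enorm v0 <= rho.
  by rewrite lerD2r; apply: le_trans vc _; exact: ler_norm.
have lt1 : d1 / (rho + 1) * (enorm v + enorm v0) < d1.
  apply: (@le_lt_trans _ _ (d1 / (rho + 1) * rho)); first by rewrite ler_pM2l.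
  by rewrite -mulrA gtr_pMr// mulrC ltr_pdivrMr// mul1r ltrDl.
rewrite -(ltr_pM2l t0).
have : t * (d1 / (rho + 1) * (enorm v + enorm v0)) < t * d1 by rewrite ltr_pM2l.
move: k1 k2 k3 k4 k5; rewrite !mulrDr !mulrN.
move: (u (x - t *: v)) (u (x - t *: v0)) (dot (Du x) v) (dot (Du x) v0) => a b a1 b1.
move: (u x) (L v) (H (Du x)) (d1 / _) (enorm v) (enorm v0) => ux l h q ev ev0; clear => *.
lra.
Qed.

(** Almost every point qualifies: [u] is differentiable there and the maximal function is finite,
    since its power p/s is integrable. *)
Lemma ae_hopf_cvg (u : vec -> R) Du : continuous u -> sobolev_W1 p u Du ->
  \forall x \ae mu, forall e, 0 < e -> exists2 d, 0 < d & forall t v, 0 < t < d ->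
    hopf_min u t x v -> enorm (Q v - Du x) < e.
Proof.
move=> cu su; have [_ LDu _] := su; have /(Lp_vecP _ p0)[_ Doo] := LDu.
have [C C0 hC] := maxgrad_integral.
have M0 x : (0 <= maxgrad Du x `^ (p / s))%E by exact: poweR_ge0.
have iM : mu.-integrable setT (fun x => (maxgrad Du x `^ (p / s))%E).
  apply/integrableP; split; first exact: measurable_maxgrad_powR.
  under eq_integral do rewrite gee0_abs//.
  by apply: le_lt_trans (hC _ LDu) _; rewrite lte_mul_pinfty.
have hd := sobolev_ae_differentiable n_gt0 (lt_trans n_lt_s s_lt_p) cu su.
apply: filterS2 (integrable_ae measurableT iM) hd => x /(_ I) Mx hx.
apply: argmax_hopf_cvg => //.
apply: (@lty_poweRy _ _ (p / s)); first by rewrite gt_eqF// divr_gt0.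
by rewrite ltey_eq Mx.
Qed.

Lemma hopf_gradient_cvg_seq (u : vec -> R) Du B (t : nat -> R) : continuous u ->
  (forall x, `|u x| <= B) -> sobolev_W1 p u Du ->
  (forall k, 0 < t k) -> t @ \oo --> 0 ->
  (fun k => \int[mu]_x (enorm (gradient (hopf_lax H u (t k)) x - Du x) `^ p)%:E)%E @ \oo --> 0%E.
Proof.
move=> cu bu su t0 tcvg.
have [_ LDu _] := su; have /(Lp_vecP _ p0)[mDu Doo] := LDu.
have [K K0 hK] := ae_hopf_gradient_le.
have [C C0 hC] := maxgrad_integral.
have mg k := measurable_hopf_gradient cu bu (t0 k).
pose M x : \bar R := ((K `^ p)%:E * maxgrad Du x `^ (p / s))%E.
(* The majorant comes from |a - b|^p <= (|a| + |b|)^p <= 2^p (|a|^p + |b|^p); [M] bounds the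
   gradients of all the w(., t) at once. *)
pose D x : \bar R := ((2 `^ p)%:E * (M x + (enorm (Du x) `^ p)%:E))%E.
have mM : measurable_fun setT M by apply: measurable_funeM; exact: measurable_maxgrad_powR.
have M0 x : (0 <= M x)%E by rewrite mule_ge0 ?poweR_ge0// lee_fin powR_ge0.
have D0 x : (0 <= (enorm (Du x) `^ p)%:E)%E by rewrite lee_fin powR_ge0.
have mDp := measurable_enorm_powR p mDu.
have mD : measurable_fun setT D by apply: measurable_funeM; exact: emeasurable_funD.
have iD : mu.-integrable setT D.
  apply/integrableP; split => //.
  have -> : (\int[mu]_x `|D x| = (2 `^ p)%:E * (\int[mu]_x M x + \int[mu]_x (enorm (Du x) `^ p)%:E))%E.
    rewrite -ge0_integralD// -ge0_integralZl//; last 2 first.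
    - exact: emeasurable_funD.
    - by move=> x _; exact: adde_ge0.
    apply: eq_integral => x _; rewrite gee0_abs// mule_ge0 ?adde_ge0// lee_fin powR_ge0.
  rewrite lte_mul_pinfty ?lee_fin ?powR_ge0// lte_add_pinfty//.
  rewrite ge0_integralZl//; last 3 first.
  - exact: measurable_maxgrad_powR.
  - by move=> x _; exact: poweR_ge0.
  - by rewrite lee_fin powR_ge0.
  rewrite lte_mul_pinfty ?lee_fin ?powR_ge0//.
  by apply: le_lt_trans (hC _ LDu) _; rewrite lte_mul_pinfty.
pose f k x : \bar R := (enorm (gradient (hopf_lax H u (t k)) x - Du x) `^ p)%:E.
have mf k : measurable_fun setT (f k).
  apply: measurable_enorm_powR => i.
  rewrite (_ : (fun x => _) = (fun x => gradient (hopf_lax H u (t k)) x ord0 i - Du x ord0 i)).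
    exact: measurable_funB.
  by apply/funext => x; rewrite !mxE.
have cf : \forall x \ae mu, setT x -> f k x @[k --> \oo] --> cst 0%E x.
  have h1 : \forall x \ae mu, forall k v, hopf_min u (t k) x v ->
      gradient (hopf_lax H u (t k)) x = argmax v.
    by apply: ae_foralln => k; exact: (ae_hopf_gradient cu bu (t0 k)).
  have h2 := ae_hopf_cvg cu su.
  apply: filterS2 h1 h2 => x h1 h2 _.
  apply: cvg_EFin; first by apply: nearW.
  apply/cvgrPdist_le => e e0 /=.
  have [d d0 hd] := h2 _ (powR_gt0 p^-1 e0).
  have /cvgrPdist_lt/(_ _ d0) := tcvg; apply: filterS => k; rewrite sub0r normrN gtr0_norm// => td.
  have [v hv] := exists_hopf_min cu bu (t0 k) x.
  rewrite sub0r normrN ger0_norm ?powR_ge0// (h1 k v hv).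
  have := hd (t k) v; rewrite t0 td => /(_ isT hv)/ltW h.
  have := ge0_ler_powR (ltW p0) _ _ h; rewrite !nnegrE enorm_ge0 powR_ge0 => /(_ isT isT).
  by rewrite -powRrM mulVf ?gt_eqF// powRr1// ltW.
have dom : \forall x \ae mu, forall k, setT x -> (`|f k x| <= D x)%E.
  have h1 : \forall x \ae mu, forall k,
      ((enorm (gradient (hopf_lax H u (t k)) x) `^ p)%:E <= M x)%E.
    by apply: ae_foralln => k; exact: (hK u Du B cu bu su (t k) (t0 k)).
  apply: filterS h1 => x h1 k _.
  rewrite gee0_abs ?lee_fin ?powR_ge0//.
  apply: (@le_trans _ _ ((2 `^ p * (enorm (gradient (hopf_lax H u (t k)) x) `^ p + enorm (Du x) `^ p))%:E)).
    rewrite lee_fin; apply: le_trans (powRD_le p0 (enorm_ge0 _) (enorm_ge0 _)).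
    by rewrite ge0_ler_powR ?nnegrE ?(ltW p0) ?addr_ge0 ?enorm_ge0// enormB.
  by rewrite EFinM EFinD lee_wpmul2l ?lee_fin ?powR_ge0// leeD2r.
have [_ _] := dominated_convergence measurableT mf (measurable_cst _) cf iD dom.
by rewrite integral_cst// mul0e.
Qed.

Lemma hopf_gradient_cvg (u : vec -> R) Du B : continuous u ->
  (forall x, `|u x| <= B) -> sobolev_W1 p u Du ->
  Lp_vec_norm p (fun x => gradient (hopf_lax H u t) x - Du x) @[t --> 0^'+] --> 0%E.
Proof.
move=> cu bu su.
pose I t : \bar R := (\int[mu]_x (enorm (gradient (hopf_lax H u t) x - Du x) `^ p)%:E)%E.
have I0 t : (0 <= I t)%E by apply: integral_ge0 => x _; rewrite lee_fin powR_ge0.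
have small e : 0 < e -> \forall t \near 0^'+, (I t <= e%:E)%E.
  (* Otherwise [e] is exceeded for arbitrarily small [t], and a sequence of such values with t_k <
     1/(k+1) contradicts the convergence along sequences. *)
  move=> e0; apply: contrapT => hn.
  have ht (k : nat) : exists2 t, 0 < t < k.+1%:R^-1 & (e%:E < I t)%E.
    apply: contrapT => h; apply: hn; exists k.+1%:R^-1 => /=; first by rewrite invr_gt0.
    move=> t /= tk t0; rewrite leNgt; apply/negP => It; apply: h; exists t => //.
    by rewrite t0/=; move: tk; rewrite sub0r normrN gtr0_norm.
  have [t ht1 ht2] : exists2 t : nat -> R, forall k, 0 < t k < k.+1%:R^-1 &
      forall k, (e%:E < I (t k))%E.
    have [t h] := choice (fun k => let: ex_intro2 t h1 h2 := ht k in ex_intro (fun t => 0 < t < k.+1%:R^-1 /\ (e%:E < I t)%E) t (conj h1 h2)).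
    by exists t => k; have [] := h k.
  have t0 k : 0 < t k by have /andP[] := ht1 k.
  have tcvg : t @ \oo --> 0.
    apply: (@squeeze_cvgr _ _ _ _ (cst 0) (fun k => k.+1%:R^-1)).
    - by apply: nearW => k; have /andP[h1 h2] := ht1 k; rewrite !ltW.
    - exact: cvg_cst.
    - exact: cvg_harmonic.
  have := hopf_gradient_cvg_seq cu bu su t0 tcvg; rewrite -/I.
  move=> /fine_cvgP[ff /cvgrPdist_lt/(_ _ e0) cI].
  have [k _ /(_ k (leqnn k))/= [fk Ik]] := filterI ff cI.
  move: Ik; rewrite sub0r normrN -/(I (t k)) (ger0_norm (fine_ge0 (I0 (t k)))) => Ik.
  have h := ht2 k; rewrite -lte_fin fineK in Ik; last exact: fk.
  by have := lt_trans Ik h; rewrite ltxx.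
pose N t := Lp_vec_norm p (fun x => gradient (hopf_lax H u t) x - Du x).
have N0 t : (0 <= N t)%E by rewrite /N Lp_vec_normE poweR_ge0.
have Ne e : 0 < e -> \forall t \near 0^'+, (N t <= e%:E)%E.
  move=> e0; apply: filterS (small _ (powR_gt0 p e0)) => t h.
  by rewrite /N Lp_vec_normE; exact: (le_poweR_inv p0 (ltW e0) (I0 t) h).
have fin : \forall t \near 0^'+, N t \is a fin_num.
  apply: filterS (Ne 1 ltr01) => t h; rewrite ge0_fin_numE//.
  by apply: le_lt_trans h _; rewrite ltry.
apply/fine_cvgP; split => //; apply/cvgrPdist_le => e e0 /=.
apply: filterS2 fin (Ne e e0) => t ft h.
by rewrite sub0r normrN -/(N t) (ger0_norm (fine_ge0 (N0 t))) -lee_fin fineK.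
Qed.

End hamiltonian.

Theorem corollary1p2 (R : realType) (n : nat) (n_ge1 : (1 <= n)%N)
    (p : R) (n_lt_p : n%:R < p)
    (H : 'rV[R]_n -> R)
    (H_ge0 : forall x, 0 <= H x)
    (H_convex : strictly_convex H)
    (H_C1 : class_C 1 H)
    (H0 : H 0 = 0)
    (DH0 : gradient H 0 = 0)
    (H_superlinear : superlinear H)
    (H_doubling : exists2 C : R, 1 < C &
       forall x, x != 0 -> H (2 *: x) / H x > 2 * C)
    (H_spheres : exists2 C' : R, 1 < C' &
       forall r : R, 0 < r ->
         sup (H @` boundary (eball r)) < C' * inf (H @` boundary (eball r))) :
  (forall (u : 'rV[R]_n -> R) (Du : 'rV[R]_n -> 'rV[R]_n),
     continuous u -> bounded_fun u -> sobolev_W1 p u Du ->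
     (forall t : R, 0 < t -> Lp_vec p (gradient (hopf_lax H u t))) /\
     Lp_vec_norm p (fun x => gradient (hopf_lax H u t) x - Du x)
       @[t --> 0^'+] --> 0%E) /\
  (exists K : R, forall (u : 'rV[R]_n -> R) (Du : 'rV[R]_n -> 'rV[R]_n),
     continuous u -> bounded_fun u -> sobolev_W1 p u Du ->
     forall t : R, 0 < t ->
       (Lp_vec_norm p (gradient (hopf_lax H u t)) <=
        K%:E * Lp_vec_norm p Du)%E).
Proof.
have p0 : 0 < p by exact: le_lt_trans n_lt_p.
(* The midpoint of [n] and [p] serves as the intermediate exponent s, so the constants depend on p,
   n and H only. *)
have n_lt_s : n%:R < (n%:R + p) / 2 by have [] := midf_lt n_lt_p.
have s_lt_p : (n%:R + p) / 2 < p by have [] := midf_lt n_lt_p.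
have bd (u : 'rV[R]_n -> R) : bounded_fun u -> exists B, forall x, `|u x| <= B.
  by move=> [M [_ hM]]; exists (M + 1) => x; apply: hM => //; rewrite ltrDl.
have [K K0 hK] := hopf_gradient_integral_le H_ge0 H_convex H_C1 H0 H_superlinear
  H_doubling H_spheres n_ge1 n_lt_s s_lt_p.
split.
  move=> u Du cu /bd[B bu] su; split; last first.
    exact: (hopf_gradient_cvg H_ge0 H_convex H_C1 H0 H_superlinear
      H_doubling H_spheres n_ge1 n_lt_s s_lt_p cu bu su).
  move=> t t0; apply/(Lp_vecP _ p0); split.
    exact: (measurable_hopf_gradient H_ge0 H_convex H_C1 H0 H_superlinear cu bu t0).
  have [_ /(Lp_vecP _ p0)[_ Doo] _] := su.
  by apply: le_lt_trans (hK u Du B cu bu su t t0) _; rewrite lte_mul_pinfty.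
(* [K] bounds the integrals of the powers p; the norms are their roots of order p. *)
exists (K `^ p^-1) => u Du cu /bd[B bu] su t t0; rewrite !Lp_vec_normE.
have I0 G : (0 <= \int[lebesgue_rV n]_x (enorm (G x) `^ p)%:E)%E.
  by apply: integral_ge0 => x _; rewrite lee_fin powR_ge0.
rewrite -poweR_EFin -poweRM ?lee_fin//.
have pV : 0 <= p^-1 by rewrite invr_ge0 ltW.
apply: (gt0_ler_poweR pV); rewrite ?in_itv /= ?leey ?andbT ?mule_ge0 ?lee_fin//.
exact: (hK u Du B cu bu su t t0).
Qed.
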